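(* There exists a polynomial-time algorithm that finds a locally optimal solution to a rational instance of the bilevel linear program $$\min_{x_1,x_2}\ c_{21}^{\top}x_1+c_{22}x_2\quad\text{s.t.}\quad x_1\in\operatorname{argmin}_{x_1'}\{c_{11}^{\top}x_1' : A_{11}x_1'+A_{12}x_2\ge b_1,\ \mathbf{0}\le x_1'\le\mathbf{1},\ 0\le x_2\le 1\},$$ where $c_{11},c_{21}\in\mathbb{Q}^{n}$, $c_{22}\in\mathbb{Q}$, $A_{11}\in\mathbb{Q}^{m\times n}$, $A_{12},b_1\in\mathbb{Q}^{m}$, and $x_2\in\mathbb{R}$ is the single upper-level variable.
   Context: A pair $(x_1,x_2)\in\mathbb{R}^n\times\mathbb{R}$ is feasible for the bilevel program if and only if $x_1$ is an optimal solution of the lower-level linear program with parameter $x_2$ (if $x_2\notin[0,1]$ the lower-level problem is infeasible, so such $x_2$ occurs in no feasible pair). Let $\mathcal{F}$ be the set of feasible pairs. A pair $(\bar x_1,\bar x_2)\in\mathbb{R}^{n+1}$ is a locally optimal solution if $(\bar x_1,\bar x_2)\in\mathcal{F}$ and there exists $\epsilon>0$ such that $c_{21}^{\top}\bar x_1+c_{22}\bar x_2\le c_{21}^{\top}x_1+c_{22}x_2$ for all $(x_1,x_2)\in\mathcal{F}$ with $\|(x_1,x_2)-(\bar x_1,\bar x_2)\|_\infty\le\epsilon$. An instance is rational if all its data are rational numbers. Data are encoded in binary, and polynomial time is with respect to the binary encoding size of the instance. $\mathbf{0}$ and $\mathbf{1}$ are the all-zeros and all-ones vectors. *)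

(* Defs.v *)
From HB Require Import structures.
From Stdlib Require Import BinNums.
From mathcomp Require Import all_boot all_order all_algebra.
From mathcomp Require Import reals prodnormedzmodule topology normedtype.
Set Implicit Arguments.
Unset Strict Implicit.
Unset Printing Implicit Defensive.
Import Order.TTheory GRing.Theory Num.Theory.
Import numFieldNormedType.Exports.
Local Open Scope ring_scope.

Inductive move := MoveLeft | Stay | MoveRight.

(* A two-way infinite tape [(l, r)]: [r] lists the scanned cell and the cells to
   its right, [l] the cells to its left, nearest first; the cells that are not
   listed are blank, and [None] is the blank symbol. *)
Definition tape (S : Type) : Type := seq (option S) * seq (option S).

Definition tape_read (S : Type) (t : tape S) : option S := head None t.2.

Definition tape_write (S : Type) (a : option S) (t : tape S) : tape S :=
  (t.1, a :: behead t.2).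

Definition tape_move (S : Type) (d : move) (t : tape S) : tape S :=
  match d with
  | MoveLeft => (behead t.1, head None t.1 :: t.2)
  | Stay => t
  | MoveRight => (head None t.2 :: t.1, behead t.2)
  end.

(* The word [w] starts at the scanned cell and is followed by blanks only. *)
Definition tape_holds (S : Type) (t : tape S) (w : seq S) : Prop :=
  forall i : nat, nth None t.2 i = onth w i.

(* The machine has [tm_work] work tapes besides tape [ord0], which initially
   holds the input and finally the output; it halts when the transition function
   returns [None]. *)
Record turing_machine (S : finType) : Type := TuringMachine {
  tm_state : finType;
  tm_work : nat;
  tm_start : tm_state;
  tm_delta : tm_state -> {ffun 'I_tm_work.+1 -> option S} ->
    option (tm_state * {ffun 'I_tm_work.+1 -> option S * move})
}.

Section Run.
Variables (S : finType) (M : turing_machine S).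

Definition tm_config : Type :=
  tm_state M * {ffun 'I_(tm_work M).+1 -> tape S}.

Definition tm_init (w : seq S) : tm_config :=
  (tm_start M,
   [ffun i => if i == ord0 then ([::], [seq Some a | a <- w]) else ([::], [::])]).

Definition tm_step (c : tm_config) : option tm_config :=
  if tm_delta c.1 [ffun i => tape_read (c.2 i)] is Some (q, act) then
    Some (q, [ffun i => tape_move (act i).2 (tape_write (act i).1 (c.2 i))])
  else None.

Fixpoint tm_run (t : nat) (c : tm_config) : tm_config :=
  if t is t'.+1 then
    if tm_step c is Some c' then tm_run t' c' else c
  else c.

Definition tm_outputs_within (w : seq S) (t : nat) (v : seq S) : Prop :=
  let c := tm_run t (tm_init w) in
  tm_step c = None /\ tape_holds (c.2 ord0) v.

End Run.

Inductive symbol := Bit of bool | Sep.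

Definition symbol_code (s : symbol) : option bool :=
  if s is Bit b then Some b else None.
Definition symbol_decode (o : option bool) : symbol :=
  if o is Some b then Bit b else Sep.
Lemma symbol_codeK : cancel symbol_code symbol_decode.
Proof. by case. Qed.

HB.instance Definition _ := Finite.copy symbol (can_type symbol_codeK).

(* Binary digits, least significant first; 0 has no digit. *)
Fixpoint pos_bits (p : positive) : seq bool :=
  match p with
  | xH => [:: true]
  | xO p' => false :: pos_bits p'
  | xI p' => true :: pos_bits p'
  end.

Definition nat_bits (n : nat) : seq bool :=
  if bin_of_nat n is Npos p then pos_bits p else [::].

(* Sign bit (set for negative numbers), digits of the absolute value,
   separator. *)
Definition encode_int (z : int) : seq symbol :=
  rcons [seq Bit b | b <- (z < 0) :: nat_bits `|z|%N] Sep.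

Definition encode_rat (q : rat) : seq symbol :=
  encode_int (numq q) ++ encode_int (denq q).

(* Entries in row-major order. *)
Definition encode_mx (m n : nat) (A : 'M[rat]_(m, n)) : seq symbol :=
  flatten [seq flatten [seq encode_rat (A i j) | j <- enum 'I_n]
          | i <- enum 'I_m].

Record bilevel := Bilevel {
  nvar : nat;
  ncon : nat;
  c11 : 'cV[rat]_nvar;
  c21 : 'cV[rat]_nvar;
  c22 : rat;
  A11 : 'M[rat]_(ncon, nvar);
  A12 : 'cV[rat]_ncon;
  b1 : 'cV[rat]_ncon
}.

Definition encode_bilevel (I : bilevel) : seq symbol :=
  encode_int (nvar I) ++ encode_int (ncon I) ++
  encode_mx (c11 I) ++ encode_mx (c21 I) ++ encode_rat (c22 I) ++
  encode_mx (A11 I) ++ encode_mx (A12 I) ++ encode_mx (b1 I).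

(* The empty word, which encodes no pair, stands for "infeasible". *)
Definition encode_answer (n : nat) (o : option ('cV[rat]_n * rat)) :
    seq symbol :=
  if o is Some (x1, x2) then encode_mx x1 ++ encode_rat x2 else [::].

Section Semantics.
Variables (R : realType) (I : bilevel).

Definition dot (n : nat) (c : 'cV[rat]_n) (x : 'cV[R]_n) : R :=
  \sum_(i < n) ratr (c i 0) * x i 0.

Definition lower_feasible (x2 : R) (x1 : 'cV[R]_(nvar I)) : Prop :=
  [/\ forall i : 'I_(ncon I),
        ratr (b1 I i 0) <=
        (map_mx ratr (A11 I) *m x1) i 0 + ratr (A12 I i 0) * x2,
      forall j : 'I_(nvar I), 0 <= x1 j 0 <= 1
    & 0 <= x2 <= 1].

Definition lower_optimal (x2 : R) (x1 : 'cV[R]_(nvar I)) : Prop :=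
  lower_feasible x2 x1 /\
  forall x1' : 'cV[R]_(nvar I),
    lower_feasible x2 x1' -> dot (c11 I) x1 <= dot (c11 I) x1'.

Definition bilevel_feasible (x : 'cV[R]_(nvar I) * R) : Prop :=
  lower_optimal x.2 x.1.

Definition upper_objective (x : 'cV[R]_(nvar I) * R) : R :=
  dot (c21 I) x.1 + ratr (c22 I) * x.2.

(* The norm on matrices and on pairs is the maximum norm. *)
Definition locally_optimal (xbar : 'cV[R]_(nvar I) * R) : Prop :=
  bilevel_feasible xbar /\
  exists2 eps : R, 0 < eps &
    forall x : 'cV[R]_(nvar I) * R,
      bilevel_feasible x -> `|x - xbar| <= eps ->
      upper_objective xbar <= upper_objective x.

End Semantics.

(* Main.v *)
From HB Require Import structures.
From Stdlib Require Import BinNums.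
Require Import Defs.
From mathcomp Require Import all_boot all_order all_algebra fingroup perm.
From mathcomp Require Import zify ring lra.
Set Implicit Arguments.
Unset Strict Implicit.
Unset Printing Implicit Defensive.

(** Let v(x2) be the optimal value of the lower level, a convex piecewise linear
    function on an interval [l, u].  A pair is feasible if and only if x1 satisfies
    the lower-level constraints and c11 . x1 <= v(x2), so over a piece of v that is
    linear the upper level is a linear program.  The number of pieces may be
    exponential, but only one of them has to be found.  The pieces of v come from
    basic dual solutions, whose entries have polynomially many bits; hence two
    breakpoints of v are never closer than 2^-K for some polynomial K.  Cut [l, u]
    into slightly more than 2^K cells, so that two adjacent cells contain at most one
    breakpoint.  Let phi(i) be the best upper-level value above the i-th grid point.
    A binary search finds an i with phi(i) <= phi(i-1) and phi(i) <= phi(i+1); the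
    breakpoint between the grid points i-1 and i+1, if any, minimizes v tilted by the
    slope of the chord, and the best feasible point above these two cells is the
    solution of two linear programs.  If it is strictly better than phi(i), it
    lies strictly between the neighbouring grid points (unless these are l or u), and
    otherwise a point above the i-th grid point is optimal there; either way it is
    locally optimal.

    Linear programs are solved through their homogeneous self-dual system by a
    rescaled perceptron method in the spirit of Chubanov: the perceptron either finds
    a positive vector of the kernel or proves that a coordinate is at most 1/2 in the
    current box, in which case this coordinate is rescaled; a coordinate that is
    thereby forced below the entries of all small integral kernel vectors is zero.

    Running times are handled by closing a class of functions on binary trees,
    computed by programs over four stacks, under composition and bounded iteration;
    such a program is compiled to a Turing machine with one tape per stack. *)

(** * Programs over four stacks and their compilation to Turing machines *)

(** Lower-level optimality is not a linear condition, but on a piece where v is affine it becomes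
    one, and a line below v that touches it at both ends of the piece proves this. The function phi
    need not be convex, so the search asks nothing of it but comparisons of neighbours. Above each
    parameter the linear programs optimize over all of x1; local optimality is thus obtained in a
    stronger form, where only x2 is confined to a neighbourhood.

    Competitors are real while the algorithm computes with rationals: a rational dual solution
    remains a certificate over the reals, so it is enough to transfer weak duality.

    The self-dual system suits the solver because a nonnegative kernel vector of maximal support
    decides solvability by its homogenizing coordinate: if positive, dividing by it gives primal and
    dual solutions without gap; if zero, no such pair exists. The bound n! B^n on integral kernel
    vectors of small support serves twice: to decide when a coordinate may be declared zero, and to
    bound the lines that make up v. *)

Definition cell := option symbol.

Inductive reg := R0 | R1 | R2 | R3.

Definition reg_ord (r : reg) : 'I_4 :=
  match r with
  | R0 => ord0 | R1 => inord 1 | R2 => inord 2 | R3 => inord 3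
  end.

Lemma reg_ord_inj : injective reg_ord.
Proof.
by case=> [] [] //= /(congr1 val); rewrite /= ?inordK.
Qed.

Definition reg_code (r : reg) : nat :=
  match r with R0 => 0 | R1 => 1 | R2 => 2 | R3 => 3 end.
Definition reg_decode (n : nat) : reg :=
  match n with 0 => R0 | 1 => R1 | 2 => R2 | _ => R3 end.
Lemma reg_codeK : cancel reg_code reg_decode. Proof. by case. Qed.
HB.instance Definition _ := Equality.copy reg (can_type reg_codeK).

Inductive prog :=
  | Push of reg & symbol
  | Pop of reg
  | Seq of prog & prog
  | If of reg & (cell -> bool) & prog & prog
  | While of reg & (cell -> bool) & prog.

Inductive stacks := Stacks (s0 s1 s2 s3 : seq symbol).

Definition get (st : stacks) (r : reg) : seq symbol :=
  let: Stacks s0 s1 s2 s3 := st in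
  match r with R0 => s0 | R1 => s1 | R2 => s2 | R3 => s3 end.

Definition upd (st : stacks) (r : reg) (w : seq symbol) : stacks :=
  let: Stacks s0 s1 s2 s3 := st in
  match r with
  | R0 => Stacks w s1 s2 s3 | R1 => Stacks s0 w s2 s3
  | R2 => Stacks s0 s1 w s3 | R3 => Stacks s0 s1 s2 w
  end.

Lemma get_upd st i w j : get (upd st i w) j = if j == i then w else get st j.
Proof. by case: st i j => s0 s1 s2 s3 [] []. Qed.

Definition top (st : stacks) (r : reg) : cell := ohead (get st r).

Section Compilation.
Implicit Types (i : reg) (P : cell -> bool).

(** The number counts the transitions of the compiled machine. A push takes two of them, because a
    transition writes before it moves; every test takes one. *)
Inductive exec : prog -> stacks -> nat -> stacks -> Prop :=
  | exec_push i s st : exec (Push i s) st 2 (upd st i (s :: get st i))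
  | exec_pop i st : exec (Pop i) st 1 (upd st i (behead (get st i)))
  | exec_seq p q st1 t1 st2 t2 st3 :
      exec p st1 t1 st2 -> exec q st2 t2 st3 -> exec (Seq p q) st1 (t1 + t2) st3
  | exec_if_true i P p q st t st' :
      P (top st i) -> exec p st t st' -> exec (If i P p q) st t.+1 st'
  | exec_if_false i P p q st t st' :
      ~~ P (top st i) -> exec q st t st' -> exec (If i P p q) st t.+1 st'
  | exec_while_true i P p st t1 st1 t2 st2 :
      P (top st i) -> exec p st t1 st1 -> exec (While i P p) st1 t2 st2 ->
      exec (While i P p) st (t1 + t2).+1 st2
  | exec_while_false i P p st :
      ~~ P (top st i) -> exec (While i P p) st 1 st.

Fixpoint pstate (p : prog) : finType :=
  match p with
  | Push _ _ => bool
  | Pop _ => unit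
  | Seq p q => (pstate p + pstate q)%type
  | If _ _ p q => option (pstate p + pstate q)%type
  | While _ _ p => option (pstate p)
  end.

Fixpoint pstart (p : prog) : pstate p :=
  match p return pstate p with
  | Push _ _ => false
  | Pop _ => tt
  | Seq p q => inl (pstart p)
  | If _ _ _ _ => None
  | While _ _ _ => None
  end.

Definition heads := {ffun 'I_4 -> cell}.
Definition action := {ffun 'I_4 -> cell * move}.

Definition act_on (h : heads) i (a : cell) (d : move) : action :=
  [ffun j => if j == reg_ord i then (a, d) else (h j, Stay)].

Definition no_act (h : heads) : action := [ffun j => (h j, Stay)].

(* The target state [None] means that the program has terminated. *)
Fixpoint pdelta (p : prog) : pstate p -> heads -> option (pstate p) * action :=
  match p return pstate p -> heads -> option (pstate p) * action with
  | Push i s => fun x h =>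
      if x then (None, act_on h i (Some s) Stay)
      else (Some true, act_on h i (h (reg_ord i)) MoveLeft)
  | Pop i => fun _ h => (None, act_on h i (h (reg_ord i)) MoveRight)
  | Seq p q => fun x h =>
      match x with
      | inl x => let: (o, a) := pdelta x h in
                 (Some (if o is Some y then inl y else inr (pstart q)), a)
      | inr x => let: (o, a) := pdelta x h in (omap inr o, a)
      end
  | If i P p q => fun x h =>
      match x with
      | None => (Some (Some (if P (h (reg_ord i)) then inl (pstart p)
                             else inr (pstart q))), no_act h)
      | Some (inl x) => let: (o, a) := pdelta x h in
                        (omap (fun y => Some (inl y)) o, a)
      | Some (inr x) => let: (o, a) := pdelta x h in
                        (omap (fun y => Some (inr y)) o, a)
      end
  | While i P p => fun x h =>
      match x with
      | None => (if P (h (reg_ord i)) then Some (Some (pstart p)) else None, no_act h)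
      | Some x => let: (o, a) := pdelta x h in (Some o, a)
      end
  end.

Definition tapes := {ffun 'I_4 -> tape symbol}.
Definition heads_of (T : tapes) : heads := [ffun i => tape_read (T i)].
Definition apply_action (a : action) (T : tapes) : tapes :=
  [ffun i => tape_move (a i).2 (tape_write (a i).1 (T i))].

Inductive runs p : nat -> pstate p -> tapes -> tapes -> Prop :=
  | runs_exit x T : (pdelta x (heads_of T)).1 = None ->
      runs 1 x T (apply_action (pdelta x (heads_of T)).2 T)
  | runs_step t x T y T' : (pdelta x (heads_of T)).1 = Some y ->
      runs t y (apply_action (pdelta x (heads_of T)).2 T) T' ->
      runs t.+1 x T T'.

Lemma runs_seq_inr p q t (x : pstate q) T T' :
  runs t x T T' -> @runs (Seq p q) t (inr x) T T'.
Proof.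
elim=> {t x T T'} [x T e|t x T y T' e _ IH].
  have := @runs_exit (Seq p q) (inr x) T; rewrite /=.
  by case E: (pdelta x _) e => [o a] /= ->; apply.
apply: (@runs_step (Seq p q) _ (inr x) _ (inr y)) => /=.
  by case: (pdelta x _) e => [o a] /= ->.
by case: (pdelta x _) e IH => [o a].
Qed.

Lemma runs_seq p q t1 (x : pstate p) T1 T2 t2 T3 :
  runs t1 x T1 T2 -> runs t2 (pstart q) T2 T3 ->
  @runs (Seq p q) (t1 + t2) (inl x) T1 T3.
Proof.
move=> R1 R2; elim: R1 R2 => {t1 x T1 T2} [x T e|t x T y T' e _ IH] R2.
  apply: (@runs_step (Seq p q) _ (inl x) _ (inr (pstart q))) => /=.
    by case: (pdelta x _) e => [o a] /= ->.
  by case: (pdelta x _) e R2 => [o a] _ R2; apply: runs_seq_inr.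
rewrite addSn; apply: (@runs_step (Seq p q) _ (inl x) _ (inl y)) => /=.
  by case: (pdelta x _) e => [o a] /= ->.
by move: (IH R2); case: (pdelta x _).
Qed.

Lemma runs_if_inl i P p q t (x : pstate p) T T' :
  runs t x T T' -> @runs (If i P p q) t (Some (inl x)) T T'.
Proof.
elim=> {t x T T'} [x T e|t x T y T' e _ IH].
  have := @runs_exit (If i P p q) (Some (inl x)) T; rewrite /=.
  by case E: (pdelta x _) e => [o a] /= ->; apply.
apply: (@runs_step (If i P p q) _ (Some (inl x)) _ (Some (inl y))) => /=.
  by case: (pdelta x _) e => [o a] /= ->.
by case: (pdelta x _) e IH => [o a].
Qed.

Lemma runs_if_inr i P p q t (x : pstate q) T T' :
  runs t x T T' -> @runs (If i P p q) t (Some (inr x)) T T'.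
Proof.
elim=> {t x T T'} [x T e|t x T y T' e _ IH].
  have := @runs_exit (If i P p q) (Some (inr x)) T; rewrite /=.
  by case E: (pdelta x _) e => [o a] /= ->; apply.
apply: (@runs_step (If i P p q) _ (Some (inr x)) _ (Some (inr y))) => /=.
  by case: (pdelta x _) e => [o a] /= ->.
by case: (pdelta x _) e IH => [o a].
Qed.

Lemma runs_while i P p t1 (x : pstate p) T1 T2 t2 T3 :
  runs t1 x T1 T2 -> @runs (While i P p) t2 None T2 T3 ->
  @runs (While i P p) (t1 + t2) (Some x) T1 T3.
Proof.
move=> R1 R2; elim: R1 R2 => {t1 x T1 T2} [x T e|t x T y T' e _ IH] R2.
  apply: (@runs_step (While i P p) _ (Some x) _ None) => /=.
    by case: (pdelta x _) e => [o a] /= ->.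
  by case: (pdelta x _) e R2.
rewrite addSn; apply: (@runs_step (While i P p) _ (Some x) _ (Some y)) => /=.
  by case: (pdelta x _) e => [o a] /= ->.
by move: (IH R2); case: (pdelta x _).
Qed.

(** Popped symbols stay on the tape to the left of the head. [tape_holds] does not look at them, and
    a push overwrites them. *)
Definition represents (st : stacks) (T : tapes) : Prop :=
  forall i, tape_holds (T (reg_ord i)) (get st i).

Lemma represents_top st T i : represents st T -> heads_of T (reg_ord i) = top st i.
Proof.
move=> r; rewrite ffunE /tape_read /top; have := r i 0.
by rewrite -nth0 => ->; rewrite /onth; case: (get st i).
Qed.

(** Writing back the scanned symbol can turn an unlisted blank into a listed one, so the tapes need
    not be equal; only the word they hold is preserved. *)
Lemma read_write (t : tape symbol) d w :
  tape_holds (tape_move d t) w ->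
  tape_holds (tape_move d (tape_write (tape_read t) t)) w.
Proof.
by case: t d => l [|a r] [] h i; have := h i; rewrite /= ?nth_nil;
  case: i => [|[|i]] //=; rewrite ?nth_nil.
Qed.

Lemma tape_holds_pop (t : tape symbol) w : tape_holds t w ->
  tape_holds (tape_move MoveRight (tape_write (tape_read t) t)) (behead w).
Proof.
case: t => l r h k; have := h k.+1.
by case: r w {h} => [|a r] [|c w] /=; rewrite ?nth_nil ?onth0n.
Qed.

Lemma tape_holds_push (t : tape symbol) s w : tape_holds t w ->
  tape_holds (tape_write (Some s)
    (tape_move MoveLeft (tape_write (tape_read t) t))) (s :: w).
Proof.
case: t => l r h [|k] //=; have := h k.
by case: r {h} => [|a r] //=; rewrite ?nth_nil //; case: k => [|k] //=; rewrite nth_nil.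
Qed.

Lemma represents_no_act st T :
  represents st T -> represents st (apply_action (no_act (heads_of T)) T).
Proof.
by move=> r i; rewrite /apply_action /no_act !ffunE /=;
  apply: (read_write (d := Stay)); apply: r.
Qed.

Lemma represents_act st T i a d w :
  represents st T ->
  tape_holds (tape_move d (tape_write a (T (reg_ord i)))) w ->
  represents (upd st i w) (apply_action (act_on (heads_of T) i a d) T).
Proof.
move=> r h j; rewrite get_upd /apply_action /act_on !ffunE (inj_eq reg_ord_inj).
case: eqP => [->//|_] /=; apply: (read_write (d := Stay)); exact: r.
Qed.

Lemma compile_exec p st t st' T : exec p st t st' -> represents st T ->
  exists2 T', runs t (pstart p) T T' & represents st' T'.
Proof.
move=> E; elim: E T => {p st t st'}
  [i s st|i st|p q st1 t1 st2 t2 st3 _ IH1 _ IH2|i P p q st t st' Pi _ IH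
  |i P p q st t st' Pi _ IH|i P p st t1 st1 t2 st2 Pi _ IH1 _ IH2
  |i P p st Pi] T r.
- pose T1 := apply_action (act_on (heads_of T) i (heads_of T (reg_ord i)) MoveLeft) T.
  exists (apply_action (act_on (heads_of T1) i (Some s) Stay) T1).
    exact: (@runs_step (Push i s) _ false _ true) (@runs_exit (Push i s) _ _ _).
  move=> j; rewrite get_upd /apply_action /act_on !ffunE (inj_eq reg_ord_inj).
  case: eqP => [->|_] /=; last by do 2!apply: (read_write (d := Stay)); apply: r.
  exact: tape_holds_push (r i).
- exists (apply_action (act_on (heads_of T) i (heads_of T (reg_ord i)) MoveRight) T).
    exact: (@runs_exit (Pop i)).
  rewrite ffunE; apply: represents_act => //; exact: tape_holds_pop (r i).
- have [T1 R1 r1] := IH1 _ r; have [T2 R2 r2] := IH2 _ r1.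
  by exists T2 => //; apply: runs_seq R1 R2.
- have [T1 R1 r1] := IH _ (represents_no_act r).
  exists T1 => //; apply: (@runs_step (If i P p q) _ None _
    (Some (inl (pstart p)))) => /=; last exact: runs_if_inl.
  by rewrite (represents_top i r) Pi.
- have [T1 R1 r1] := IH _ (represents_no_act r).
  exists T1 => //; apply: (@runs_step (If i P p q) _ None _
    (Some (inr (pstart q)))) => /=; last exact: runs_if_inr.
  by rewrite (represents_top i r) (negPf Pi).
- have [T1 R1 r1] := IH1 _ (represents_no_act r); have [T2 R2 r2] := IH2 _ r1.
  exists T2 => //; apply: (@runs_step (While i P p) _ None _
    (Some (pstart p))) => /=; last exact: runs_while R1 R2.
  by rewrite (represents_top i r) Pi.
- exists (apply_action (no_act (heads_of T)) T); last exact: represents_no_act.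
  by apply: (@runs_exit (While i P p)); rewrite /= (represents_top i r) (negPf Pi).
Qed.

Definition machine_of (p : prog) : turing_machine symbol :=
  @TuringMachine symbol (option (pstate p)) 3 (Some (pstart p))
    (fun x h => if x is Some x then Some (pdelta x h) else None).

Lemma run_machine_of p t (x : pstate p) T T' t' :
  runs t x T T' -> t <= t' ->
  tm_run t' ((Some x, T) : tm_config (machine_of p)) = (None, T').
Proof.
move=> R; elim: R t' => {t x T T'} [x T e|t x T y T' e _ IH] [//|t'] /= le.
  rewrite /tm_step /= -/(heads_of T); case E: (pdelta x _) e => [o a] /= ->.
  by rewrite -/(apply_action a T); case: t' le.
rewrite /tm_step /= -/(heads_of T).
by case E: (pdelta x _) e IH => [o a] /= -> IH; rewrite -/(apply_action a T) IH.
Qed.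

Definition input_stacks (w : seq symbol) : stacks := Stacks w [::] [::] [::].

Lemma machine_of_outputs p w t st t' :
  exec p (input_stacks w) t st -> t <= t' ->
  tm_outputs_within (machine_of p) w t' (get st R0).
Proof.
move=> E le; pose T : tapes := (tm_init (machine_of p) w).2.
have r : represents (input_stacks w) T.
  move=> i k; rewrite /T ffunE -[ord0]/(reg_ord R0) (inj_eq reg_ord_inj).
  by case: i => /=; rewrite ?nth_nil ?onth0n ?onthE.
have [T' R r'] := compile_exec E r.
rewrite /tm_outputs_within; have -> : tm_init (machine_of p) w = (Some (pstart p), T) by [].
by rewrite (run_machine_of R le); split=> //=; apply: (r' R0).
Qed.
End Compilation.

(** * Binary trees on a stack *)

Definition exec_le p st t st' := exists2 t', t' <= t & exec p st t' st'.

Lemma exec_le_seq p q st1 st2 st3 t1 t2 t :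
  exec_le p st1 t1 st2 -> exec_le q st2 t2 st3 -> t1 + t2 <= t ->
  exec_le (Seq p q) st1 t st3.
Proof.
move=> [u1 l1 e1] [u2 l2 e2] le; exists (u1 + u2); first by lia.
exact: exec_seq e1 e2.
Qed.

Lemma exec_le_weak p st t t' st' : exec_le p st t st' -> t <= t' -> exec_le p st t' st'.
Proof. by move=> [u l e] le; exists u => //; lia. Qed.

Lemma exec_le_push i s st st' :
  st' = upd st i (s :: get st i) -> exec_le (Push i s) st 2 st'.
Proof. by move=> ->; exists 2 => //; apply: exec_push. Qed.

Lemma exec_le_pop i st st' :
  st' = upd st i (behead (get st i)) -> exec_le (Pop i) st 1 st'.
Proof. by move=> ->; exists 1 => //; apply: exec_pop. Qed.

Lemma exec_le_if_true i (P : cell -> bool) p q st t st' :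
  P (top st i) -> exec_le p st t st' -> exec_le (If i P p q) st t.+1 st'.
Proof. by move=> h [u l e]; exists u.+1 => //; apply: exec_if_true. Qed.

Lemma exec_le_if_false i (P : cell -> bool) p q st t st' :
  ~~ P (top st i) -> exec_le q st t st' -> exec_le (If i P p q) st t.+1 st'.
Proof. by move=> h [u l e]; exists u.+1 => //; apply: exec_if_false. Qed.

Lemma exec_le_while_true i (P : cell -> bool) p st t1 st1 t2 st2 t :
  P (top st i) -> exec_le p st t1 st1 -> exec_le (While i P p) st1 t2 st2 ->
  (t1 + t2).+1 <= t -> exec_le (While i P p) st t st2.
Proof.
move=> h [u1 l1 e1] [u2 l2 e2] le; exists (u1 + u2).+1; first by lia.
exact: exec_while_true e1 e2.
Qed.

Lemma exec_le_while_false i (P : cell -> bool) p st :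
  ~~ P (top st i) -> exec_le (While i P p) st 1 st.
Proof. by move=> h; exists 1 => //; apply: exec_while_false. Qed.

Definition is_true_bit (c : cell) := if c is Some (Bit true) then true else false.
Definition is_bit (c : cell) := if c is Some (Bit _) then true else false.

(** The language has no empty program; a push that is undone at once replaces it. *)
Definition skip := Seq (Push R3 Sep) (Pop R3).

Lemma exec_le_skip st : exec_le skip st 3 st.
Proof.
apply: exec_le_seq (exec_le_push _) (exec_le_pop _) _; first by [].
  by case: st.
by [].
Qed.

(** Words on auxiliary stacks lie above a separator, which tells the loop where to stop. *)
Definition pour i j :=
  Seq (While i is_bit
        (If i is_true_bit (Seq (Pop i) (Push j (Bit true)))
                          (Seq (Pop i) (Push j (Bit false)))))
      (Pop i).

Lemma exec_le_pour i j (w : seq bool) si st st' : i != j ->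
  get st i = map Bit w ++ Sep :: si ->
  st' = upd (upd st i si) j (map Bit (rev w) ++ get st j) ->
  exec_le (pour i j) st (5 * size w + 2) st'.
Proof.
move=> ne e es'; pose st1 := upd (upd st i (Sep :: si)) j (map Bit (rev w) ++ get st j).
apply: (@exec_le_seq _ _ _ st1 _ (5 * size w + 1) 1); last by lia.
  rewrite {es' st'} /st1; elim: w st e => [|b w IH] st e.
    have -> : upd (upd st i (Sep :: si)) j (map Bit (rev [::]) ++ get st j) = st.
      by move: e ne; case: st i j => s0 s1 s2 s3 [] [] //= ->.
    by apply: exec_le_while_false; rewrite /top e.
  pose st2 := upd (upd st i (map Bit w ++ Sep :: si)) j (Bit b :: get st j).
  apply: (@exec_le_while_true _ _ _ _ 4 st2 (5 * size w + 1)).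
  - by rewrite /top e.
  - have step : exec_le (Seq (Pop i) (Push j (Bit b))) st 3 st2.
      apply: (exec_le_seq (exec_le_pop (erefl _)) (exec_le_push _)) => //.
      by move: e ne; rewrite /st2; clear; case: st i j => s0 s1 s2 s3 [] [] //= ->.
    move: e step; rewrite {}/st2; clear; case: b => e step.
      by apply: exec_le_if_true; rewrite /top ?e.
    by apply: exec_le_if_false; rewrite /top ?e.
  - have -> : upd (upd st i (Sep :: si)) j (map Bit (rev (b :: w)) ++ get st j) =
              upd (upd st2 i (Sep :: si)) j (map Bit (rev w) ++ get st2 j).
      rewrite rev_cons -cats1 map_cat -catA /= /st2.
      by move: e ne; clear; case: st i j => s0 s1 s2 s3 [] [] //= ->.
    apply: IH; rewrite /st2; by move: e ne; clear; case: st i j => s0 s1 s2 s3 [] [] //= ->.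
  - by rewrite /=; lia.
apply: exec_le_pop; rewrite es' /st1.
by move: ne; clear; case: st i j => s0 s1 s2 s3 [] [].
Qed.

Inductive tree := Leaf | Node of tree & tree.

(** Preorder makes the code self-delimiting: the end of an argument is found by counting pending
    subtrees, so arguments can be stacked without separators. *)
Fixpoint code (x : tree) : seq bool :=
  if x is Node a b then true :: code a ++ code b else [:: false].

Definition cd (x : tree) : seq symbol := map Bit (code x).
Definition tsize (x : tree) : nat := size (code x).

Lemma tsize_node a b : tsize (Node a b) = (tsize a + tsize b).+1.
Proof. by rewrite /tsize /= size_cat. Qed.

Lemma tsize_gt0 x : 0 < tsize x. Proof. by case: x. Qed.

Definition seq_of_opt (T : Type) (o : option T) : seq T := if o is Some x then [:: x] else [::].

Definition push_opt (i : reg) (o : option symbol) : prog :=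
  if o is Some s then Push i s else skip.

Definition emit (o : bool -> option symbol) (w : seq bool) : seq symbol :=
  rev (pmap o w).

(* Consumes one tree from the top of [R0] and pushes on [R1] and [R2] the images
   of the symbols of its code; [R3] counts the subtrees still to be read. *)
Definition scan (o1 o2 : bool -> option symbol) :=
  Seq (Push R3 Sep) (Seq (Push R3 (Bit true)) (Seq
    (While R3 is_true_bit (Seq (Pop R3)
      (If R0 is_true_bit
        (Seq (Pop R0) (Seq (push_opt R1 (o1 true)) (Seq (push_opt R2 (o2 true))
          (Seq (Push R3 (Bit true)) (Push R3 (Bit true))))))
        (Seq (Pop R0) (Seq (push_opt R1 (o1 false)) (push_opt R2 (o2 false)))))))
    (Pop R3))).

Lemma exec_le_push_opt i o st st' :
  st' = upd st i (seq_of_opt o ++ get st i) -> exec_le (push_opt i o) st 3 st'.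
Proof.
case: o => [s|] -> /=; first by exists 2 => //; apply: exec_push.
have -> : upd st i (get st i) = st by case: st i => s0 s1 s2 s3 [].
exact: exec_le_skip.
Qed.

Lemma emit_cons o b w : emit o (b :: w) = emit o w ++ seq_of_opt (o b).
Proof. by rewrite /emit /=; case: (o b) => [s|] /=; rewrite ?rev_cons -?cats1 ?cats0. Qed.

Lemma emit_cat o w1 w2 : emit o (w1 ++ w2) = emit o w2 ++ emit o w1.
Proof. by rewrite /emit pmap_cat rev_cat. Qed.

Lemma exec_le_scan o1 o2 x s0 s1 s2 s3 :
  exec_le (scan o1 o2) (Stacks (cd x ++ s0) s1 s2 s3) (15 * tsize x + 6)
    (Stacks s0 (emit o1 (code x) ++ s1) (emit o2 (code x) ++ s2) s3).
Proof.
rewrite /scan; set body := (X in While R3 is_true_bit X).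
(* The rest of the loop is a parameter with its own time [t]; this lets the two subtrees of a node
   be chained in the induction. *)
have loop y u0 u1 u2 u3 t st :
    exec_le (While R3 is_true_bit body)
      (Stacks u0 (emit o1 (code y) ++ u1) (emit o2 (code y) ++ u2) u3) t st ->
    exec_le (While R3 is_true_bit body)
      (Stacks (cd y ++ u0) u1 u2 (Bit true :: u3)) (t + 15 * tsize y) st.
  elim: y u0 u1 u2 u3 t st => [|a IHa b IHb] u0 u1 u2 u3 t st ex.
    apply: (@exec_le_while_true _ _ _ _ 9
              (Stacks u0 (emit o1 (code Leaf) ++ u1) (emit o2 (code Leaf) ++ u2) u3) t) => //;
      last by rewrite /tsize /=; lia.
    apply: (exec_le_seq (exec_le_pop (erefl _)) (t2 := 8)) => //.
    apply: exec_le_if_false => //=.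
    apply: (exec_le_seq (exec_le_pop (erefl _)) (t2 := 6)) => //.
    apply: (exec_le_seq (exec_le_push_opt (erefl _)) (exec_le_push_opt _)) => //=.
    by rewrite !emit_cons.
  apply: (@exec_le_while_true _ _ _ _ 13
    (Stacks (cd a ++ cd b ++ u0) (seq_of_opt (o1 true) ++ u1)
       (seq_of_opt (o2 true) ++ u2) (Bit true :: Bit true :: u3))
    (t + 15 * tsize b + 15 * tsize a)) => //; last by rewrite tsize_node; lia.
    apply: (exec_le_seq (exec_le_pop (erefl _)) (t2 := 12)) => //.
    apply: exec_le_if_true => //=.
    apply: (exec_le_seq (exec_le_pop (erefl _)) (t2 := 10)) => //.
    apply: (exec_le_seq (exec_le_push_opt (erefl _)) (t2 := 7)) => //.
    apply: (exec_le_seq (exec_le_push_opt (erefl _)) (t2 := 4)) => //.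
    apply: (exec_le_seq (exec_le_push (erefl _)) (exec_le_push _)) => //=.
    by rewrite /cd map_cat -catA.
  by apply: IHa; apply: IHb; move: ex; rewrite /= !emit_cons !emit_cat -!catA.
apply: (exec_le_seq (exec_le_push (erefl _)) (t2 := 15 * tsize x + 4)); last by lia.
apply: (exec_le_seq (exec_le_push (erefl _)) (t2 := 15 * tsize x + 2)); last by lia.
apply: (exec_le_seq (t1 := 1 + 15 * tsize x) (t2 := 1)); last by lia.
  by apply: loop; apply: exec_le_while_false.
exact: exec_le_pop.
Qed.

Lemma emit_some w : emit (fun b => Some (Bit b)) w = map Bit (rev w).
Proof. by elim: w => //= b w IH; rewrite emit_cons IH rev_cons -cats1 map_cat. Qed.

Lemma emit_none w : emit (fun=> None) w = [::].
Proof. by elim: w => //= b w IH; rewrite emit_cons IH. Qed.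

Lemma exec_le_pour_rev i j x si st st' : i != j ->
  get st i = map Bit (rev (code x)) ++ Sep :: si ->
  st' = upd (upd st i si) j (cd x ++ get st j) ->
  exec_le (pour i j) st (5 * tsize x + 2) st'.
Proof.
move=> ne e es; rewrite /tsize -size_rev.
by apply: exec_le_pour ne e _; rewrite revK.
Qed.

Definition keep (b : bool) := Some (Bit b).
Definition ignore (_ : bool) : option symbol := None.

Definition drop_tree := scan ignore ignore.

Lemma exec_le_drop x s0 s1 s2 s3 :
  exec_le drop_tree (Stacks (cd x ++ s0) s1 s2 s3) (21 * tsize x) (Stacks s0 s1 s2 s3).
Proof.
have := exec_le_scan ignore ignore x s0 s1 s2 s3; rewrite !emit_none => h.
by apply: exec_le_weak h _; have := tsize_gt0 x; lia.
Qed.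

Definition dup_tree :=
  Seq (Push R1 Sep) (Seq (Push R2 Sep) (Seq (scan keep keep)
    (Seq (pour R1 R0) (pour R2 R0)))).

Lemma exec_le_dup x s0 s1 s2 s3 :
  exec_le dup_tree (Stacks (cd x ++ s0) s1 s2 s3) (40 * tsize x)
    (Stacks (cd x ++ cd x ++ s0) s1 s2 s3).
Proof.
apply: (exec_le_seq (exec_le_push (erefl _)) (t2 := 25 * tsize x + 13));
  last by have := tsize_gt0 x; lia.
apply: (exec_le_seq (exec_le_push (erefl _)) (t2 := 25 * tsize x + 11)); last by lia.
apply: (exec_le_seq (exec_le_scan _ _ _ _ _ _ _) (t2 := 10 * tsize x + 4)); last by lia.
rewrite !emit_some.
apply: (exec_le_seq (exec_le_pour_rev _ _ (erefl _)) (t2 := 5 * tsize x + 2)) => //=; last by lia.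
exact: exec_le_pour_rev.
Qed.

Definition swap_tree :=
  Seq (Push R1 Sep) (Seq (scan keep ignore) (Seq (Push R2 Sep) (Seq (scan ignore keep)
    (Seq (pour R1 R0) (pour R2 R0))))).

Lemma exec_le_swap x y s0 s1 s2 s3 :
  exec_le swap_tree (Stacks (cd x ++ cd y ++ s0) s1 s2 s3) (40 * (tsize x + tsize y))
    (Stacks (cd y ++ cd x ++ s0) s1 s2 s3).
Proof.
have := tsize_gt0 x; have := tsize_gt0 y => gx gy.
apply: (exec_le_seq (exec_le_push (erefl _)) (t2 := 20 * tsize x + 20 * tsize y + 18)); last by lia.
apply: (exec_le_seq (exec_le_scan _ _ _ _ _ _ _) (t2 := 5 * tsize x + 20 * tsize y + 12)); last by lia.
rewrite emit_some emit_none.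
apply: (exec_le_seq (exec_le_push (erefl _)) (t2 := 5 * tsize x + 20 * tsize y + 10)); last by lia.
apply: (exec_le_seq (exec_le_scan _ _ _ _ _ _ _) (t2 := 5 * tsize x + 5 * tsize y + 4)); last by lia.
rewrite emit_some emit_none.
apply: (exec_le_seq (exec_le_pour_rev _ _ (erefl _)) (t2 := 5 * tsize y + 2)) => //=; last by lia.
exact: exec_le_pour_rev.
Qed.

(** * Programs computing functions on trees *)

(** Whatever lies below the argument, and on the other stacks, is preserved; so intermediate results
    and loop counters can be kept there. *)
Definition computes (p : prog) (x : tree) (t : nat) (y : tree) : Prop :=
  forall s0 s1 s2 s3,
    exec_le p (Stacks (cd x ++ s0) s1 s2 s3) t (Stacks (cd y ++ s0) s1 s2 s3).

Lemma computes_seq p q x y z t1 t2 t :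
  computes p x t1 y -> computes q y t2 z -> t1 + t2 <= t ->
  computes (Seq p q) x t z.
Proof. by move=> h1 h2 le s0 s1 s2 s3; apply: exec_le_seq (h1 _ _ _ _) (h2 _ _ _ _) le. Qed.

Lemma computes_skip x : computes skip x 3 x.
Proof. by move=> *; apply: exec_le_skip. Qed.

Definition pair_prog p q := Seq dup_tree (Seq p (Seq swap_tree (Seq q (Push R0 (Bit true))))).

(* [Node (f x) (g x)] is obtained as [1] followed by the codes of [f x] and
   [g x]; since [q] runs last, it must be the one that computes [f x]. *)
Lemma computes_pair p q x y z t1 t2 t :
  computes q x t1 y -> computes p x t2 z ->
  t1 + t2 + 40 * tsize x + 40 * (tsize x + tsize z) + 2 <= t ->
  computes (pair_prog p q) x t (Node y z).
Proof.
move=> h1 h2 le s0 s1 s2 s3.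
apply: (exec_le_seq (exec_le_dup _ _ _ _ _)
  (t2 := t2 + (40 * (tsize z + tsize x) + (t1 + 2)))); last by lia.
apply: (exec_le_seq (h2 _ _ _ _) (t2 := 40 * (tsize z + tsize x) + (t1 + 2))) => //.
apply: (exec_le_seq (exec_le_swap _ _ _ _ _ _) (t2 := t1 + 2)) => //.
apply: (exec_le_seq (h1 _ _ _ _) (exec_le_push _)) => //.
by rewrite /= /cd map_cat -catA.
Qed.

Definition fst_prog := Seq (Pop R0) (Seq swap_tree drop_tree).
Definition snd_prog := Seq (Pop R0) drop_tree.

Lemma computes_fst x y : computes fst_prog (Node x y) (61 * tsize (Node x y)) x.
Proof.
move=> s0 s1 s2 s3; rewrite tsize_node.
apply: (exec_le_seq (exec_le_pop (erefl _)) (t2 := 40 * (tsize x + tsize y) + 21 * tsize y)); last by lia.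
apply: (exec_le_seq _ (exec_le_drop y _ _ _ _)); last by apply: leqnn.
by rewrite /= /cd map_cat -catA; apply: exec_le_swap.
Qed.

Lemma computes_snd x y : computes snd_prog (Node x y) (61 * tsize (Node x y)) y.
Proof.
move=> s0 s1 s2 s3; rewrite tsize_node.
apply: (exec_le_seq (exec_le_pop (erefl _)) (t2 := 21 * tsize x)); last by lia.
by rewrite /= /cd map_cat -catA; apply: exec_le_drop.
Qed.

Fixpoint const_prog (w : seq bool) :=
  if w is b :: w' then Seq (const_prog w') (Push R0 (Bit b)) else skip.

Lemma computes_const y x :
  computes (Seq drop_tree (const_prog (code y))) x (21 * tsize x + 2 * tsize y + 3) y.
Proof.
move=> s0 s1 s2 s3.
apply: (exec_le_seq (exec_le_drop _ _ _ _ _) (t2 := 2 * tsize y + 3)); last by lia.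
rewrite /cd /tsize; elim: (code y) => [|b w IH] /=; first exact: exec_le_skip.
by apply: (exec_le_seq IH (exec_le_push _)) => //; lia.
Qed.

Definition if_prog c p q :=
  Seq dup_tree (Seq c (If R0 is_true_bit (Seq drop_tree p) (Seq drop_tree q))).

Lemma computes_if c p q x z y tc t1 t :
  computes c x tc z ->
  (if z is Node _ _ then computes p x t1 y else computes q x t1 y) ->
  40 * tsize x + tc + 1 + 21 * tsize z + t1 <= t ->
  computes (if_prog c p q) x t y.
Proof.
move=> hc hpq le s0 s1 s2 s3.
apply: (exec_le_seq (exec_le_dup _ _ _ _ _) (t2 := tc + (21 * tsize z + t1).+1)); last by lia.
apply: (exec_le_seq (hc _ _ _ _) (t2 := (21 * tsize z + t1).+1)) => //.
case: z hpq hc {le} => [|z1 z2] h _.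
  by apply: exec_le_if_false => //; apply: exec_le_seq (exec_le_drop _ _ _ _ _) (h _ _ _ _) _.
by apply: exec_le_if_true => //; apply: exec_le_seq (exec_le_drop _ _ _ _ _) (h _ _ _ _) _.
Qed.

Fixpoint nodes (x : tree) : nat := if x is Node a b then (nodes a + nodes b).+1 else 0.

Lemma nodes_tsize x : tsize x = (nodes x).*2.+1.
Proof. elim: x => //= a IHa b IHb; rewrite tsize_node IHa IHb; lia. Qed.

(** The first component is a loop counter: each of its inner nodes leaves one bit on [R1], and [p]
    runs once for each bit. *)
Definition iter_prog p :=
  Seq (Pop R0) (Seq (Push R1 Sep)
    (Seq (scan (fun b => if b then keep b else None) ignore)
      (Seq (While R1 is_true_bit (Seq (Pop R1) p)) (Pop R1)))).

(** The trajectory [f] is given, so that the time bound [b] is required only for states that really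
    occur. *)
Lemma computes_iter p n x (f : nat -> tree) b t :
  x = f 0 -> (forall i, i < nodes n -> computes p (f i) b (f i.+1)) ->
  30 * tsize n + nodes n * (b + 2) <= t ->
  computes (iter_prog p) (Node n x) t (f (nodes n)).
Proof.
move=> e h le s0 s1 s2 s3; rewrite /= /cd /= map_cat -catA.
have gn := tsize_gt0 n.
apply: (exec_le_seq (exec_le_pop (erefl _)) (t2 := 15 * tsize n + nodes n * (b + 2) + 10)); last by lia.
apply: (exec_le_seq (exec_le_push (erefl _)) (t2 := 15 * tsize n + nodes n * (b + 2) + 8)); last by lia.
apply: (exec_le_seq (exec_le_scan _ _ _ _ _ _ _) (t2 := nodes n * (b + 2) + 2)); last by lia.
rewrite emit_none.
have -> : emit (fun b0 : bool => if b0 then keep b0 else None) (code n) = nseq (nodes n) (Bit true).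
  elim: n {h gn le} => //= n1 IH1 n2 IH2; rewrite emit_cons emit_cat IH1 IH2.
  by rewrite (_ : seq_of_opt _ = nseq 1 (Bit true)) // -!nseqD addn1 addnC.
apply: (exec_le_seq (st2 := Stacks (cd (f (nodes n)) ++ s0) (Sep :: s1) s2 s3)
  (t1 := nodes n * (b + 2) + 1) _ (exec_le_pop (erefl _))); last by lia.
rewrite e -[X in f X](subnn (nodes n)) /=.
have : nodes n <= nodes n by [].
elim: {1 4 5 6}(nodes n) => [|k IH] le'; first by rewrite subn0; apply: exec_le_while_false.
apply: (exec_le_while_true (t1 := 1 + b) _ _ (IH _)) => //; [|by lia|by lia].
apply: (exec_le_seq (exec_le_pop (erefl _)) (t2 := b)) => //=.
have -> : nodes n - k = (nodes n - k.+1).+1 by lia.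
by apply: h; lia.
Qed.

(** * Functions computable in polynomial time *)

Class enc (T : Type) := encode : T -> tree.

Definition sz (T : Type) (e : enc T) (x : T) : nat := tsize (encode x).
Arguments sz {T e} x.

Lemma sz_gt0 T {e : enc T} (x : T) : 0 < sz x. Proof. exact: tsize_gt0. Qed.

(** The base is at least 2, so constants, sums and products are all absorbed by a larger
    exponent. *)
Definition poly_bounded A (e : enc A) (q : A -> nat) :=
  exists k, forall a, q a <= (sz a + 2) ^ k.
Arguments poly_bounded {A e} q.

Definition polytime A B (eA : enc A) (eB : enc B) (f : A -> B) :=
  exists p k, forall a, computes p (encode a) ((sz a + 2) ^ k) (encode (f a)).
Arguments polytime {A B eA eB} f.

Notation PT := polytime.
Notation PB := poly_bounded.

Lemma leq_expr2 m n k : m <= n -> m ^ k <= n ^ k.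
Proof. by case: k => // k le; rewrite leq_exp2r. Qed.

Section PolyBounded.
Variables (A : Type) (eA : enc A).
Implicit Types q r : A -> nat.

Lemma PB_le q r : (forall a, q a <= r a) -> PB r -> PB q.
Proof. by move=> h [k hk]; exists k => a; apply: leq_trans (h a) (hk a). Qed.

Lemma PB_const n : PB (fun _ : A => n).
Proof.
exists n => a; apply: (@leq_trans (2 ^ n)); first exact/ltnW/ltn_expl.
by apply: leq_expr2; lia.
Qed.

Lemma PB_add q r : PB q -> PB r -> PB (fun a => q a + r a).
Proof.
move=> [k hk] [l hl]; exists (k + l).+1 => a; rewrite expnS.
have h1 := hk a; have h2 := hl a; set s := sz a in h1 h2 *.
have g n : 0 < (s + 2) ^ n by rewrite expn_gt0; lia.
rewrite expnD; move: (g k) (g l) h1 h2.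
move: ((s + 2) ^ k) ((s + 2) ^ l) => x y gx gy h1 h2.
apply: (@leq_trans (x + y)); first by lia.
by apply: (@leq_trans (2 * (x * y))); nia.
Qed.

Lemma PB_mul q r : PB q -> PB r -> PB (fun a => q a * r a).
Proof. by move=> [k hk] [l hl]; exists (k + l) => a; rewrite expnD leq_mul. Qed.

Lemma PB_expc q k : PB q -> PB (fun a => q a ^ k).
Proof.
move=> hq; elim: k => [|k IH]; first exact: (PB_le _ (PB_const 1)).
by apply: PB_le (PB_mul hq IH) => a; rewrite expnS.
Qed.

Lemma PB_size : PB (@sz A eA).
Proof. by exists 1 => a; rewrite expn1; lia. Qed.

Lemma PB_succ q : PB q -> PB (fun a => (q a).+1).
Proof.
by move=> h; apply: PB_le (PB_add h (PB_const 1)) => a; rewrite addn1.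
Qed.

Lemma PT_bound B (eB : enc B) (f : A -> B) p q :
  PB q -> (forall a, computes p (encode a) (q a) (encode (f a))) -> PT f.
Proof.
move=> [k hk] h; exists p, k => a s0 s1 s2 s3.
by apply: exec_le_weak (h a s0 s1 s2 s3) (hk a).
Qed.

Definition total_size (st : stacks) :=
  let: Stacks s0 s1 s2 s3 := st in size s0 + size s1 + size s2 + size s3.

Lemma exec_total_size p st t st' : exec p st t st' -> total_size st' <= total_size st + t.
Proof.
elim=> {p st t st'} //=.
- by case=> [] s [] s0 s1 s2 s3 /=; lia.
- by case=> [] [] s0 s1 s2 s3 /=; rewrite ?size_behead; lia.
- by move=> p q st1 t1 st2 t2 st3 _ h1 _ h2; lia.
- by move=> i P p q st t st' _ _ h; lia.
- by move=> i P p q st t st' _ _ h; lia.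
- by move=> i P p st t1 st1 t2 st2 _ _ h1 _ h2; lia.
- by move=> i P p st _; lia.
Qed.

(** A program writes at most one symbol per step, so its running time also limits the size of its
    result. Closure under composition rests on this. *)
Lemma PB_sz B (eB : enc B) (f : A -> B) : PT f -> PB (fun a => sz (f a)).
Proof.
move=> [p [k h]].
apply: (@PB_le _ (fun a => sz a + (sz a + 2) ^ k)).
  move=> a; have [t le /exec_total_size] := h a [::] [::] [::] [::].
  by rewrite /= !cats0 /cd !size_map; move: le; rewrite /sz /tsize; lia.
by apply: PB_add (PB_size) _; exists k.
Qed.

End PolyBounded.

Ltac pb := cbv beta;
  lazymatch goal with
  | |- poly_bounded (fun _ => ?n) => exact: PB_const
  | |- poly_bounded (fun a => @?q a + @?r a) => apply: (@PB_add _ _ q r); pb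
  | |- poly_bounded (fun a => @?q a * @?r a) => apply: (@PB_mul _ _ q r); pb
  | |- poly_bounded (fun a => (@?q a).+1) => apply: (@PB_succ _ _ q); pb
  | |- poly_bounded (fun a => (@?q a) ^ ?k) => apply: (@PB_expc _ _ q k); pb
  | |- poly_bounded (fun a => sz a) => exact: PB_size
  | |- poly_bounded (fun a => tsize (encode a)) => exact: PB_size
  | |- poly_bounded (fun a => sz (@?f a)) => apply: (@PB_sz _ _ _ _ f); try eassumption
  | |- _ => try eassumption
  end.

Section Basic.
Variables (A : Type) (eA : enc A).

Lemma PT_cast B (eB : enc B) (f : A -> B) :
  (forall a, encode (f a) = encode a) -> PT f.
Proof.
move=> h; apply: (@PT_bound _ _ _ _ _ skip (fun=> 3)); first exact: PB_const.
by move=> a; rewrite h; apply: computes_skip.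
Qed.

Lemma PT_id : PT (fun a : A => a).
Proof. exact: PT_cast. Qed.

Lemma PT_const B (eB : enc B) (b : B) : PT (fun _ : A => b).
Proof.
apply: (PT_bound _ (fun a => computes_const (encode b) (encode a))).
pb.
Qed.

End Basic.

Lemma PT_comp A B C (eA : enc A) (eB : enc B) (eC : enc C) (g : B -> C) (f : A -> B) :
  PT g -> PT f -> PT (fun a => g (f a)).
Proof.
move=> [p [k hp]] hf; case: (hf) => q [l hq].
apply: (@PT_bound _ _ _ _ _ (Seq q p)
  (fun a => (sz a + 2) ^ l + (sz (f a) + 2) ^ k)).
  pb.
by move=> a; apply: computes_seq (hq a) (hp _) _.
Qed.

#[export] Instance enc_unit : enc unit := fun=> Leaf.
#[export] Instance enc_bool : enc bool := fun b => if b then Node Leaf Leaf else Leaf.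
#[export] Instance enc_prod A B (eA : enc A) (eB : enc B) : enc (A * B) :=
  fun x => Node (encode x.1) (encode x.2).
#[export] Instance enc_option A (eA : enc A) : enc (option A) :=
  fun o => if o is Some x then Node Leaf (encode x) else Leaf.
#[export] Instance enc_seq A (eA : enc A) : enc (seq A) :=
  foldr (fun x t => Node (encode x) t) Leaf.
#[export] Instance enc_symbol : enc symbol := fun s => encode (symbol_code s).

(* Natural numbers are encoded in unary, integers and rationals in binary. *)
#[export] Instance enc_nat : enc nat := fun n => iter n (Node Leaf) Leaf.
#[export] Instance enc_int : enc int := fun z => encode ((z < 0)%R, nat_bits `|z|%N).
#[export] Instance enc_rat : enc rat := fun q => encode (numq q, denq q).

Section Closure.
Variables (A : Type) (eA : enc A).

Lemma PT_pair B C (eB : enc B) (eC : enc C) (f : A -> B) (g : A -> C) :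
  PT f -> PT g -> PT (fun a => (f a, g a)).
Proof.
move=> hf hg; case: (hf) => p [k hp]; case: (hg) => q [l hq].
apply: (@PT_bound _ _ _ _ _ (pair_prog q p) (fun a => (sz a + 2) ^ k + (sz a + 2) ^ l
  + 40 * sz a + 40 * (sz a + sz (g a)) + 2)); last first.
  by move=> a; apply: computes_pair (hp a) (hq a) _.
pb.
Qed.

Lemma PT_fst B C (eB : enc B) (eC : enc C) (f : A -> B * C) :
  PT f -> PT (fun a => (f a).1).
Proof.
apply: (PT_comp (g := fst)).
apply: (PT_bound _ (fun a => computes_fst (encode a.1) (encode a.2))).
exact: (PB_mul (PB_const _ 61) (@PB_size _ _)).
Qed.

Lemma PT_snd B C (eB : enc B) (eC : enc C) (f : A -> B * C) :
  PT f -> PT (fun a => (f a).2).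
Proof.
apply: (PT_comp (g := snd)).
apply: (PT_bound _ (fun a => computes_snd (encode a.1) (encode a.2))).
exact: (PB_mul (PB_const _ 61) (@PB_size _ _)).
Qed.

Lemma PT_comp2 B C D (eB : enc B) (eC : enc C) (eD : enc D) (h : B -> C -> D)
    (f : A -> B) (g : A -> C) :
  PT (fun x : B * C => h x.1 x.2) -> PT f -> PT g -> PT (fun a => h (f a) (g a)).
Proof. by move=> hh hf hg; apply: (PT_comp hh (PT_pair hf hg)). Qed.

Lemma PT_comp3 B C D E (eB : enc B) (eC : enc C) (eD : enc D) (eE : enc E)
    (h : B -> C -> D -> E) (f1 : A -> B) (f2 : A -> C) (f3 : A -> D) :
  PT (fun x : B * C * D => h x.1.1 x.1.2 x.2) -> PT f1 -> PT f2 -> PT f3 ->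
  PT (fun a => h (f1 a) (f2 a) (f3 a)).
Proof.
by move=> hh h1 h2 h3; apply: (PT_comp hh (PT_pair (PT_pair h1 h2) h3)).
Qed.

Lemma PT_if B (eB : enc B) (b : A -> bool) (f g : A -> B) :
  PT b -> PT f -> PT g -> PT (fun a => if b a then f a else g a).
Proof.
move=> hb [p [k hp]] [q [l hq]]; case: (hb) => c [m hc].
apply: (@PT_bound _ _ _ _ _ (if_prog c p q) (fun a => 40 * sz a + (sz a + 2) ^ m + 1
  + 21 * sz (b a) + ((sz a + 2) ^ k + (sz a + 2) ^ l))); last first.
  move=> a; apply: computes_if (hc a) _ (leqnn _).
  case: (b a) => /= s0 s1 s2 s3; [have := hp a|have := hq a];
    by move/(_ s0 s1 s2 s3)/exec_le_weak; apply; lia.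
pb.
Qed.

Lemma PT_cons X (eX : enc X) (x : A -> X) (s : A -> seq X) :
  PT x -> PT s -> PT (fun a => x a :: s a).
Proof.
move=> hx hs.
have := PT_comp (@PT_cast _ _ _ _ (fun p : X * seq X => p.1 :: p.2) _) (PT_pair hx hs).
exact.
Qed.

Lemma PT_Some X (eX : enc X) (x : A -> X) : PT x -> PT (fun a => Some (x a)).
Proof.
move=> hx.
have := PT_comp (@PT_cast _ _ _ _ (fun p : unit * X => Some p.2) _)
  (PT_pair (PT_const _ _ tt) hx).
exact.
Qed.

End Closure.

Create HintDb polytime.

Ltac pt_hook := fail.

(* Decomposes a goal [PT (fun a => e)] along the structure of [e]; functions of
   up to four arguments are looked up in the hint database [polytime]. *)
Ltac pt_eta :=
  lazymatch goal with
  | |- polytime (fun _ => _) => idtac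
  | |- @polytime ?A ?B ?eA ?eB ?f => change (@polytime A B eA eB (fun a => f a))
  | |- _ => idtac
  end.

Ltac pt := cbv beta; pt_eta;
  try first
  [ assumption
  | lazymatch goal with |- polytime (fun a => a) => exact: PT_id end
  | lazymatch goal with |- polytime (fun _ => ?c) => exact: PT_const end
  | pt_hook
  | lazymatch goal with
    | |- polytime (fun a => fst (@?f a)) => refine (PT_fst (f := f) _); pt
    | |- polytime (fun a => snd (@?f a)) => refine (PT_snd (f := f) _); pt
    | |- polytime (fun a => (@?f a, @?g a)) => refine (PT_pair (f := f) (g := g) _ _); pt
    | |- polytime (fun a => @?x a :: @?s a) => refine (PT_cons (x := x) (s := s) _ _); pt
    | |- polytime (fun a => Some (@?x a)) => refine (PT_Some (x := x) _); pt
    end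
  | simple apply PT_if; pt
  | match goal with
    | |- polytime (fun a => ?h (@?f a)) =>
        refine (@PT_comp _ _ _ _ _ _ h f _ _); [solve [auto with polytime nocore] | pt]
    | |- polytime (fun a => ?h (@?f a) (@?g a)) =>
        refine (@PT_comp2 _ _ _ _ _ _ _ _ h f g _ _ _);
        [solve [auto with polytime nocore] | pt | pt]
    | |- polytime (fun a => ?h (@?f a) (@?g a) (@?k a)) =>
        refine (@PT_comp3 _ _ _ _ _ _ _ _ _ _ h f g k _ _ _ _);
        [solve [auto with polytime nocore] | pt | pt | pt]
    end ].

Section Cases.
Variables (A : Type) (eA : enc A).

(** One rule for options, sequences and unary numbers: the program tests whether the code of [y a]
    is a leaf, and otherwise reads the same tree as the code of an element of [X], for instance of a
    pair of head and tail. *)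
Lemma PT_case Y (eY : enc Y) X (eX : enc X) B (eB : enc B) (y : A -> Y)
    (g : A * X -> B) (h f : A -> B) :
  PT y -> PT g -> PT h ->
  (forall a, if encode (y a) is Node _ _
    then exists2 x, encode (y a) = encode x & f a = g (a, x) else f a = h a) ->
  PT f.
Proof.
move=> hy hg [q [l hq]] hf; case: (hg) => p [k hp]; case: (hy) => c [m hc].
have PBy := PB_sz hy.
pose bp (a : A) := 3 + (@sz _ eA a + 2) ^ m + 40 * @sz _ eA a + 40 * (@sz _ eA a + @sz _ eY (y a)) + 2.
apply: (@PT_bound _ _ _ _ _ (if_prog c (Seq (pair_prog c skip) p) q) (fun a => 40 * sz a + (sz a + 2) ^ m + 1
  + 21 * sz (y a) + (bp a + ((sz a + sz (y a)).+1 + 2) ^ k + (sz a + 2) ^ l))); last first.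
  move=> a; apply: computes_if (hc a) _ (leqnn _).
  have := hf a; case E: (encode (y a)) => [|t1 t2] => [->|[x ex ->]].
    by move=> s0 s1 s2 s3; apply: exec_le_weak (hq a _ _ _ _) _; lia.
  have e : Node (encode a) (encode (y a)) = encode (a, x) by rewrite E ex.
  apply: (@computes_seq _ _ _ (encode (a, x)) _ (bp a) (((sz a + sz (y a)).+1 + 2) ^ k)); last by lia.
    by rewrite -e; apply: computes_pair (computes_skip _) (hc a) _; rewrite /bp -/(sz a) -/(sz (y a)); lia.
  by have := hp (a, x); rewrite /sz -e tsize_node.
rewrite /bp; pb.
Qed.

Lemma PT_seq_case X (eX : enc X) B (eB : enc B) (l : A -> seq X)
    (g : A -> X -> seq X -> B) (h : A -> B) :
  PT l -> PT (fun p : A * (X * seq X) => g p.1 p.2.1 p.2.2) -> PT h ->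
  PT (fun a => if l a is x :: s then g a x s else h a).
Proof.
move=> hl hg hh; apply: (PT_case hl hg hh) => a.
by case: (l a) => //= x s; exists (x, s).
Qed.

Lemma PT_option_case X (eX : enc X) B (eB : enc B) (o : A -> option X)
    (g : A -> X -> B) (h : A -> B) :
  PT o -> PT (fun p : A * X => g p.1 p.2) -> PT h ->
  PT (fun a => if o a is Some x then g a x else h a).
Proof.
move=> ho hg hh.
have hg' : PT (fun p : A * (unit * X) => g p.1 p.2.2).
  by pt.
apply: (PT_case ho hg' hh) => a.
by case: (o a) => //= x; exists (tt, x).
Qed.

End Cases.

Section Iteration.
Variables (A : Type) (eA : enc A).

(** Iterating a polynomial-time map can double the size in each round. A polynomial bound on all
    iterates is therefore a hypothesis. *)
Lemma PT_iter_nodes C (eC : enc C) S (eS : enc S) (n : A -> C) (f : A -> S -> S) (s : A -> S) q :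
  PT n -> PT s -> PT (fun p : A * S => f p.1 p.2) -> PB q ->
  (forall a i, i <= nodes (encode (n a)) -> sz (iter i (f a) (s a)) <= q a) ->
  PT (fun a => iter (nodes (encode (n a))) (f a) (s a)).
Proof.
move=> hn hs hf hq bound.
(* The body of the loop sees only its state, so the parameter is carried along in it. *)
have [p [k hp]] : PT (fun p : A * S => (p.1, f p.1 p.2)) by pt.
have hinit : PT (fun a => (n a, (a, s a))) by pt.
have : PT (fun a => (a, iter (nodes (encode (n a))) (f a) (s a))); last by move=> h; apply: PT_snd h.
have [p0 [k0 hp0]] := hinit.
pose b a := ((@sz _ eA a + q a).+1 + 2) ^ k.
apply: (@PT_bound _ _ _ _ _ (Seq p0 (iter_prog p))
  (fun a => (sz a + 2) ^ k0 + (30 * sz (n a) + sz (n a) * (b a + 2)))); last first.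
  move=> a; apply: computes_seq (hp0 a) _ (leqnn _).
  apply: (@computes_iter p (encode (n a)) (encode (a, s a))
    (fun i => encode (a, iter i (f a) (s a))) (b a)) => //.
    move=> i lei s0 s1 s2 s3; apply: exec_le_weak (hp (a, iter i (f a) (s a)) _ _ _ _) _.
    apply: leq_expr2; rewrite /sz tsize_node -!/(sz _).
    by have := bound a i (ltnW lei); rewrite /sz /=; lia.
  rewrite leq_add2l leq_mul2r; apply/orP; right.
  by rewrite /sz nodes_tsize; lia.
rewrite /b; pb.
Qed.

Lemma nodes_nat (n : nat) : nodes (encode n) = n.
Proof. by elim: n => //= n ->. Qed.

Lemma nodes_seq X {eX : enc X} (l : seq X) : size l <= nodes (encode l).
Proof. by elim: l => //= x l IH; rewrite ltnS; apply: leq_trans IH _; apply: leq_addl. Qed.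

Lemma PT_iter S (eS : enc S) (n : A -> nat) (f : A -> S -> S) (s : A -> S) q :
  PT n -> PT s -> PT (fun p : A * S => f p.1 p.2) -> PB q ->
  (forall a i, i <= n a -> sz (iter i (f a) (s a)) <= q a) ->
  PT (fun a => iter (n a) (f a) (s a)).
Proof.
move=> hn hs hf hq bound.
have := @PT_iter_nodes _ _ _ _ n f s q hn hs hf hq.
case=> [a i|p [k h]]; first by rewrite nodes_nat; apply: bound.
by exists p, k => a; rewrite -[n a in X in computes _ _ _ X]nodes_nat.
Qed.

(** The loop runs once per inner node of the code of the list, which is at least once per entry;
    surplus rounds find an empty list and change nothing. *)
Lemma PT_foldl S (eS : enc S) X (eX : enc X) (f : A -> S -> X -> S) (s : A -> S)
    (l : A -> seq X) q :
  PT l -> PT s -> PT (fun p : A * S * X => f p.1.1 p.1.2 p.2) -> PB q ->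
  (forall a l1 l2, l a = l1 ++ l2 -> sz (foldl (f a) (s a) l1) <= q a) ->
  PT (fun a => foldl (f a) (s a) (l a)).
Proof.
move=> hl hs hf hq bound.
pose step a (st : seq X * S) := if st.1 is x :: r then (r, f a st.2 x) else st.
have hstep : PT (fun p : A * (seq X * S) => step p.1 p.2).
  by rewrite /step; apply: (PT_seq_case (l := fun p : A * (seq X * S) => p.2.1) (h := fun p => p.2)
    (g := fun (p : A * (seq X * S)) x r => (r, f p.1 p.2.2 x))); pt.
have iterE a i : iter i (step a) (l a, s a) =
    (drop i (l a), foldl (f a) (s a) (take i (l a))).
  elim: i => [|i /= ->]; first by rewrite drop0 take0.
  rewrite /step /=; case: (ltnP i (size (l a))) => h; last first.
    by rewrite !drop_oversize ?take_oversize //; lia.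
  case: (l a) h => [//|x0 l0] h; rewrite (drop_nth x0) //.
  by rewrite (take_nth x0) // foldl_rcons.
have : PT (fun a => (iter (nodes (encode (l a))) (step a) (l a, s a)).2).
  apply: PT_snd.
  apply: (@PT_iter_nodes _ _ _ _ l step (fun a => (l a, s a)) (fun a => (sz (l a) + q a).+1)) => //.
  - exact: PT_pair.
  - pb.
  - move=> a i _; rewrite iterE /sz tsize_node ltnS leq_add //.
      rewrite -!/(sz _); elim: (l a) i => //= x r IH [|i] //.
      by apply: leq_trans (IH i) _; rewrite /sz [leqRHS]tsize_node; exact: leq_trans (leq_addl _ _) (leqnSn _).
    by apply: (bound a _ (drop i (l a))); rewrite cat_take_drop.
case=> p [k h]; exists p, k => a; have := h a.
by rewrite iterE take_oversize ?nodes_seq.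
Qed.

Lemma PT_foldl_incr S (eS : enc S) X (eX : enc X) (f : A -> S -> X -> S) (s : A -> S)
    (l : A -> seq X) g :
  PT l -> PT s -> PT (fun p : A * S * X => f p.1.1 p.1.2 p.2) -> PB g ->
  (forall a st l1 x l2, l a = l1 ++ x :: l2 -> sz (f a st x) <= sz st + g a) ->
  PT (fun a => foldl (f a) (s a) (l a)).
Proof.
move=> hl hs hf hg incr.
apply: (@PT_foldl _ _ _ _ f s l (fun a => sz (s a) + sz (l a) * g a)) => //.
  pb.
move=> a l1 l2 e; apply: (@leq_trans (sz (s a) + size l1 * g a)); last first.
  rewrite leq_add2l leq_mul2r; apply/orP; right; rewrite /sz nodes_tsize.
  by pose proof (nodes_seq (l a)) as szh; move: szh; rewrite e size_cat; lia.
elim/last_ind: l1 l2 e => [|l1 x IH] l2 e; first by rewrite /=; lia.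
rewrite foldl_rcons size_rcons; move: e; rewrite cat_rcons => e.
by have := incr a (foldl (f a) (s a) l1) _ _ _ e; have := IH _ e; lia.
Qed.

Lemma PT_iter_incr S (eS : enc S) (n : A -> nat) (f : A -> S -> S) (s : A -> S) g :
  PT n -> PT s -> PT (fun p : A * S => f p.1 p.2) -> PB g ->
  (forall a st, sz (f a st) <= sz st + g a) ->
  PT (fun a => iter (n a) (f a) (s a)).
Proof.
move=> hn hs hf hg incr.
apply: (@PT_iter _ _ n f s (fun a => sz (s a) + sz (n a) * g a)) => //.
  pb.
move=> a i le; apply: (@leq_trans (sz (s a) + i * g a)); last first.
  rewrite leq_add2l leq_mul2r; apply/orP; right; apply: leq_trans le _.
  by rewrite /sz nodes_tsize nodes_nat; lia.
by elim: i {le} => [|i IH] /=; [lia|have := incr a (iter i (f a) (s a)); lia].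
Qed.
End Iteration.

(** * Booleans, unary numbers and lists *)

Lemma sz_pair A B (eA : enc A) (eB : enc B) (a : A) (b : B) : sz (a, b) = (sz a + sz b).+1.
Proof. by rewrite /sz tsize_node. Qed.

Lemma sz_cons X (eX : enc X) (x : X) s : sz (x :: s) = (sz x + sz s).+1.
Proof. by rewrite /sz tsize_node. Qed.

Lemma sz_nil X (eX : enc X) : sz ([::] : seq X) = 1.
Proof. by []. Qed.

Lemma sz_nat (n : nat) : sz n = n.*2.+1.
Proof. by rewrite /sz nodes_tsize nodes_nat. Qed.

Lemma sz_bool (b : bool) : sz b <= 3.
Proof. by case: b. Qed.

Lemma sz_cat X {eX : enc X} (s t : seq X) : sz (s ++ t) + 1 = sz s + sz t.
Proof. by elim: s => [|x s IH] /=; rewrite ?sz_nil ?sz_cons; lia. Qed.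

Lemma sz_mem X {eX : enc X} (s : seq X) l1 x l2 : s = l1 ++ x :: l2 -> sz x < sz s.
Proof. by move=> ->; pose proof (sz_cat l1 (x :: l2)) as szh; move: szh; pose proof (sz_gt0 l1) as szh; move: szh; rewrite sz_cons; lia. Qed.

Lemma sz_size X {eX : enc X} (s : seq X) : size s < sz s.
Proof. by elim: s => //= x s IH; rewrite sz_cons; pose proof (sz_gt0 x) as szh; move: szh; lia. Qed.

Lemma PT_ext A B (eA : enc A) (eB : enc B) (f g : A -> B) : f =1 g -> PT f -> PT g.
Proof. by move=> e [p [k h]]; exists p, k => a; rewrite -e. Qed.

Lemma PT_andb : PT (fun p : bool * bool => p.1 && p.2).
Proof. by rewrite /andb; pt. Qed.

Lemma PT_orb : PT (fun p : bool * bool => p.1 || p.2).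
Proof. by rewrite /orb; pt. Qed.

Lemma PT_negb : PT negb.
Proof. by rewrite /negb; pt. Qed.

Lemma PT_addb : PT (fun p : bool * bool => p.1 (+) p.2).
Proof.
apply: (PT_ext (f := fun p : bool * bool => if p.1 then if p.2 then false else true else p.2)); pt.
by do 2!case.
Qed.

#[export] Hint Resolve PT_andb PT_orb PT_negb PT_addb : polytime.

Lemma PT_succn : PT S.
Proof.
have h : PT (fun p : unit * nat => p.2.+1) by apply: PT_cast.
exact: (PT_comp h (PT_pair (PT_const _ _ tt) (PT_id _))).
Qed.

Lemma PT_nat_case A (eA : enc A) B (eB : enc B) (n : A -> nat) (g : A -> nat -> B) (h : A -> B) :
  PT n -> PT (fun p : A * nat => g p.1 p.2) -> PT h ->
  PT (fun a => if n a is m.+1 then g a m else h a).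
Proof.
move=> hn hg hh.
have hg' : PT (fun p : A * (unit * nat) => g p.1 p.2.2) by pt.
by apply: (PT_case hn hg' hh) => a; case: (n a) => //= m; exists (tt, m).
Qed.

Lemma PT_predn : PT predn.
Proof.
have : PT (fun n : nat => if n is m.+1 then m else n) by apply: PT_nat_case; pt.
case=> p [k h]; exists p, k => a; have := h a; by case: a.
Qed.

#[export] Hint Resolve PT_succn PT_predn : polytime.

Lemma PT_addn : PT (fun p : nat * nat => p.1 + p.2).
Proof.
apply: (PT_ext (f := fun p : nat * nat => iter p.1 S p.2)).
  by move=> p; rewrite iter_succn addnC.
apply: (@PT_iter_incr _ _ _ _ fst (fun _ => S) snd (fun=> 2)); pt; first by pb.
by move=> _ st; rewrite !sz_nat; lia.
Qed.

#[export] Hint Resolve PT_addn : polytime.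

Lemma PT_muln : PT (fun p : nat * nat => p.1 * p.2).
Proof.
apply: (PT_ext (f := fun p : nat * nat => iter p.1 (addn p.2) 0)).
  by move=> p; rewrite iter_addn addn0 mulnC.
apply: (@PT_iter_incr _ _ _ _ fst (fun p s => p.2 + s) (fun=> 0) (fun p => sz p.2)); pt.
  by pb; pt.
by move=> p st; rewrite !sz_nat; lia.
Qed.

Lemma PT_subn : PT (fun p : nat * nat => p.1 - p.2).
Proof.
apply: (PT_ext (f := fun p : nat * nat => iter p.2 predn p.1)).
  by move=> p; rewrite iter_predn.
apply: (@PT_iter_incr _ _ _ _ snd (fun _ => predn) fst (fun=> 0)); pt; first by pb.
by move=> _ st; rewrite !sz_nat; lia.
Qed.

#[export] Hint Resolve PT_subn : polytime.

#[export] Hint Resolve PT_muln : polytime.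

Lemma PT_leq : PT (fun p : nat * nat => p.1 <= p.2).
Proof.
have : PT (fun p : nat * nat => if p.1 - p.2 is _.+1 then false else true).
  by apply: (@PT_nat_case _ _ _ _ (fun p => p.1 - p.2) (fun _ _ => false) (fun=> true)); pt.
by case=> p [k h]; exists p, k => a; have := h a; rewrite /leq; case: subn.
Qed.

#[export] Hint Resolve PT_leq : polytime.

Lemma PT_eqn : PT (fun p : nat * nat => p.1 == p.2).
Proof.
have : PT (fun p : nat * nat => (p.1 <= p.2) && (p.2 <= p.1)) by pt.
by case=> p [k h]; exists p, k => a; have := h a; rewrite eqn_leq.
Qed.

#[export] Hint Resolve PT_eqn : polytime.

Lemma foldl_rev_cons T (s : seq T) : foldl (fun acc x => x :: acc) [::] s = rev s.
Proof.
rewrite /rev; move: [::] => acc; by elim: s acc => //= x s IH acc; rewrite IH.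
Qed.

Lemma PT_rev X (eX : enc X) : PT (@rev X).
Proof.
apply: (PT_ext (@foldl_rev_cons X)).
apply: (@PT_foldl_incr _ _ _ _ _ _ (fun _ acc x => x :: acc) (fun=> [::]) id (fun s => sz s)); pt; first by pb.
by move=> a st l1 x l2 e; rewrite sz_cons; pose proof (sz_mem e) as szh; move: szh; lia.
Qed.

Lemma PT_catrev X (eX : enc X) : PT (fun p : seq X * seq X => catrev p.1 p.2).
Proof.
apply: (PT_ext (f := fun p => foldl (fun acc x => x :: acc) p.2 p.1)).
  by case=> s t /=; elim: s t => //= x s IH t; rewrite IH.
apply: (@PT_foldl_incr _ _ _ _ _ _ (fun _ acc x => x :: acc) snd fst (fun p => sz p.1)); pt; first by pb; pt.
by move=> a st l1 x l2 e; rewrite sz_cons; pose proof (sz_mem e) as szh; move: szh; lia.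
Qed.

#[export] Hint Resolve PT_rev PT_catrev : polytime.

Lemma PT_cat X (eX : enc X) : PT (fun p : seq X * seq X => p.1 ++ p.2).
Proof.
by apply: (PT_ext (f := fun p => catrev (rev p.1) p.2)); [move=> p; rewrite catrevE revK|pt].
Qed.

Lemma PT_behead X (eX : enc X) : PT (@behead X).
Proof.
apply: (PT_ext (f := fun s : seq X => if s is x :: r then r else s)); first by case.
by apply: (@PT_seq_case _ _ _ _ _ _ id (fun _ _ r => r)); pt.
Qed.

Lemma PT_head X (eX : enc X) : PT (fun p : X * seq X => head p.1 p.2).
Proof.
apply: (PT_ext (f := fun p : X * seq X => if p.2 is x :: r then x else p.1)); first by case=> x [].
by apply: (@PT_seq_case _ _ _ _ _ _ snd (fun _ x _ => x)); pt.
Qed.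

#[export] Hint Resolve PT_cat PT_behead PT_head : polytime.

Lemma sz_behead X {eX : enc X} (s : seq X) : sz (behead s) <= sz s.
Proof. by case: s => //= x s; rewrite sz_cons; lia. Qed.

Lemma PT_drop X (eX : enc X) : PT (fun p : nat * seq X => drop p.1 p.2).
Proof.
apply: (PT_ext (f := fun p => iter p.1 behead p.2)).
  by case=> n s /=; elim: n s => [|n IH] s /=; rewrite ?drop0 // IH -drop1 drop_drop add1n.
apply: (@PT_iter_incr _ _ _ _ fst (fun _ => behead) snd (fun=> 0)); pt; first by pb.
by move=> _ st; pose proof (sz_behead st) as szh; move: szh; lia.
Qed.

#[export] Hint Resolve PT_drop : polytime.

Lemma PT_nth X (eX : enc X) : PT (fun p : X * seq X * nat => nth p.1.1 p.1.2 p.2).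
Proof.
apply: (PT_ext (f := fun p => head p.1.1 (drop p.2 p.1.2))); last by pt.
by move=> p; rewrite -nth0 nth_drop addn0.
Qed.

Lemma PT_size X (eX : enc X) : PT (@size X).
Proof.
apply: (PT_ext (f := foldl (fun n _ => n.+1) 0)).
  move=> s; rewrite -[RHS]add0n; move: 0 => n; elim: s n => //= [|x s IH] n; first by rewrite addn0.
  by rewrite IH addSnnS.
apply: (@PT_foldl_incr _ _ _ _ _ _ (fun _ n _ => n.+1) (fun=> 0) id (fun=> 2)); pt; first by pb.
by move=> a st l1 x l2 e; rewrite !sz_nat; lia.
Qed.

#[export] Hint Resolve PT_nth PT_size : polytime.

Lemma PB_sz_mem A (eA : enc A) X (eX : enc X) Y (eY : enc Y) (f : A * X -> Y) (l : A -> seq X) :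
  PT f -> PT l -> exists2 g, PB g &
  forall a l1 x l2, l a = l1 ++ x :: l2 -> sz (f (a, x)) <= g a.
Proof.
move=> hf hl; have [k hk] := PB_sz hf.
exists (fun a => ((sz a + sz (l a)).+1 + 2) ^ k); first by pb.
move=> a l1 x l2 e; apply: leq_trans (hk _) _; apply: leq_expr2.
by rewrite sz_pair; pose proof (sz_mem e) as szh; move: szh; lia.
Qed.

Lemma PT_map A (eA : enc A) X (eX : enc X) Y (eY : enc Y) (f : A -> X -> Y) (l : A -> seq X) :
  PT (fun p : A * X => f p.1 p.2) -> PT l -> PT (fun a => map (f a) (l a)).
Proof.
move=> hf hl.
apply: (PT_ext (f := fun a => rev (foldl (fun acc x => f a x :: acc) [::] (l a)))).
  move=> a; rewrite -[RHS]revK -[rev (map _ _)]foldl_rev_cons; congr rev.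
  by elim: (l a) [::] => //= x s IH acc; rewrite IH.
have [g hg le] := PB_sz_mem hf hl.
refine (PT_comp (@PT_rev _ _) _).
apply: (@PT_foldl_incr _ _ _ _ _ _ (fun a acc x => f a x :: acc) (fun=> [::]) l (fun a => (g a).+1)); pt; first by pb.
by move=> a st l1 x l2 e; rewrite sz_cons; have := le _ _ _ _ e; rewrite /=; lia.
Qed.

Lemma PT_filter A (eA : enc A) X (eX : enc X) (f : A -> X -> bool) (l : A -> seq X) :
  PT (fun p : A * X => f p.1 p.2) -> PT l -> PT (fun a => filter (f a) (l a)).
Proof.
move=> hf hl.
apply: (PT_ext (f := fun a => rev (foldl (fun acc x => if f a x then x :: acc else acc) [::] (l a)))).
  move=> a; rewrite -[RHS]revK; congr rev; elim/last_ind: (l a) => //= s x IH.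
  by rewrite foldl_rcons IH filter_rcons; case: ifP => // _; rewrite rev_rcons.
refine (PT_comp (@PT_rev _ _) _).
apply: (@PT_foldl_incr _ _ _ _ _ _ (fun a acc x => if f a x then x :: acc else acc) (fun=> [::]) l (fun a => sz (l a))); pt; first by pb.
by move=> a st l1 x l2 e; pose proof (sz_mem e) as szh; move: szh; case: ifP => _; rewrite ?sz_cons; lia.
Qed.

Lemma sz_iota m n : sz (iota m n) <= n * (m + n).*2.+2 + 1.
Proof.
elim: n m => [|n IH] m; rewrite ?sz_nil //= sz_cons sz_nat.
by have := IH m.+1; nia.
Qed.

Lemma PT_iota : PT (fun n : nat => iota 0 n).
Proof.
have iterE n : iter n (fun s : nat * seq nat => (s.1.+1, s.1 :: s.2)) (0, [::]) = (n, rev (iota 0 n)).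
  by elim: n => //= n ->; congr (_, _); rewrite -[0 :: _]/(iota 0 n.+1) -addn1 iotaD rev_cat.
apply: (PT_ext (f := fun n : nat => rev (iter n (fun s : nat * seq nat => (s.1.+1, s.1 :: s.2)) (0, [::])).2)).
  move=> n; rewrite iterE revK //.
refine (PT_comp (@PT_rev _ _) _); refine (PT_snd _).
apply: (@PT_iter _ _ _ _ id (fun _ s => (s.1.+1, s.1 :: s.2)) (fun=> (0, [::]))
  (fun n => n.*2.+1 + (n * (n.*2 + 2) + 1) + 1)); pt.
  apply: (@PB_le _ _ _ (fun n => sz n + sz n * (sz n + 2) + 3)); last by pb.
  by move=> n; rewrite sz_nat; nia.
move=> n i le.
rewrite iterE.
have : sz (rev (iota 0 i)) = sz (iota 0 i).
  elim: (iota 0 i) => // x s IH; rewrite rev_cons -cats1 sz_cons.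
  by pose proof (sz_cat (rev s) [:: x]) as szh; move: szh; rewrite IH sz_cons sz_nil; lia.
rewrite sz_pair => ->; have := sz_iota 0 i; rewrite sz_nat add0n; nia.
Qed.

#[export] Hint Resolve PT_iota : polytime.

Lemma PT_mkseq A (eA : enc A) Y (eY : enc Y) (f : A -> nat -> Y) (n : A -> nat) :
  PT (fun p : A * nat => f p.1 p.2) -> PT n -> PT (fun a => mkseq (f a) (n a)).
Proof.
move=> hf hn; apply: (PT_map (l := fun a => iota 0 (n a)) hf).
exact: (PT_comp PT_iota hn).
Qed.

Ltac pt_hook ::=
  lazymatch goal with
  | |- polytime (fun a => map (@?f a) (@?l a)) => refine (PT_map (f := f) (l := l) _ _); pt
  | |- polytime (fun a => filter (@?f a) (@?l a)) => refine (PT_filter (f := f) (l := l) _ _); pt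
  | |- polytime (fun a => mkseq (@?f a) (@?n a)) => refine (PT_mkseq (f := f) (n := n) _ _); pt
  end.

Lemma PT_zip X (eX : enc X) Y (eY : enc Y) : PT (fun p : seq X * seq Y => zip p.1 p.2).
Proof.
pose step (st : seq Y * seq (X * Y)) x :=
  if st.1 is y :: r then (r, (x, y) :: st.2) else st.
apply: (PT_ext (f := fun p => rev (foldl step (p.2, [::]) p.1).2)).
  case=> s t /=; suff -> : forall acc, foldl step (t, acc) s = (drop (size s) t, catrev (zip s t) acc).
    by rewrite catrevE cats0 revK.
  by elim: s t => [|x s IH] [|y t] acc //=; rewrite ?drop0 // IH //; case: s {IH}.
refine (PT_comp (@PT_rev _ _) _); refine (PT_snd _).
apply: (@PT_foldl_incr _ _ _ _ _ _ (fun=> step) (fun p => (p.2, [::])) fst (fun p => sz p.1 + 2)); pt.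
- rewrite /step; apply: (@PT_seq_case _ _ _ _ _ _ (fun p : seq X * seq Y * (seq Y * seq (X * Y)) * X => p.1.2.1)
    (fun p y r => (r, (p.2, y) :: p.1.2.2)) (fun p => p.1.2)); pt.
- by pb; pt.
move=> a [[|y r] acc] l1 x l2 e; rewrite /step /= !sz_pair ?sz_cons; first by lia.
by pose proof (sz_mem e) as szh; move: szh; rewrite sz_pair; lia.
Qed.

#[export] Hint Resolve PT_zip : polytime.

Import Order.TTheory GRing.Theory Num.Theory.

(** * Binary arithmetic *)

(** Programs see only codes, so a function may be replaced by one into another type that yields the
    same trees. *)
Lemma PT_recode A B C (eA : enc A) (eB : enc B) (eC : enc C) (f : A -> B) (g : A -> C) :
  (forall a, encode (f a) = encode (g a)) -> PT f -> PT g.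
Proof. by move=> e [p [k h]]; exists p, k => a; rewrite -e. Qed.

Definition bval (s : seq bool) : nat := foldr (fun (b : bool) v => b + v.*2) 0 s.

(** Digitwise arithmetic can leave zeros at the most significant end, which [nat_bits] never has;
    the codes of integers require the canonical form. *)
Definition strip (s : seq bool) : seq bool :=
  foldr (fun b acc => if b || (0 < size acc) then b :: acc else [::]) [::] s.

Lemma size_strip_gt0 s : (0 < size (strip s)) = (bval s != 0).
Proof.
elim: s => //= b s; rewrite -/(strip s) => IH; case: ifP; rewrite IH /=; case: b => /=; lia.
Qed.

Lemma strip0 s : bval s = 0 -> strip s = [::].
Proof. by elim: s => //= -[] s IH //= h; rewrite IH //; lia. Qed.

Lemma eq_bval_strip s t : bval s = bval t -> strip s = strip t.
Proof.
elim: s t => [|b s IH] [|c t] // e; [by rewrite (strip0 (esym e))|by rewrite (strip0 e)|].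
rewrite /= -!/(strip _) (IH t); last by move: e => /=; case: b c => -[] /=; lia.
by have -> : b = c by move: e => /=; case: b c => -[] /=; lia.
Qed.

Lemma bval_pos_bits p : bval (pos_bits p) = nat_of_pos p.
Proof. by elim: p => //= p ->; lia. Qed.

Lemma bval_nat_bits n : bval (nat_bits n) = n.
Proof.
rewrite -[RHS]bin_of_natK /nat_bits; case: (bin_of_nat n) => //= p.
exact: bval_pos_bits.
Qed.

Lemma strip_nat_bits n : strip (nat_bits n) = nat_bits n.
Proof.
rewrite /nat_bits; case: (bin_of_nat n) => //.
have pos p : 0 < size (pos_bits p) by case: p.
by elim=> //= p ->; rewrite ?pos ?orbT.
Qed.

Lemma nat_bits_bval s : nat_bits (bval s) = strip s.
Proof. by rewrite -strip_nat_bits; apply: eq_bval_strip; rewrite bval_nat_bits. Qed.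

Lemma bval_lt s : bval s < 2 ^ size s.
Proof. by elim: s => //= b s IH; rewrite expnS; case: b; lia. Qed.

Lemma size_strip s k : bval s < 2 ^ k -> size (strip s) <= k.
Proof.
elim: s k => // b s IH [|k] lt.
  by rewrite strip0 //; move: lt; rewrite expn0; case: (bval _).
by rewrite /= -/(strip s); case: ifP => //= _; apply: IH; move: lt; rewrite expnS /=; lia.
Qed.

Lemma size_nat_bits n k : n < 2 ^ k -> size (nat_bits n) <= k.
Proof. by move=> lt; rewrite -strip_nat_bits; apply: size_strip; rewrite bval_nat_bits. Qed.

Lemma nat_bits_lt n : n < 2 ^ size (nat_bits n).
Proof. by rewrite -{1}(bval_nat_bits n) bval_lt. Qed.

Lemma sz_bits (s : seq bool) : sz s <= 4 * size s + 1.
Proof. by elim: s => // b s IH; rewrite sz_cons /=; have := sz_bool b; lia. Qed.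

Lemma sz_int (z : int) k : `|z|%N < 2 ^ k -> sz z <= 4 * k + 6.
Proof.
move=> lt; rewrite /sz tsize_node -!/(sz _) /=.
have := sz_bool (z < 0)%R; have := sz_bits (nat_bits `|z|); have := size_nat_bits lt.
by rewrite /sz; lia.
Qed.

Lemma int_lt_sz (z : int) : `|z|%N < 2 ^ sz z.
Proof.
apply: leq_trans (nat_bits_lt _) _; rewrite leq_exp2l // /sz tsize_node.
pose proof (sz_size (nat_bits `|z|)) as h; move: h; rewrite /sz /=; lia.
Qed.

Lemma PT_strip : PT strip.
Proof.
apply: (PT_ext (f := fun s => foldl (fun acc (b : bool) =>
  if b || (0 < size acc) then b :: acc else [::]) [::] (rev s))).
  by move=> s; rewrite foldl_rev.
apply: (@PT_foldl_incr _ _ _ _ _ _ (fun _ acc (b : bool) => if b || (0 < size acc) then b :: acc else [::])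
  (fun=> [::]) rev (fun=> 4)); pt; first by pb.
move=> _ acc _ b _ _; have := sz_bool b; case: ifP => _; rewrite ?sz_cons ?sz_nil; first by lia.
by pose proof (sz_gt0 acc) as h; lia.
Qed.

#[export] Hint Resolve PT_strip : polytime.

Definition int_of_bits (b : bool) (s : seq bool) : int := ((-1) ^+ b * (bval s)%:Z)%R.

Lemma int_of_bits_sign b s : (int_of_bits b s < 0)%R = b && (bval s != 0).
Proof. by rewrite /int_of_bits; case: b; rewrite ?expr1 ?expr0 ?mul1r; lia. Qed.

Lemma abs_int_of_bits b s : `|int_of_bits b s|%N = bval s.
Proof. by rewrite /int_of_bits; case: b; rewrite ?expr1 ?expr0 ?mul1r; lia. Qed.

Lemma PT_int_of_bits : PT (fun p : bool * seq bool => int_of_bits p.1 p.2).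
Proof.
apply: (@PT_recode _ _ _ _ _ _ (fun p => (p.1 && (0 < size (strip p.2)), strip p.2))); last by pt.
move=> [b s] /=; rewrite /encode /enc_int int_of_bits_sign abs_int_of_bits nat_bits_bval.
by rewrite size_strip_gt0.
Qed.

#[export] Hint Resolve PT_int_of_bits : polytime.

Definition int_bits (z : int) := nat_bits `|z|%N.
Definition int_neg (z : int) := (z < 0)%R.

Lemma PT_int_bits : PT int_bits.
Proof. by apply: (PT_snd (f := fun z : int => ((z < 0)%R, nat_bits `|z|%N))); apply: PT_cast. Qed.

Lemma PT_int_neg : PT int_neg.
Proof. by apply: (PT_fst (f := fun z : int => ((z < 0)%R, nat_bits `|z|%N))); apply: PT_cast. Qed.

(** A full adder. The state is the carry and the digits of the sum so far, most significant
    first. *)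
Definition adder_step (st : bool * seq bool) (p : bool * bool) :=
  ((p.1 && p.2) || (st.1 && (p.1 (+) p.2)), (p.1 (+) p.2 (+) st.1) :: st.2).

Definition adder (c : bool) (l : seq (bool * bool)) := foldl adder_step (c, [::]) l.

Lemma bval_cat s t : bval (s ++ t) = bval s + 2 ^ size s * bval t.
Proof. by elim: s => [|b s IH] /=; rewrite ?mul1n // IH expnS; lia. Qed.

Lemma size_adder c l : size (adder c l).2 = size l.
Proof. by elim/last_ind: l => // l p IH; rewrite /adder foldl_rcons size_rcons -IH. Qed.

Lemma adderE c l : bval (rev (adder c l).2) + (adder c l).1 * 2 ^ size l =
  c + bval (unzip1 l) + bval (unzip2 l).
Proof.
elim/last_ind: l => [|l [x y] IH]; first by rewrite /= expn0; lia.
rewrite /adder foldl_rcons -/(adder c l) /= rev_cons -cats1 bval_cat size_rev size_adder.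
rewrite size_rcons expnS /unzip1 /unzip2 !map_rcons -!cats1 !bval_cat !size_map /=.
move: IH; rewrite -/(unzip1 l) -/(unzip2 l); move: (2 ^ size l) => w.
by case: (adder c l) => -[] u; case: x; case: y => /=; lia.
Qed.

Lemma PT_adder : PT (fun p : bool * seq (bool * bool) => adder p.1 p.2).
Proof.
rewrite /adder; apply: (@PT_foldl_incr _ _ _ _ _ _ (fun=> adder_step) (fun p => (p.1, [::])) snd (fun=> 10));
  rewrite /adder_step; pt; first by pb.
move=> a [c u] l1 [x y] l2 _ /=; rewrite !sz_pair !sz_cons.
have := sz_bool (x && y || c && (x (+) y)); have := sz_bool (x (+) y (+) c).
by pose proof (sz_gt0 c) as h; lia.
Qed.

#[export] Hint Resolve PT_int_bits PT_int_neg PT_adder : polytime.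

(** [pad s t] and [pad t s] have the same length, so they can be zipped without loss. *)
Definition pad (s t : seq bool) := s ++ map (fun=> false) t.

Lemma bval_pad s t : bval (pad s t) = bval s.
Proof.
by rewrite bval_cat; have -> : bval (map (fun=> false) t) = 0; [elim: t => //= b t -> | lia].
Qed.

Lemma size_pad s t : size (pad s t) = size s + size t.
Proof. by rewrite size_cat size_map. Qed.

Definition add_bits s t := let r := adder false (zip (pad s t) (pad t s)) in rev (r.1 :: r.2).
(** Two's complement: the complement of [t] is added with an incoming carry, and the outgoing carry
    says that nothing had to be borrowed. *)
Definition sub_bits s t := let r := adder true (zip (pad s t) (map negb (pad t s))) in (r.1, rev r.2).

Lemma bval_add_bits s t : bval (add_bits s t) = bval s + bval t.
Proof.
rewrite /add_bits /=; have := adderE false (zip (pad s t) (pad t s)).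
rewrite unzip1_zip ?unzip2_zip ?size_pad 1?addnC // !bval_pad size_zip !size_pad.
by rewrite rev_cons -cats1 bval_cat size_rev size_adder size_zip !size_pad /=; lia.
Qed.

Lemma sub_bitsE s t : (sub_bits s t).1 = (bval t <= bval s) /\
  (bval t <= bval s -> bval (sub_bits s t).2 = bval s - bval t).
Proof.
rewrite /sub_bits /=; set l := zip _ _; have := adderE true l; have := bval_lt (rev (adder true l).2).
rewrite size_rev size_adder unzip1_zip ?unzip2_zip ?size_map ?size_pad 1?addnC //.
have neg u : bval (map negb u) + bval u + 1 = 2 ^ size u.
  by elim: u => //= b u IH; rewrite expnS -IH; case: b => /=; lia.
have := neg (pad t s); rewrite !bval_pad size_pad.
have -> : size l = size t + size s by rewrite size_zip size_map !size_pad; lia.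
have := bval_lt (pad s t); rewrite bval_pad size_pad addnC.
move: (2 ^ _) => w; case: (adder true l) => -[] u /=; lia.
Qed.

Lemma PT_add_bits : PT (fun p : seq bool * seq bool => add_bits p.1 p.2).
Proof. by rewrite /add_bits /pad; pt. Qed.

Lemma PT_sub_bits : PT (fun p : seq bool * seq bool => sub_bits p.1 p.2).
Proof. by rewrite /sub_bits /pad; pt. Qed.

#[export] Hint Resolve PT_add_bits PT_sub_bits : polytime.

Definition add_int (x y : int) : int :=
  if ~~ (int_neg x (+) int_neg y) then int_of_bits (int_neg x) (add_bits (int_bits x) (int_bits y))
  else if (sub_bits (int_bits x) (int_bits y)).1
    then int_of_bits (int_neg x) (sub_bits (int_bits x) (int_bits y)).2
    else int_of_bits (int_neg y) (sub_bits (int_bits y) (int_bits x)).2.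

Lemma add_intE x y : add_int x y = (x + y)%R.
Proof.
rewrite /add_int /int_of_bits bval_add_bits /int_neg /int_bits.
have [-> h1] := sub_bitsE (nat_bits `|x|) (nat_bits `|y|).
have [_ h2] := sub_bitsE (nat_bits `|y|) (nat_bits `|x|).
move: h1 h2; rewrite !bval_nat_bits => h1 h2.
case: leqP => h; [move: (h1 h) => {}h1|move: (h2 (ltnW h)) => {}h2];
  case: (ltrP x 0%R) => hx; case: (ltrP y 0%R) => hy; rewrite /= ?bval_nat_bits ?h1 ?h2 ?expr1 ?expr0 ?mul1r; lia.
Qed.

Lemma PT_addz : PT (fun p : int * int => (p.1 + p.2)%R).
Proof.
apply: (PT_ext (f := fun p => add_int p.1 p.2)) => [p|]; first exact: add_intE.
by rewrite /add_int; pt.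
Qed.

Lemma PT_oppz : PT (fun z : int => (- z)%R).
Proof.
apply: (PT_ext (f := fun z : int => int_of_bits (~~ int_neg z) (int_bits z))); last by pt.
move=> z; rewrite /int_of_bits bval_nat_bits /int_neg.
by case: ltrP => /=; rewrite ?expr1 ?expr0 ?mul1r; lia.
Qed.

#[export] Hint Resolve PT_addz PT_oppz : polytime.

Lemma PT_ltz : PT (fun p : int * int => (p.1 < p.2)%R).
Proof.
apply: (PT_ext (f := fun p : int * int => int_neg (p.1 - p.2)%R)); last by pt.
by move=> p; rewrite /int_neg subr_lt0.
Qed.

#[export] Hint Resolve PT_ltz : polytime.

Lemma PT_lez : PT (fun p : int * int => (p.1 <= p.2)%R).
Proof.
apply: (PT_ext (f := fun p : int * int => ~~ (p.2 < p.1)%R)); last by pt.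
by move=> p; rewrite leNgt.
Qed.

#[export] Hint Resolve PT_lez : polytime.

Lemma PT_eqz : PT (fun p : int * int => p.1 == p.2).
Proof.
apply: (PT_ext (f := fun p : int * int => (p.1 <= p.2)%R && (p.2 <= p.1)%R)); last by pt.
by move=> p; rewrite -eq_le.
Qed.

#[export] Hint Resolve PT_eqz : polytime.

Definition horner_bits (s : seq bool) (y : int) : int :=
  foldl (fun (acc : int) (b : bool) => (acc + acc + if b then y else 0)%R) 0%R (rev s).

Lemma horner_bitsE s y : horner_bits s y = ((bval s)%:Z * y)%R.
Proof.
rewrite /horner_bits foldl_rev; elim: s => [|b s IH] /=; first by rewrite mul0r.
by rewrite IH -addnn !PoszD !mulrDl; case: b; rewrite /= ?mul1r ?mul0r; lia.
Qed.

Lemma PT_horner_bits : PT (fun p : seq bool * int => horner_bits p.1 p.2).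
Proof.
apply: (@PT_foldl _ _ _ _ _ _ (fun p (acc : int) (b : bool) => (acc + acc + if b then p.2 else 0)%R)
  (fun=> 0%R) (fun p => rev p.1) (fun p => 4 * (sz (rev p.1) + sz p.2) + 6)); pt; first by pb; pt.
move=> [s y] l1 l2 /= e; apply: sz_int.
have -> : l1 = rev (rev l1) by rewrite revK.
rewrite -/(horner_bits (rev l1) y) horner_bitsE abszM /= expnD.
apply: ltn_mul; last exact: int_lt_sz.
apply: leq_trans (bval_lt _) _; rewrite leq_exp2l // size_rev.
by pose proof (sz_size (rev s)) as h; move: h; rewrite e size_cat; lia.
Qed.

#[export] Hint Resolve PT_horner_bits : polytime.

Lemma PT_mulz : PT (fun p : int * int => (p.1 * p.2)%R).
Proof.
apply: (PT_ext (f := fun p : int * int => let h := horner_bits (int_bits p.1) p.2 in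
  if (p.1 < 0)%R then (- h)%R else h)); last by pt.
by move=> [x y] /=; rewrite horner_bitsE bval_nat_bits; case: ltrP => h; nia.
Qed.

#[export] Hint Resolve PT_mulz : polytime.

(** * Polynomial-time functions on words *)

Definition is_symbol (c : cell) : bool := if c is Some _ then true else false.

Fixpoint push_word (j : reg) (w : seq symbol) : prog :=
  if w is s :: w' then Seq (push_word j w') (Push j s) else skip.

Definition transfer_symbol (i j : reg) (f : symbol -> seq symbol) : prog :=
  If i is_true_bit (Seq (Pop i) (push_word j (f (Bit true))))
    (If i is_bit (Seq (Pop i) (push_word j (f (Bit false)))) (Seq (Pop i) (push_word j (f Sep)))).

Definition transfer i j f := While i is_symbol (transfer_symbol i j f).

Section Transfer.
Variables (i j : reg) (mk : seq symbol -> seq symbol -> stacks).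
Hypothesis get_i : forall u v, get (mk u v) i = u.
Hypothesis get_j : forall u v, get (mk u v) j = v.
Hypothesis upd_i : forall u v w, upd (mk u v) i w = mk w v.
Hypothesis upd_j : forall u v w, upd (mk u v) j w = mk u w.

Lemma exec_le_push_word w u v : exec_le (push_word j w) (mk u v) (2 * size w + 3) (mk u (w ++ v)).
Proof.
elim: w => [|s w IH] /=; first exact: exec_le_weak (exec_le_skip _) _.
apply: (exec_le_seq IH) (_ : 2 * size w + 3 + 2 <= _); last by lia.
by apply: exec_le_push; rewrite get_j upd_j.
Qed.

Lemma exec_le_transfer_symbol f c s u v : (forall s, size (f s) <= c) ->
  exec_le (transfer_symbol i j f) (mk (s :: u) v) (2 * c + 6) (mk u (f s ++ v)).
Proof.
move=> hf.
have pop_push : exec_le (Seq (Pop i) (push_word j (f s))) (mk (s :: u) v) (2 * c + 4) (mk u (f s ++ v)).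
  apply: (exec_le_seq (exec_le_pop (erefl _))); first by rewrite get_i upd_i; apply: exec_le_push_word.
  by have := hf s; lia.
have tp : top (mk (s :: u) v) i = Some s by rewrite /top get_i.
rewrite /transfer_symbol; case: s pop_push tp => [[]|] pop_push tp.
- apply: (@exec_le_weak _ _ (2 * c + 4).+1); last by lia.
  by apply: exec_le_if_true; [rewrite tp|exact: pop_push].
- apply: (@exec_le_weak _ _ (2 * c + 4).+2); last by lia.
  apply: exec_le_if_false; first by rewrite tp.
  by apply: exec_le_if_true; [rewrite tp|exact: pop_push].
- apply: (@exec_le_weak _ _ (2 * c + 4).+2); last by lia.
  apply: exec_le_if_false; first by rewrite tp.
  by apply: exec_le_if_false; [rewrite tp|exact: pop_push].
Qed.

Lemma exec_le_transfer f c u v : (forall s, size (f s) <= c) ->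
  exec_le (transfer i j f) (mk u v) ((2 * c + 7) * size u + 1) (mk [::] (foldl (fun w s => f s ++ w) v u)).
Proof.
move=> hf; elim: u v => [|s u IH] v /=.
  by rewrite muln0; apply: exec_le_while_false; rewrite /top get_i.
apply: (exec_le_while_true _ (exec_le_transfer_symbol s u v hf) (IH _)); last by rewrite mulnS; lia.
by rewrite /top get_i.
Qed.
End Transfer.

Definition list_cell (s : symbol) : seq symbol := Bit true :: cd (encode s).

(** The word is first reversed onto [R1], because the code of a list is built from its last entry
    on. *)
Definition load : prog :=
  Seq (transfer R0 R1 (fun s => [:: s]))
    (Seq (Push R0 (Bit false)) (transfer R1 R0 list_cell)).

Lemma foldl_cons (u v : seq symbol) : foldl (fun w s => [:: s] ++ w) v u = rev u ++ v.
Proof. by elim: u v => //= s u IH v; rewrite IH rev_cons cat_rcons. Qed.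

Lemma foldl_cells (u v w : seq symbol) : v = cd (encode w) ->
  foldl (fun w s => list_cell s ++ w) v u = cd (encode (rev u ++ w)).
Proof.
elim: u v w => //= s u IH v w ->; rewrite (IH _ (s :: w)) ?rev_cons ?cat_rcons //.
by rewrite /cd /= map_cat.
Qed.

Lemma size_list_cell s : size (list_cell s) <= 6.
Proof. by case: s => [[]|]. Qed.

Lemma exec_le_load w : exec_le load (Stacks w [::] [::] [::]) (28 * size w + 10)
  (Stacks (cd (encode w)) [::] [::] [::]).
Proof.
apply: (exec_le_seq (exec_le_transfer (i := R0) (j := R1) (mk := fun u v => Stacks u v [::] [::])
  (c := 1) _ _ _ _ w [::] _)) => //.
  rewrite foldl_cons cats0.
  apply: (exec_le_seq (exec_le_push (erefl _))); last exact: leqnn.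
  rewrite /=; have := @exec_le_transfer R1 R0 (fun u v => Stacks v u [::] [::]) _ _ _ _
    list_cell 6 (rev w) [:: Bit false] size_list_cell.
  by rewrite (@foldl_cells _ _ [::]) // revK cats0; apply.
rewrite size_rev; lia.
Qed.

Definition unload_symbol : prog :=
  Seq (Pop R0)
    (If R0 is_true_bit
      (Seq (Pop R0) (Seq (Pop R0)
        (If R0 is_true_bit (Seq (Pop R0) (Seq (Pop R0) (Seq (Pop R0) (Push R1 (Bit true)))))
          (Seq (Pop R0) (Push R1 (Bit false))))))
      (Seq (Pop R0) (Push R1 Sep))).

Definition unload : prog :=
  Seq (While R0 is_true_bit unload_symbol) (Seq (Pop R0) (transfer R1 R0 (fun s => [:: s]))).

Lemma exec_le_unload_symbol s u v :
  exec_le unload_symbol (Stacks (list_cell s ++ u) v [::] [::]) 12 (Stacks u (s :: v) [::] [::]).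
Proof.
have pop t p a s' b c d st : exec_le p (Stacks a b c d) t st ->
    exec_le (Seq (Pop R0) p) (Stacks (s' :: a) b c d) t.+1 st.
  by move=> h; apply: (@exec_le_seq _ _ _ (Stacks a b c d) _ 1 t) => //; apply: exec_le_pop.
have push s' a b c d : exec_le (Push R1 s') (Stacks a b c d) 2 (Stacks a (s' :: b) c d).
  exact: exec_le_push.
rewrite /unload_symbol; case: s => [[]|] /=.
- apply: (@exec_le_weak _ _ 10) => //; apply/pop/exec_le_if_true => //; apply/pop/pop/exec_le_if_true => //.
  by apply/pop/pop/pop/push.
- apply: (@exec_le_weak _ _ 8) => //; apply/pop/exec_le_if_true => //; apply/pop/pop/exec_le_if_false => //.
  by apply/pop/push.
by apply: (@exec_le_weak _ _ 5) => //; apply/pop/exec_le_if_false => //; apply/pop/push.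
Qed.

Lemma exec_le_unload w : exec_le unload (Stacks (cd (encode w)) [::] [::] [::]) (22 * size w + 10) (Stacks w [::] [::] [::]).
Proof.
have loop v : exec_le (While R0 is_true_bit unload_symbol) (Stacks (cd (encode w)) v [::] [::]) (13 * size w + 1)
    (Stacks [:: Bit false] (rev w ++ v) [::] [::]).
  elim: w v => [|s w IH] v; first by apply: exec_le_while_false.
  have -> : cd (encode (s :: w)) = list_cell s ++ cd (encode w) by rewrite /cd /= map_cat.
  apply: (exec_le_while_true _ (exec_le_unload_symbol _ _ _)); first by [].
    by rewrite rev_cons cat_rcons; apply: IH.
  by rewrite /=; lia.
apply: (exec_le_seq (loop _)).
  apply: (exec_le_seq (exec_le_pop (erefl _))); last exact: leqnn.
  rewrite /= cats0; have := @exec_le_transfer R1 R0 (fun u v => Stacks v u [::] [::]) _ _ _ _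
    (fun s => [:: s]) 1 (rev w) [::] (fun=> isT).
  by rewrite foldl_cons revK cats0; apply.
by rewrite size_rev; lia.
Qed.

Local Open Scope ring_scope.

Theorem polytime_machine (f : seq symbol -> seq symbol) : PT f ->
  exists (M : turing_machine symbol) (p : {poly nat}), forall w, tm_outputs_within M w p.[size w] (f w).
Proof.
move=> hf; have hsz := PB_sz hf; case: (hf) => p [k hp].
have szE (w : seq symbol) : (size w <= sz w)%N by elim: w => //= s w IH; rewrite sz_cons; lia.
(* A symbol has a code of size at most 5, and its list cell adds one. *)
have szle (w : seq symbol) : (sz w <= 6 * size w + 1)%N.
  elim: w => //= s w IH; rewrite sz_cons; have : (sz s <= 5)%N by case: s => [[]|].
  by move: IH; lia.
have [l hl] : PB (fun w : seq symbol => (28 * sz w + 10 + ((sz w + 2) ^ k + (22 * sz (f w) + 10)))%N) by pb.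
exists (machine_of (Seq load (Seq p unload))), ((6%:P * 'X + 3%:P) ^+ l) => w.
have [t le run] : exec_le (Seq load (Seq p unload)) (input_stacks w) ((6 * size w + 3) ^ l)%N (Stacks (f w) [::] [::] [::]).
  apply: exec_le_weak (_ : ((sz w + 2) ^ l <= _)%N); last first.
    by apply: leq_expr2; rewrite (_ : (6 * size w + 3 = 6 * size w + 1 + 2)%N) ?leq_add2r ?szle // -addnA.
  apply: exec_le_weak (hl w); apply: (exec_le_seq (exec_le_load w)); last first.
    apply: leq_add; first by rewrite leq_add2r leq_mul2l szE orbT.
    exact: leqnn.
  have := hp w [::] [::] [::] [::]; rewrite !cats0 => hpw.
  apply: (exec_le_seq hpw (exec_le_unload _)).
  by rewrite leq_add2l leq_add2r leq_mul2l szE orbT.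
have := machine_of_outputs run le; rewrite /=.
rewrite horner_exp hornerD hornerM !hornerC hornerX.
by [].
Qed.

(** * Division, greatest common divisors, finite sums and products of integers *)

Definition absz_int (z : int) : int := if z < 0 then - z else z.

Lemma absz_intE z : absz_int z = `|z|%N%:Z.
Proof. by rewrite /absz_int; case: ltrP => h; lia. Qed.

Lemma PT_absz_int : PT absz_int.
Proof. by rewrite /absz_int; pt. Qed.

#[export] Hint Resolve PT_absz_int : polytime.

(** Long division in base 2: the next digit of the dividend is appended to the remainder, from which
    [d] is subtracted if possible. *)
Definition div_step (d : int) (st : int * int) (b : bool) : int * int :=
  if d <= st.2 + st.2 + (if b then 1 else 0)
  then (st.1 + st.1 + 1, st.2 + st.2 + (if b then 1 else 0) - d)
  else (st.1 + st.1, st.2 + st.2 + (if b then 1 else 0)).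

Definition divmod (z d : int) : int * int :=
  foldl (div_step (absz_int d)) (0, 0) (rev (int_bits z)).

(** The size bounds on [q] and [r] include [d = 0], since the running time must be polynomial on
    every input. *)
Lemma div_stepE (d : nat) l : let st := foldl (div_step d%:Z) (0, 0) l in
  exists q r : nat, [/\ st = (q%:Z, r%:Z), (q < 2 ^ size l)%N, (r < 2 ^ size l)%N &
   bval (rev l) = (q * d + r)%N /\ ((0 < d)%N -> (r < d)%N)].
Proof.
elim/last_ind: l => [|l b]; first by exists 0%N, 0%N; rewrite expn0.
rewrite foldl_rcons rev_rcons size_rcons expnS => -[q [r [-> hq hr [e lt]]]].
rewrite /div_step /= e; case: ifP => h.
  exists (q + q + 1)%N, (r + r + b - d)%N; case: b h => /= h; split; rewrite ?mulnDl; try lia.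
  - by congr (_, _); lia.
  - by congr (_, _); lia.
exists (q + q)%N, (r + r + b)%N; case: b h => /= h; split; rewrite ?mulnDl; try lia.
- by congr (_, _); lia.
- by congr (_, _); lia.
Qed.

Lemma divmodE z d : d != 0 -> divmod z d = ((`|z| %/ `|d|)%N%:Z, (`|z| %% `|d|)%N%:Z).
Proof.
move=> d0; rewrite /divmod absz_intE.
have [q [r [-> _ _ [e lt]]]] := div_stepE `|d| (rev (int_bits z)).
move: e; rewrite revK bval_nat_bits => ->.
have d1 : (0 < `|d|)%N by lia.
by rewrite divnMDl // modnMDl divn_small ?modn_small ?lt // addn0.
Qed.

Lemma PT_divmod : PT (fun p : int * int => divmod p.1 p.2).
Proof.
apply: (@PT_foldl _ _ _ _ _ _ (fun p => div_step (absz_int p.2)) (fun=> (0, 0))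
  (fun p => rev (int_bits p.1)) (fun p => (8 * sz (rev (int_bits p.1)) + 13)%N)); rewrite /div_step; pt.
  by pb; pt.
move=> [z d] l1 l2 /= e; rewrite absz_intE -/(div_step _).
have [q [r [-> hq hr _]]] := div_stepE `|d| l1; rewrite sz_pair.
have := sz_int (z := q%:Z) hq; have := sz_int (z := r%:Z) hr.
pose proof (sz_size (rev (int_bits z))) as h; move: h; rewrite e size_cat; lia.
Qed.

#[export] Hint Resolve PT_divmod : polytime.

Definition quoz (z d : int) : int :=
  if d == 0 then 0 else
  if (z < 0) (+) (d < 0) then - (divmod z d).1 else (divmod z d).1.

Lemma quozE d k : d != 0 -> quoz (k * d) d = k.
Proof.
move=> d0; rewrite /quoz (negPf d0) divmodE //= abszM mulnK; last by lia.
by case: ltrP => h1; case: ltrP => h2 /=; nia.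
Qed.

Lemma PT_quoz : PT (fun p : int * int => quoz p.1 p.2).
Proof. by rewrite /quoz; pt. Qed.

#[export] Hint Resolve PT_quoz : polytime.

Definition gcd_step (st : int * int) : int * int :=
  if st.2 == 0 then st else (st.2, (divmod st.1 st.2).2).

Definition gcd_int (x y : int) : int :=
  (iter (size (int_bits y)).*2 gcd_step (absz_int x, absz_int y)).1.

Lemma gcd_stepE (a b : nat) : gcd_step (a%:Z, b%:Z) =
  if b == 0%N then (a%:Z, b%:Z) else (b%:Z, (a %% b)%N%:Z).
Proof.
rewrite /gcd_step /=; case: (altP (b =P 0%N)) => [->|h] //=.
by rewrite ifF ?divmodE //; lia.
Qed.

(** Two Euclidean steps at least halve the second number: if [r] is the remainder of [a] modulo [b],
    then [b] is at least the sum of [r] and [b %% r], and the latter is smaller than [r]. *)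
Lemma iter_gcd_step k (a b : nat) : (b < 2 ^ k)%N ->
  iter k.*2 gcd_step (a%:Z, b%:Z) = ((gcdn a b)%:Z, 0).
Proof.
elim: k a b => [|k IH] a b h.
  by move: h; rewrite expn0 ltnS leqn0 => /eqP ->; rewrite gcdn0.
rewrite doubleS !iterSr gcd_stepE; case: (altP (b =P 0%N)) => [->|b0].
  by rewrite gcd_stepE eqxx IH ?gcdn0 // expn_gt0.
have lt1 : (a %% b < b)%N by rewrite ltn_mod lt0n.
have g1 : gcdn a b = gcdn b (a %% b) by rewrite gcdn_modr gcdnC.
rewrite gcd_stepE; case: (altP (a %% b =P 0)%N) => [e|r0].
  by rewrite e IH ?expn_gt0 // g1 e.
rewrite IH; first by rewrite gcdn_modr g1 gcdnC.
have lt2 : (b %% (a %% b) < a %% b)%N by rewrite ltn_mod lt0n.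
have := divn_eq b (a %% b); have : (0 < b %/ (a %% b))%N by rewrite divn_gt0; lia.
by move: h; rewrite expnS; nia.
Qed.

Lemma gcd_intE x y : gcd_int x y = (gcdn `|x| `|y|)%:Z.
Proof. by rewrite /gcd_int !absz_intE iter_gcd_step ?nat_bits_lt. Qed.

Lemma PT_double : PT double.
Proof. by apply: (PT_ext (f := fun n => n + n)%N) => [n|]; [rewrite addnn|pt]. Qed.

#[export] Hint Resolve PT_double : polytime.

Lemma PT_gcd_int : PT (fun p : int * int => gcd_int p.1 p.2).
Proof.
rewrite /gcd_int; refine (PT_fst _).
apply: (@PT_iter _ _ _ _ (fun p => (size (int_bits p.2)).*2) (fun=> gcd_step)
  (fun p => (absz_int p.1, absz_int p.2)) (fun p => (8 * (sz p.1 + sz p.2) + 13)%N)); rewrite /gcd_step; pt.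
  by pb; pt.
move=> [x y] i _ /=; rewrite !absz_intE -/gcd_step.
have [a [b [-> ha hb]]] : exists a b : nat, [/\ iter i gcd_step (`|x|%N%:Z, `|y|%N%:Z) = (a%:Z, b%:Z),
    (a < 2 ^ (sz x + sz y))%N & (b < 2 ^ (sz x + sz y))%N].
  elim: i => [|i [a [b [/= -> ha hb]]]] /=.
    exists `|x|%N, `|y|%N; split=> //.
      by apply: leq_trans (int_lt_sz _) _; rewrite leq_exp2l ?leq_addr.
    by apply: leq_trans (int_lt_sz _) _; rewrite leq_exp2l ?leq_addl.
  rewrite gcd_stepE; case: eqP => [e|/eqP b0]; first by exists a, b.
  by exists b, (a %% b)%N; split=> //; apply: leq_trans hb; rewrite ltnW // ltnS ltn_mod lt0n.
have := sz_int (z := a%:Z) ha; have := sz_int (z := b%:Z) hb; rewrite sz_pair; lia.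
Qed.

#[export] Hint Resolve PT_gcd_int : polytime.

Definition sumz (n : nat) (F : nat -> int) : int := foldl (fun s i => s + F i) 0 (iota 0 n).
Definition prodz (n : nat) (F : nat -> int) : int := foldl (fun s i => s * F i) 1 (iota 0 n).

Lemma sumzE n F : sumz n F = \sum_(i < n) F i.
Proof.
rewrite /sumz; elim: n => [|n IH]; first by rewrite big_ord0.
by rewrite -addn1 iotaD foldl_cat IH addn1 big_ord_recr.
Qed.

Lemma prodzE n F : prodz n F = \prod_(i < n) F i.
Proof.
rewrite /prodz; elim: n => [|n IH]; first by rewrite big_ord0.
by rewrite -addn1 iotaD foldl_cat IH addn1 big_ord_recr.
Qed.

Lemma iota_prefix n l1 l2 : iota 0 n = l1 ++ l2 -> l1 = iota 0 (size l1) /\ (size l1 <= n)%N.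
Proof.
move=> e; have s : (size l1 + size l2)%N = n by rewrite -size_cat -e size_iota.
split; last by lia.
by have := congr1 (take (size l1)) e; rewrite take_size_cat // -s iotaD take_size_cat ?size_iota.
Qed.

Lemma PB_mem_iota A (eA : enc A) (F : A -> nat -> int) (n : A -> nat) :
  PT (fun p : A * nat => F p.1 p.2) -> PT n ->
  exists2 g, PB g & forall a i, (i < n a)%N -> (`|F a i| < 2 ^ g a)%N.
Proof.
move=> hF hn.
have [g hg le] := PB_sz_mem (f := fun p : A * nat => F p.1 p.2) (l := fun a => iota 0 (n a)) hF (PT_comp PT_iota hn).
exists g => // a i lt; apply: leq_trans (int_lt_sz _) _; rewrite leq_exp2l //.
apply: (le a (iota 0 i) i (iota i.+1 (n a - i.+1))).
have e1 : iota 0 i.+1 = iota 0 i ++ [:: i] by rewrite -addn1 iotaD.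
by rewrite -[X in iota _ X = _](subnKC lt) iotaD e1 -catA.
Qed.

Lemma PT_sumz A (eA : enc A) (F : A -> nat -> int) (n : A -> nat) :
  PT (fun p : A * nat => F p.1 p.2) -> PT n -> PT (fun a => sumz (n a) (F a)).
Proof.
move=> hF hn; have [g hg le] := PB_mem_iota hF hn.
apply: (@PT_foldl _ _ _ _ _ _ (fun a s i => s + F a i) (fun=> 0) (fun a => iota 0 (n a))
  (fun a => (4 * (g a + sz (n a)) + 6)%N)); pt; first by pb.
move=> a l1 l2 /iota_prefix [e hs]; rewrite e -/(sumz _ _); apply: sz_int.
have : (`|sumz (size l1) (F a)| <= size l1 * 2 ^ g a)%N.
  rewrite sumzE; elim: (size l1) hs => [|k IH] hk; first by rewrite big_ord0.
  rewrite big_ord_recr /=; have tri (x y : int) : (absz (x + y)%R <= absz x + absz y)%N by lia.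
  by apply: leq_trans (tri _ _) _; rewrite mulSn addnC leq_add ?IH 1?ltnW ?le.
move/leq_ltn_trans; apply; rewrite expnD mulnC ltn_pmul2l ?expn_gt0 //.
by apply: leq_trans (ltn_expl _ (isT : (1 < 2)%N)) _; rewrite leq_exp2l // sz_nat; lia.
Qed.

Lemma PT_prodz A (eA : enc A) (F : A -> nat -> int) (n : A -> nat) :
  PT (fun p : A * nat => F p.1 p.2) -> PT n -> PT (fun a => prodz (n a) (F a)).
Proof.
move=> hF hn; have [g hg le] := PB_mem_iota hF hn.
apply: (@PT_foldl _ _ _ _ _ _ (fun a s i => s * F a i) (fun=> 1) (fun a => iota 0 (n a))
  (fun a => (4 * (g a * sz (n a) + 1) + 6)%N)); pt; first by pb.
move=> a l1 l2 /iota_prefix [e hs]; rewrite e -/(prodz _ _); apply: sz_int.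
have : (`|prodz (size l1) (F a)| <= 2 ^ (g a * size l1))%N.
  rewrite prodzE; elim: (size l1) hs => [|k IH] hk; first by rewrite big_ord0 muln0.
  rewrite big_ord_recr /= abszM mulnS expnD mulnC leq_mul //; first exact: ltnW (le _ _ hk).
  exact: IH (ltnW hk).
move/leq_ltn_trans; apply; rewrite ltn_exp2l // addn1 ltnS leq_mul2l.
by rewrite sz_nat; lia.
Qed.

Definition pow2 (k : nat) : int := iter k (fun x => x + x) 1.

Lemma pow2E k : pow2 k = (2 ^ k)%N%:Z.
Proof. by rewrite /pow2; elim: k => //= k ->; rewrite expnS; lia. Qed.

Lemma PT_pow2 : PT pow2.
Proof.
apply: (@PT_iter _ _ _ _ id (fun _ (x : int) => x + x) (fun=> 1) (fun k => (4 * (sz k).+1 + 6)%N)); pt; first by pb.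
move=> k i le; rewrite -/(pow2 i) pow2E; apply: sz_int => /=.
by rewrite ltn_exp2l // sz_nat; lia.
Qed.

#[export] Hint Resolve PT_pow2 : polytime.

(** * Rational arithmetic *)

Definition mkrat (n d : int) : rat := n%:~R / d%:~R.

Lemma mkratE n d : mkrat n d = mkrat (quoz n (gcd_int n d)) (quoz d (gcd_int n d)).
Proof.
case: (altP (d =P 0)) => [->|d0].
  have q0 g : quoz 0 g = 0.
    by rewrite /quoz; case: (altP (g =P 0)) => // g0; rewrite divmodE //= div0n; case: ifP.
  by rewrite /mkrat q0 invr0 !mulr0.
rewrite gcd_intE; set g : int := (gcdn _ _)%:Z.
have g0 : g != 0 by rewrite /g eqz_nat -lt0n gcdn_gt0; lia.
have [n' en] : exists n', n = n' * g.
  by exists (n %/ g)%Z; rewrite divzK // dvdzE /g /= dvdn_gcdl.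
have [d' ed] : exists d', d = d' * g.
  by exists (d %/ g)%Z; rewrite divzK // dvdzE /g /= dvdn_gcdr.
rewrite en ed !quozE // /mkrat !rmorphM /= -mulf_div divff ?mulr1 //.
by rewrite intr_eq0.
Qed.

Lemma coprime_quoz n d : d != 0 -> quoz d (gcd_int n d) != 0 /\
  coprime `|quoz n (gcd_int n d)| `|quoz d (gcd_int n d)|.
Proof.
move=> d0; rewrite gcd_intE; set g := gcdn `|n| `|d|.
have g0 : (0 < g)%N by rewrite gcdn_gt0; lia.
have [n' en] : exists n', n = n' * g%:Z.
  by exists (n %/ g)%Z; rewrite divzK // dvdzE /g /= dvdn_gcdl.
have [d' ed] : exists d', d = d' * g%:Z.
  by exists (d %/ g)%Z; rewrite divzK // dvdzE /g /= dvdn_gcdr.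
have -> : quoz n g = n' by rewrite [X in quoz X _]en quozE //; lia.
have -> : quoz d g = d' by rewrite [X in quoz X _]ed quozE //; lia.
split; first by apply: contraNneq d0 => e; rewrite ed e mul0r.
have : g = (gcdn `|n'| `|d'| * g)%N by rewrite muln_gcdl {1}/g [in LHS]en [in LHS]ed !abszM.
by rewrite /coprime -{1}[g]mul1n => /eqP; rewrite eqn_pmul2r // eq_sym.
Qed.

Lemma PT_rat_parts : PT (fun q : rat => (numq q, denq q)).
Proof. exact: PT_cast. Qed.

Lemma PT_numq : PT numq.
Proof. exact: (PT_fst PT_rat_parts). Qed.

Lemma PT_denq : PT denq.
Proof. exact: (PT_snd PT_rat_parts). Qed.

#[export] Hint Resolve PT_numq PT_denq : polytime.

Lemma PT_mkrat : PT (fun p : int * int => mkrat p.1 p.2).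
Proof.
(* Division by 0 yields 0, whose reduced form is 0 over 1. *)
pose f (p : int * int) : int * int := if p.2 == 0 then (0, 1) else
  let n := quoz p.1 (gcd_int p.1 p.2) in let d := quoz p.2 (gcd_int p.1 p.2) in
  (if d < 0 then - n else n, absz_int d).
apply: (@PT_recode _ _ _ _ _ _ f); last by rewrite /f; pt.
move=> [n d]; rewrite /f /=; case: (altP (d =P 0)) => [->|d0].
  by rewrite /mkrat invr0 mulr0.
rewrite mkratE; have [] := coprime_quoz n d0.
set n1 := quoz n _; set d1 := quoz d _ => d1n c.
rewrite [RHS]/encode /enc_rat /mkrat coprimeq_num // coprimeq_den // absz_intE (negPf d1n).
by congr (encode (_, _)); case: sgrP d1n => //; lia.
Qed.

#[export] Hint Resolve PT_mkrat : polytime.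

Lemma PT_mulq : PT (fun p : rat * rat => p.1 * p.2).
Proof.
apply: (PT_ext (f := fun p => mkrat (numq p.1 * numq p.2) (denq p.1 * denq p.2))); last by pt.
by move=> [x y]; rewrite /mkrat !rmorphM /= -mulf_div !divq_num_den.
Qed.

Lemma PT_oppq : PT (fun q : rat => - q).
Proof.
apply: (PT_recode (f := fun q : rat => (- numq q, denq q))); last by pt.
by move=> q; rewrite [RHS]/encode /enc_rat numqN denqN.
Qed.

Lemma PT_addq : PT (fun p : rat * rat => p.1 + p.2).
Proof.
apply: (PT_ext (f := fun p => mkrat (numq p.1 * denq p.2 + numq p.2 * denq p.1) (denq p.1 * denq p.2))); last by pt.
move=> [x y]; rewrite /mkrat /= -[x in RHS]divq_num_den -[y in RHS]divq_num_den.
by rewrite addf_div ?intr_eq0 ?denq_neq0 // !(rmorphM, rmorphD).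
Qed.

Lemma PT_leq_rat : PT (fun p : rat * rat => p.1 <= p.2).
Proof.
apply: (PT_ext (f := fun p => numq p.1 * denq p.2 <= numq p.2 * denq p.1)); last by pt.
by move=> [x y]; rewrite -le_ratE.
Qed.

#[export] Hint Resolve PT_mulq PT_oppq PT_addq PT_leq_rat : polytime.

Lemma PT_ltq : PT (fun p : rat * rat => p.1 < p.2).
Proof.
by apply: (PT_ext (f := fun p : rat * rat => ~~ (p.2 <= p.1))) => [p|]; [rewrite ltNge|pt].
Qed.

Lemma PT_ratz : PT (fun z : int => z%:~R : rat).
Proof.
by apply: (PT_ext (f := fun z => mkrat z 1)) => [z|]; [rewrite /mkrat divr1|pt].
Qed.

#[export] Hint Resolve PT_ltq PT_ratz : polytime.

(** The product of all denominators is a common denominator with polynomially many bits, which turns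
    the sum into one of integers. *)
Definition sumq (n : nat) (F : nat -> rat) : rat :=
  let q := prodz n (fun i => denq (F i)) in
  mkrat (sumz n (fun i => numq (F i) * quoz q (denq (F i)))) q.

Lemma common_denq (n : nat) (F : nat -> rat) i : (i < n)%N ->
  (numq (F i) * quoz (prodz n (fun i => denq (F i))) (denq (F i)))%:~R =
  F i * (prodz n (fun i => denq (F i)))%:~R.
Proof.
move=> lt; rewrite prodzE (bigD1 (Ordinal lt)) //=; move: (\prod_(_ < _ | _) _) => P.
by rewrite [denq _ * P]mulrC quozE ?denq_neq0 // !rmorphM /= numqE; ring.
Qed.

Lemma prodz_denq_gt0 n (F : nat -> rat) : 0 < prodz n (fun i => denq (F i)).
Proof. by rewrite prodzE prodr_gt0 // => i _; rewrite denq_gt0. Qed.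

Lemma sumqE n F : sumq n F = \sum_(i < n) F i.
Proof.
rewrite /sumq /mkrat sumzE rmorph_sum /=.
under eq_bigr => i _ do rewrite common_denq //.
by rewrite -mulr_suml mulfK // intr_eq0 gt_eqF // prodz_denq_gt0.
Qed.

Lemma PT_sumq A (eA : enc A) (F : A -> nat -> rat) (n : A -> nat) :
  PT (fun p : A * nat => F p.1 p.2) -> PT n -> PT (fun a => sumq (n a) (F a)).
Proof.
move=> hF hn; rewrite /sumq.
pose Q a := prodz (n a) (fun i => denq (F a i)).
have hd : PT Q by apply: (PT_prodz (F := fun a i => denq (F a i))) => //; pt.
refine (PT_comp2 PT_mkrat _ hd).
by apply: (PT_sumz (F := fun a i => numq (F a i) * quoz (Q a) (denq (F a i)))) => //; pt.
Qed.

Ltac pt_hook ::=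
  lazymatch goal with
  | |- polytime (fun a => map (@?f a) (@?l a)) => refine (PT_map (f := f) (l := l) _ _); pt
  | |- polytime (fun a => filter (@?f a) (@?l a)) => refine (PT_filter (f := f) (l := l) _ _); pt
  | |- polytime (fun a => mkseq (@?f a) (@?n a)) => refine (PT_mkseq (f := f) (n := n) _ _); pt
  | |- polytime (fun a => sumz (@?n a) (@?F a)) => refine (PT_sumz (F := F) (n := n) _ _); pt
  | |- polytime (fun a => prodz (@?n a) (@?F a)) => refine (PT_prodz (F := F) (n := n) _ _); pt
  | |- polytime (fun a => sumq (@?n a) (@?F a)) => refine (PT_sumq (F := F) (n := n) _ _); pt
  end.

(** * Integral orthogonal projections *)

(** The second factor is the Schur complement of [G]. *)
Lemma det_bordered (F : fieldType) r (G : 'M[F]_r) (g : 'cV_r) (h : 'rV_r) (k : 'M_1) :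
  G \in unitmx ->
  \det (block_mx G g h k) = \det G * (k 0 0 - (h *m invmx G *m g) 0 0).
Proof.
move=> Gu.
have -> : block_mx G g h k =
    block_mx G 0 h (k - h *m invmx G *m g) *m block_mx 1%:M (invmx G *m g) 0 1%:M.
  rewrite mulmx_block !(mulmx0, mul0mx, addr0, add0r, mulmx1) !mulmxA mulmxV // mul1mx.
  by rewrite addrC subrK.
by rewrite det_mulmx det_lblock det_ublock !det1 !mulr1 det_mx11 !mxE.
Qed.

Section Gram.
Variables (R : comNzRingType) (n r : nat) (S : 'M[R]_(r, n)).

Definition gram := S *m S^T.
(** The usual projection onto the kernel, multiplied by the Gram determinant: the adjugate takes the
    place of the inverse, so integral data give an integral matrix. *)
Definition gram_proj : 'M[R]_n := \det gram *: 1%:M - S^T *m \adj gram *m S.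

Lemma gram_sym : gram^T = gram.
Proof. by rewrite /gram trmx_mul trmxK. Qed.

Lemma gram_proj_sym : gram_proj^T = gram_proj.
Proof.
rewrite /gram_proj linearB /= linearZ /= trmx1 !trmx_mul trmxK mulmxA.
by rewrite trmx_adj gram_sym.
Qed.

Lemma mul_gram_proj : S *m gram_proj = 0.
Proof.
rewrite /gram_proj mulmxBr -scalemxAr mulmx1 !mulmxA -/gram mul_mx_adj.
by rewrite -scalemx1 -scalemxAl mul1mx subrr.
Qed.

Lemma gram_proj_ker p (x : 'M_(n, p)) : S *m x = 0 -> gram_proj *m x = \det gram *: x.
Proof. by move=> e; rewrite /gram_proj mulmxBl -[_ *m S *m x]mulmxA e mulmx0 subr0 -scalemxAl mul1mx. Qed.

Lemma gram_proj_idem : gram_proj *m gram_proj = \det gram *: gram_proj.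
Proof. by rewrite gram_proj_ker // mul_gram_proj. Qed.
End Gram.

Lemma map_gram (R1 R2 : comNzRingType) (f : {rmorphism R1 -> R2}) n r (S : 'M[R1]_(r, n)) :
  gram (map_mx f S) = map_mx f (gram S).
Proof. by rewrite /gram map_trmx map_mxM. Qed.

Lemma map_gram_proj (R1 R2 : comNzRingType) (f : {rmorphism R1 -> R2}) n r (S : 'M[R1]_(r, n)) :
  gram_proj (map_mx f S) = map_mx f (gram_proj S).
Proof.
rewrite /gram_proj map_gram det_map_mx [RHS]map_mxB map_mxZ map_scalar_mx rmorph1.
rewrite !map_mxM map_trmx; congr (_ - _ *m _ *m _).
by rewrite map_mx_adj -map_gram /gram map_trmx.
Qed.

(** Each matrix fixes the columns of the other, so [P1 = P2 *m P1 = (P1 *m P2)^T = P2^T = P2]. *)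
Lemma proj_unique (F : fieldType) n r (S : 'M[F]_(r, n)) (P1 P2 : 'M[F]_n) :
  (forall P, P \in [:: P1; P2] -> [/\ P^T = P, S *m P = 0 &
     forall Q : 'M_n, S *m Q = 0 -> P *m Q = Q]) -> P1 = P2.
Proof.
move=> h; have [t1 s1 k1] := h P1 (mem_head _ _).
have [t2 s2 k2] := h P2 (mem_last P1 [:: P2]).
by rewrite -[LHS](k2 _ s1) -[LHS]trmxK trmx_mul t1 t2 k1.
Qed.

Section GramStep.
Variables (F : realFieldType) (n r : nat) (S : 'M[F]_(r, n)) (a : 'rV[F]_n).
Let D := \det (gram S).
Let N := gram_proj S.
Let v := N *m a^T.
Let s := (a *m v) 0 0.

Lemma sum_sqr_eq0 m (w : 'cV[F]_m) : (w^T *m w) 0 0 = 0 -> w = 0.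
Proof.
rewrite mxE => /eqP; rewrite psumr_eq0; last by move=> i _; rewrite mxE -expr2 sqr_ge0.
move=> /allP h; apply/colP => i; rewrite [RHS]mxE.
by have := h i (mem_index_enum i); rewrite /= mxE -expr2 sqrf_eq0 => /eqP.
Qed.

Lemma gram_step_norm : s * D = (v^T *m v) 0 0.
Proof.
rewrite /s /v /N trmx_mul trmxK gram_proj_sym !mulmxA -[_ *m gram_proj S *m gram_proj S]mulmxA.
by rewrite gram_proj_idem -scalemxAr -scalemxAl [RHS]mxE mulrC.
Qed.

(** Since [s * D] is the squared norm of [v], the vector [v] vanishes, while on the kernel of [S]
    its transpose acts as [D] times [a]. *)
Lemma gram_step_eq0 (x : 'cV[F]_n) : D != 0 -> s = 0 -> S *m x = 0 -> a *m x = 0.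
Proof.
move=> D0 s0 e; have v0 : v = 0.
  by apply: sum_sqr_eq0; rewrite -gram_step_norm s0 mul0r.
have : v^T *m x = 0 by rewrite v0 trmx0 mul0mx.
rewrite /v /N trmx_mul trmxK gram_proj_sym -mulmxA gram_proj_ker // -scalemxAr.
by move/eqP; rewrite scalemx_eq0 (negPf D0) => /eqP.
Qed.

Lemma gram_step_det : D != 0 -> \det (gram (col_mx S a)) = s.
Proof.
move=> D0; have Gu : gram S \in unitmx by rewrite unitmxE unitfE.
rewrite /gram tr_col_mx mul_col_row det_bordered // -/(gram S) -/D.
rewrite /s /v /N /gram_proj mulmxBl mulmxBr -scalemxAl mul1mx -scalemxAr.
have E (X Y : 'M[F]_1) : (\det (gram S) *: X - Y) 0 0 = D * X 0 0 - Y 0 0 by rewrite !mxE.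
rewrite E mulrBr; congr (_ - _).
have E' (X : 'M[F]_1) : D * X 0 0 = (D *: X) 0 0 by rewrite mxE.
by rewrite E' /invmx Gu -/D -!scalemxAr -!scalemxAl scalerA divff // scale1r !mulmxA.
Qed.

(** The component along [v] is removed from the projection. For integral data this shows that [D]
    divides the right-hand side, so the update is exact, as in fraction-free elimination. *)
Lemma gram_step_proj : D != 0 -> s != 0 ->
  D *: gram_proj (col_mx S a) = s *: N - v *m v^T.
Proof.
move=> D0 s0; set S' := col_mx S a.
suff : s^-1 *: gram_proj S' = (D * s)^-1 *: (s *: N - v *m v^T).
  move/(congr1 (fun M => (D * s) *: M)); rewrite !scalerA divff ?mulf_neq0 // scale1r => <-.
  by rewrite mulrAC divfK // mulrC.
apply: (@proj_unique _ _ _ S') => P; rewrite !inE => /orP [/eqP ->|/eqP ->]; split.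
- by rewrite linearZ /= gram_proj_sym.
- by rewrite -scalemxAr mul_gram_proj scaler0.
- by move=> Q e; rewrite -scalemxAl gram_proj_ker // gram_step_det // scalerA mulVf // scale1r.
- by rewrite linearZ /= linearB /= linearZ /= gram_proj_sym trmx_mul trmxK.
- have e1 : S *m v = 0 by rewrite /v mulmxA mul_gram_proj mul0mx.
  rewrite -scalemxAr mulmxBr -scalemxAr /S' !mul_col_mx mul_gram_proj [S *m (v *m _)]mulmxA e1 mul0mx [a *m (v *m _)]mulmxA.
  have -> : a *m v = s%:M by rewrite [LHS]mx11_scalar.
  rewrite mul_scalar_mx /v /N trmx_mul trmxK gram_proj_sym scale_col_mx scaler0.
  by rewrite opp_col_mx oppr0 add_col_mx addr0 subrr col_mx0 scaler0.
- move=> Q; rewrite /S' mul_col_mx => /eqP; rewrite col_mx_eq0 => /andP [/eqP eS /eqP ea].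
  have eN : N *m Q = D *: Q by apply: gram_proj_ker.
  rewrite -scalemxAl mulmxBl -scalemxAl eN -mulmxA /v trmx_mul trmxK gram_proj_sym -/N.
  rewrite -[a *m N *m Q]mulmxA eN -scalemxAr ea scaler0 mulmx0 subr0 !scalerA.
  by rewrite -mulrA [s * D]mulrC mulVf ?mulf_neq0 // scale1r.
Qed.
End GramStep.

(* [N] is [D] times the orthogonal projection onto the kernel of [S]. *)
Definition gram_state n (N : 'M[int]_n) (D : int) (ker : 'cV[rat]_n -> Prop) :=
  exists r (S : 'M[int]_(r, n)), [/\ 0 < D, D = \det (gram S), N = gram_proj S &
    forall x, map_mx intr S *m x = 0 <-> ker x].

Lemma gram_state0 n : @gram_state n 1%:M 1 (fun=> True).
Proof.
exists 0%N, 0; split=> //; first by rewrite det_mx00.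
  by rewrite /gram_proj det_mx00 scale1r mulmx0 subr0.
by move=> x; split=> // _; rewrite map_mx0 mul0mx.
Qed.

Lemma gram_state_step n (N : 'M[int]_n) D ker (a : 'rV[int]_n) :
  gram_state N D ker ->
  let v := N *m a^T in let s := (a *m v) 0 0 in
  let ker' x := ker x /\ map_mx intr a *m x = 0 in
  (s = 0 -> gram_state N D ker') /\
  (s <> 0 -> exists N' : 'M_n, [/\ s *: N - v *m v^T = D *: N', 0 < s & gram_state N' s ker']).
Proof.
move=> [r [S [D0 eD eN hk]]] v s ker'.
pose S' := map_mx (intr : int -> rat) S; pose a' := map_mx (intr : int -> rat) a.
have eDq : \det (gram S') = D%:~R by rewrite map_gram det_map_mx -eD.
have eNq : gram_proj S' = map_mx intr N by rewrite map_gram_proj -eN.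
have evq : gram_proj S' *m a'^T = map_mx intr v by rewrite eNq /v map_mxM map_trmx.
have esq : (a' *m (gram_proj S' *m a'^T)) 0 0 = s%:~R.
  by rewrite evq /a' -map_mxM mxE.
have D0q : \det (gram S') != 0 by rewrite eDq intr_eq0 gt_eqF.
split=> [s0|/eqP s0].
  exists r, S; split=> // x; rewrite /ker' -hk; split=> [e|[]//]; split=> //.
  by apply: (gram_step_eq0 (S := S')) => //; rewrite esq s0.
have s0q : (a' *m (gram_proj S' *m a'^T)) 0 0 != 0 by rewrite esq intr_eq0.
have := gram_step_proj D0q s0q; have := gram_step_det a' D0q.
have := gram_step_norm S' a'; rewrite !eDq !esq.
have -> : col_mx S' a' = map_mx intr (col_mx S a) by rewrite map_col_mx.
rewrite map_gram det_map_mx [gram_proj (map_mx _ (col_mx _ _))]map_gram_proj => e1 /intr_inj e2 e3.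
have s_gt0 : 0 < s.
  rewrite -(ltr0z rat) lt_def intr_eq0 s0 -(pmulr_lge0 (x := D%:~R)) ?ltr0z // e1.
  by rewrite mxE sumr_ge0 // => i _; rewrite mxE -expr2 sqr_ge0.
exists (gram_proj (col_mx S a)); split.
- have E : map_mx intr (s *: N - v *m v^T) = map_mx intr (D *: gram_proj (col_mx S a)) :> 'M[rat]_n.
    by rewrite [RHS]map_mxZ e3 map_mxB map_mxZ map_mxM -map_trmx -evq -eNq.
  apply/matrixP => i j; have := congr1 (fun M : 'M[rat]_n => M i j) E.
  by rewrite mxE [in RHS]mxE => /intr_inj.
- exact: s_gt0.
- exists (r + 1)%N, (col_mx S a); split=> //.
  move=> x; rewrite /ker' map_col_mx mul_col_mx -hk; split=> [/eqP|[-> ->]]; last by rewrite col_mx0.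
  by rewrite col_mx_eq0 => /andP [/eqP -> /eqP ->].
Qed.

(** * Small integral kernel vectors *)

Lemma det_le n (H : 'M[int]_n) (B : nat) :
  (forall i j, `|H i j| <= B%:Z) -> `|\det H| <= (n`! * B ^ n)%N%:Z.
Proof.
move=> hB; rewrite /determinant; apply: le_trans (ler_norm_sum _ _ _) _.
apply: (@le_trans _ _ (\sum_(s : 'S_n) (B ^ n)%N%:Z)).
  apply: ler_sum => s _; rewrite normrMsign normr_prod.
  apply: (@le_trans _ _ (\prod_(i < n) B%:Z)).
    by apply: ler_prod => i _; rewrite normr_ge0 hB.
  by rewrite prodr_const card_ord -rmorphXn.
by rewrite sumr_const (card_Sn n) PoszM -mulr_natl natz.
Qed.

(** The entry is a sum of at most [n] cofactors, each a determinant of order one less. *)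
Lemma adj_indicator_le n (H : 'M[int]_n) (B : nat) (h : 'cV[int]_n) i : (0 < B)%N ->
  (forall i j, `|H i j| <= B%:Z) -> (forall r, 0 <= h r 0 <= 1) ->
  `|(\adj H *m h) i 0| <= (n`! * B ^ n)%N%:Z.
Proof.
move=> B0 hB hh; case: n H h hB hh i => [|n] H h hB hh i; first by case: i.
rewrite mxE; apply: le_trans (ler_norm_sum _ _ _) _.
apply: (@le_trans _ _ (\sum_(r < n.+1) (n`! * B ^ n)%N%:Z)).
  apply: ler_sum => r _; rewrite mxE normrM -[leRHS]mulr1.
  apply: ler_pM => //; last by have /andP[h0 h1] := hh r; rewrite ger0_norm.
  by rewrite /cofactor normrMsign; apply: det_le => k l; rewrite !mxE.
rewrite sumr_const card_ord -mulr_natl natz -PoszM lez_nat factS -mulnA leq_mul2l.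
by rewrite leq_mul2l expnS leq_pmull // !orbT.
Qed.

(** Induction on the support of [x]. As long as some kernel direction is supported in it and
    vanishes at [j], moving along it removes a coordinate; once there is none, [x] is determined up
    to a factor and Cramer's rule gives the bound. *)
Lemma circuit m n (A : 'M[int]_(m, n)) (B : nat) (x : 'cV[rat]_n) (j : 'I_n) :
  (0 < B)%N -> (forall i k, `|A i k| <= B%:Z) -> (forall i, 0 <= x i 0) ->
  map_mx intr A *m x = 0 -> 0 < x j 0 ->
  exists u : 'cV[int]_n, [/\ A *m u = 0, forall i, 0 <= u i 0 <= (n`! * B ^ n)%N%:Z,
    0 < u j 0 & forall i, x i 0 = 0 -> u i 0 = 0].
Proof.
move=> B0 hB; have [k] := ubnP #|[set i | x i 0 != 0]|.
elim: k x => // k IH x lek x0 Ax xj.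
(* The rows ask for a kernel vector of [A], for zeros outside the support of [x], and read off the
   coordinate [j]. *)
pose Z : 'M[int]_(m + (n + 1), n) := col_mx A (col_mx
  (\matrix_(i, l) ((x i 0 == 0) && (i == l))%:R) (\row_l (l == j)%:R)).
pose Zq : 'M[rat]_(m + (n + 1), n) := map_mx intr Z.
have ZqE (w : 'cV[rat]_n) : Zq *m w = col_mx (map_mx intr A *m w)
    (col_mx (\col_i ((x i 0 == 0)%:R * w i 0)) (\col_i w j 0)).
  rewrite /Zq /Z !map_col_mx !mul_col_mx; congr (col_mx _ (col_mx _ _)).
    apply/colP => i; rewrite !mxE (bigD1 i) //= big1 ?addr0.
      by rewrite !mxE eqxx andbT; case: eqP.
    by move=> l /negPf ne; rewrite !mxE [i == l]eq_sym ne andbF mul0r.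
  apply/colP => i; rewrite !mxE (bigD1 j) //= big1 ?addr0.
    by rewrite !mxE eqxx mul1r.
  by move=> l /negPf ne; rewrite !mxE ne mul0r.
case: (boolP (row_full Zq)) => [full|nfull]; last first.
  have [w w0 Zw] : exists2 w : 'cV[rat]_n, w != 0 & Zq *m w = 0.
    have : kermx Zq^T != 0.
      rewrite kermx_eq0 /row_free mxrank_tr; move: nfull; rewrite /row_full //.
    case/rowV0Pn => v /sub_kermxP kv v0; exists v^T; first by rewrite trmx_eq0.
    by rewrite -[Zq]trmxK -trmx_mul kv trmx0.
  wlog [i1 wi1] : w w0 Zw / exists i1, 0 < w i1 0.
    move=> wl; have [i wi] : exists i, w i 0 != 0.
      apply/existsP; apply: contraNT w0; rewrite negb_exists => /forallP h.
      by apply/eqP/colP => i; have := h i; rewrite negbK mxE => /eqP.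
    case: (ltrgtP (w i 0) 0) => [lt|gt|e]; last by rewrite e eqxx in wi.
      apply: (wl (- w)); rewrite ?oppr_eq0 ?mulmxN ?Zw ?oppr0 //.
      by exists i; rewrite mxE oppr_gt0.
    by apply: (wl w) => //; exists i.
  move: Zw; rewrite ZqE => /eqP; rewrite !col_mx_eq0 => /and3P [/eqP Aw /eqP Sw /eqP jw].
  have wj : w j 0 = 0 by have := congr1 (fun M : 'cV_1 => M 0 0) jw; rewrite !mxE.
  have ws i : x i 0 = 0 -> w i 0 = 0.
    by move=> e; have := congr1 (fun M : 'cV_n => M i 0) Sw; rewrite !mxE e eqxx mul1r.
  (* Ratio test: the largest multiple of [w] that can be subtracted from [x] without leaving the
     nonnegative vectors. It makes the coordinate [i0] zero. *)
  pose i0 := [arg min_(i < i1 | 0 < w i 0) (x i 0 / w i 0)]%O.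
  have [wi0 mini] : 0 < w i0 0 /\ forall i, 0 < w i 0 -> x i0 0 / w i0 0 <= x i 0 / w i 0.
    by rewrite /i0; case: arg_minP.
  pose th := x i0 0 / w i0 0; have th0 : 0 <= th by rewrite divr_ge0 // ltW.
  pose x' := x - th *: w.
  have x'E i : x' i 0 = x i 0 - th * w i 0 by rewrite !mxE.
  have x's i : x i 0 = 0 -> x' i 0 = 0 by move=> e; rewrite x'E e ws // mulr0 subr0.
  have [||||u [Au ub uj us]] := IH x'.
  - move: lek; rewrite ltnS; apply: leq_trans.
    apply: proper_card; apply/properP; split.
      by apply/subsetP => i; rewrite !inE; apply: contraNN => /eqP /x's ->.
    exists i0; rewrite !inE; last by rewrite negbK x'E /th divfK ?subrr // gt_eqF.
    by apply: contraTneq wi0 => /ws ->; rewrite ltxx.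
  - move=> i; rewrite x'E subr_ge0; case: (ltrP 0 (w i 0)) => h.
      by rewrite -ler_pdivlMr //; apply: mini.
    by apply: le_trans (x0 i); rewrite mulr_ge0_le0.
  - by rewrite mulmxBr Ax -scalemxAr Aw scaler0 subr0.
  - by rewrite x'E wj mulr0 subr0.
  by exists u; split=> // i /x's /us.
(* Full column rank provides an invertible square subsystem [H]; up to the factor [x j 0], its
   right-hand side [h] has entries 0 and 1. *)
pose f := fullrankfun full; pose H : 'M[int]_n := rowsub f Z.
pose h : 'cV[int]_n := rowsub f (col_mx 0 (col_mx 0 (const_mx 1))).
have Hu : map_mx intr H \in (unitmx : pred 'M[rat]_n) by rewrite /H map_mxsub fullrowsub_unit.
have detH : \det H != 0 by move: Hu; rewrite unitmxE unitfE det_map_mx intr_eq0.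
have Hx : map_mx intr H *m x = x j 0 *: map_mx intr h.
  have key : Zq *m x = x j 0 *: map_mx intr (col_mx 0 (col_mx 0 (const_mx 1))).
    rewrite ZqE Ax !map_col_mx !map_mx0 !scale_col_mx !scaler0; congr (col_mx _ (col_mx _ _)).
      by apply/colP => i; rewrite !mxE; case: eqP => [->|]; rewrite ?mulr0 ?mul0r.
    by apply/colP => i; rewrite !mxE mulr1.
  rewrite /H map_mxsub -/Zq mul_rowsub_mx key /h map_mxsub.
  by apply/colP => i; rewrite [LHS]mxE [LHS]mxE [RHS]mxE [in RHS]mxE.
have hB' i l : `|H i l| <= B%:Z.
  rewrite /H mxE; case: (split_ordP (f i)) => r ->; rewrite ?col_mxEu ?col_mxEd; first exact: hB.
  case: (split_ordP r) => r' ->; rewrite ?col_mxEu ?col_mxEd mxE.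
    by case: (_ && _); rewrite ?normr1 ?normr0; lia.
  by case: (_ == _); rewrite ?normr1 ?normr0; lia.
have hh r : 0 <= h r 0 <= 1.
  rewrite /h mxE; case: (split_ordP (f r)) => r1 ->; rewrite ?col_mxEu ?col_mxEd; first by rewrite mxE.
  by case: (split_ordP r1) => r' ->; rewrite ?col_mxEu ?col_mxEd ?mxE.
(* Cramer's rule; the sign makes [u] a nonnegative multiple of [x]. *)
pose u := Num.sg (\det H) *: (\adj H *m h).
have uE : map_mx intr u = (`|\det H|%:~R / x j 0) *: x.
  have : (\det H)%:~R *: x = x j 0 *: map_mx intr (\adj H *m h).
    rewrite map_mxM scalemxAr -Hx mulmxA -map_mxM mul_adj_mx map_scalar_mx.
    by rewrite mul_scalar_mx.
  move/(congr1 (fun M => ((Num.sg (\det H))%:~R / x j 0) *: M)); rewrite !scalerA divfK ?gt_eqF //.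
  rewrite /u map_mxZ => <-; congr (_ *: _).
  by rewrite mulrAC -rmorphM /= normrEsg.
have uiE i : (u i 0)%:~R = `|\det H|%:~R / x j 0 * x i 0 :> rat.
  by have := congr1 (fun M : 'cV[rat]_n => M i 0) uE; rewrite [in LHS]mxE [in RHS]mxE.
exists u; split.
- apply/colP => i; apply: (@intr_inj rat); rewrite mxE.
  have := congr1 (fun M : 'cV[rat]_m => M i 0) (mulmxA (map_mx intr A) x (1%:M)).
  have : map_mx intr (A *m u) = 0 :> 'cV[rat]_m by rewrite map_mxM uE -scalemxAr Ax scaler0.
  by move/colP/(_ i); rewrite !mxE => ->.
- move=> i; apply/andP; split.
    by rewrite -(ler0z rat) uiE mulr_ge0 // divr_ge0 ?ler0z // ltW.
  apply: le_trans (ler_norm _) _; rewrite /u mxE normrM.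
  by rewrite normr_sg detH mul1r; apply: adj_indicator_le.
- by rewrite -(ltr0z rat) uiE divfK ?gt_eqF // ltr0z normr_gt0.
- by move=> i e; apply: (@intr_inj rat); rewrite uiE e mulr0.
Qed.

(** Expand the nonnegative number [z^T *m N *m z] for [z = y - 2n x]. The energy of [y] is at most
    [4 n^3 D] and the squared norm of [x] at most [n], which gives [y . x <= 2 n^2], whereas the
    [k]-th entry of [y] is at least [4 n^2]. *)
Lemma perceptron_cut (F : realFieldType) n (N : 'M[F]_n) (D : F) (x y : 'cV[F]_n) k :
  0 < D -> N^T = N -> N *m N = D *: N -> N *m x = D *: x ->
  (forall i, 0 <= x i 0 <= 1) -> (forall i, 0 <= y i 0) ->
  (y^T *m N *m y) 0 0 <= 4 * n%:R ^+ 3 * D -> 4 * n%:R ^+ 3 <= n%:R * y k 0 ->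
  2 * x k 0 <= 1.
Proof.
move=> D0 Nt NN Nx hx hy Q hk.
have n0 : 0 < n%:R :> F by rewrite ltr0n; case: n k {N x y Nt NN Nx hx hy Q hk} => [[]|].
pose z := y - (2 * n%:R) *: x.
have psd : 0 <= (z^T *m N *m z) 0 0.
  rewrite -(pmulr_rge0 _ D0).
  have -> : D * (z^T *m N *m z) 0 0 = ((N *m z)^T *m (N *m z)) 0 0.
    by rewrite trmx_mul Nt !mulmxA -[_ *m N *m N]mulmxA NN -scalemxAr -scalemxAl [RHS]mxE.
  by rewrite mxE sumr_ge0 // => i _; rewrite mxE -expr2 sqr_ge0.
have zE : (z^T *m N *m z) 0 0 = (y^T *m N *m y) 0 0 - 4 * n%:R * D * (y^T *m x) 0 0
    + 4 * n%:R ^+ 2 * D * (x^T *m x) 0 0.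
  have tx : x^T *m N = D *: x^T by rewrite -[LHS]trmxK trmx_mul trmxK Nt Nx linearZ.
  have sym : (x^T *m y) 0 0 = (y^T *m x) 0 0.
    by rewrite -[x^T *m y]trmxK trmx_mul trmxK [LHS]mxE.
  have zt : z^T = y^T - (2 * n%:R) *: x^T by apply/rowP => i; rewrite !mxE.
  rewrite zt /z !mulmxBl !mulmxBr -!scalemxAl -!scalemxAr tx -[y^T *m N *m x]mulmxA Nx.
  rewrite -!scalemxAl -!scalemxAr.
  have E (a b c d : 'M[F]_1) p q r : (a - p *: b - (q *: c - r *: d)) 0 0 =
    a 0 0 - p * b 0 0 - (q * c 0 0 - r * d 0 0) by rewrite !mxE.
  rewrite !scalerA E sym; ring.
have xx : (x^T *m x) 0 0 <= n%:R.
  rewrite mxE -[n%:R]mulr_natr mul1r -[X in _ <= X%:R]card_ord -sumr_const ler_sum // => i _.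
  by rewrite mxE; have := hx i; nra.
have yx : y k 0 * x k 0 <= (y^T *m x) 0 0.
  rewrite mxE (bigD1 k) //= mxE lerDl sumr_ge0 // => i _; rewrite mxE mulr_ge0 //.
  by have /andP[] := hx i.
have yk : 4 * n%:R ^+ 2 <= y k 0.
  by rewrite -(ler_pM2l n0); apply: le_trans hk; rewrite le_eqVlt; apply/orP; left; apply/eqP; ring.
have main : (y^T *m x) 0 0 <= 2 * n%:R ^+ 2.
  have : 4 * n%:R * D * (y^T *m x) 0 0 <= 4 * n%:R * D * (2 * n%:R ^+ 2).
    have : 4 * n%:R ^+ 2 * D * (x^T *m x) 0 0 <= 4 * n%:R ^+ 2 * D * n%:R.
      by rewrite ler_pM2l // !mulr_gt0 // exprn_gt0.
    by move: psd; rewrite zE; lra.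
  by rewrite ler_pM2l // !mulr_gt0.
have xk := hx k; have n2 : 0 < n%:R ^+ 2 :> F by rewrite exprn_gt0.
have : 4 * n%:R ^+ 2 * x k 0 <= 2 * n%:R ^+ 2.
  apply: le_trans main; apply: le_trans yx; rewrite ler_wpM2r //; by case/andP: xk.
by move=> h; rewrite -(ler_pM2l n2); nra.
Qed.

(** * Nonnegative kernel vectors of maximal support *)

Definition vget (v : seq int) (i : nat) : int := nth 0 v i.
Definition mget (A : seq (seq int)) (i j : nat) : int := vget (nth [::] A i) j.

Lemma PT_vget : PT (fun p : seq int * nat => vget p.1 p.2).
Proof. by rewrite /vget; pt. Qed.

#[export] Hint Resolve PT_vget : polytime.

Lemma PT_mget : PT (fun p : seq (seq int) * nat * nat => mget p.1.1 p.1.2 p.2).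
Proof. by rewrite /mget; pt. Qed.

#[export] Hint Resolve PT_mget : polytime.

Definition mulmv (n : nat) (N : seq (seq int)) (a : seq int) : seq int :=
  mkseq (fun i => sumz n (fun k => mget N i k * vget a k)) n.

Definition dotz (n : nat) (u v : seq int) : int := sumz n (fun i => vget u i * vget v i).

Definition rank1_update (n : nat) (st : seq (seq int) * int) (s : int) (v : seq int) : seq (seq int) :=
  mkseq (fun i => mkseq (fun j => quoz (s * mget st.1 i j - vget v i * vget v j) st.2) n) n.

Definition proj_step (n : nat) (st : seq (seq int) * int) (a : seq int) :=
  if dotz n a (mulmv n st.1 a) == 0 then st
  else (rank1_update n st (dotz n a (mulmv n st.1 a)) (mulmv n st.1 a),
        dotz n a (mulmv n st.1 a)).

Definition proj_init (n : nat) : seq (seq int) * int :=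
  (mkseq (fun i => mkseq (fun j => if i == j then 1 else 0) n) n, 1).

Definition proj (n : nat) (A : seq (seq int)) := foldl (proj_step n) (proj_init n) A.

Lemma PT_mulmv : PT (fun p : nat * seq (seq int) * seq int => mulmv p.1.1 p.1.2 p.2).
Proof. by rewrite /mulmv; pt. Qed.

Lemma PT_dotz : PT (fun p : nat * seq int * seq int => dotz p.1.1 p.1.2 p.2).
Proof. by rewrite /dotz; pt. Qed.

#[export] Hint Resolve PT_mulmv PT_dotz : polytime.

Lemma PT_comp4 A B C D E G (eA : enc A) (eB : enc B) (eC : enc C) (eD : enc D) (eE : enc E) (eG : enc G)
    (h : B -> C -> D -> E -> G) (f1 : A -> B) (f2 : A -> C) (f3 : A -> D) (f4 : A -> E) :
  PT (fun x : B * C * D * E => h x.1.1.1 x.1.1.2 x.1.2 x.2) -> PT f1 -> PT f2 -> PT f3 -> PT f4 ->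
  PT (fun a => h (f1 a) (f2 a) (f3 a) (f4 a)).
Proof.
by move=> hh h1 h2 h3 h4; apply: (PT_comp hh (PT_pair (PT_pair (PT_pair h1 h2) h3) h4)).
Qed.

Lemma PT_rank1_update : PT (fun p : nat * (seq (seq int) * int) * int * seq int =>
  rank1_update p.1.1.1 p.1.1.2 p.1.2 p.2).
Proof. by rewrite /rank1_update; pt. Qed.

Lemma PT_proj_step : PT (fun p : nat * (seq (seq int) * int) * seq int => proj_step p.1.1 p.1.2 p.2).
Proof.
rewrite /proj_step; apply: PT_if; pt.
by apply: (PT_comp4 PT_rank1_update); pt.
Qed.

Definition mxl (m n : nat) (A : seq (seq int)) : 'M[int]_(m, n) := \matrix_(i, j) mget A i j.
Definition rowl (n : nat) (a : seq int) : 'rV[int]_n := \row_j vget a j.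

Lemma vget_mkseq n F i : (i < n)%N -> vget (mkseq F n) i = F i.
Proof. by move=> lt; rewrite /vget nth_mkseq. Qed.

Lemma mget_mkseq m n F i j : (i < m)%N -> (j < n)%N ->
  mget (mkseq (fun i => mkseq (F i) n) m) i j = F i j.
Proof. by move=> li lj; rewrite /mget nth_mkseq // vget_mkseq. Qed.

Lemma vget_mulmv n N a (i : 'I_n) : vget (mulmv n N a) i = (mxl n n N *m (rowl n a)^T) i 0.
Proof.
rewrite vget_mkseq // sumzE mxE; apply: eq_bigr => k _.
by rewrite !mxE.
Qed.

Lemma dotzE n a N : dotz n a (mulmv n N a) = (rowl n a *m (mxl n n N *m (rowl n a)^T)) 0 0.
Proof.
rewrite /dotz sumzE [RHS]mxE; apply: eq_bigr => k _.
by rewrite vget_mulmv; congr (_ * _); rewrite mxE.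
Qed.

Definition in_kernel (n : nat) (A : seq (seq int)) (x : 'cV[rat]_n) : Prop :=
  forall a, a \in A -> map_mx intr (rowl n a) *m x = 0.

Lemma gram_state_iff n (N : 'M[int]_n) D (P Q : 'cV[rat]_n -> Prop) :
  (forall x, P x <-> Q x) -> gram_state N D P -> gram_state N D Q.
Proof.
by move=> PQ [r [S [D0 eD eN h]]]; exists r, S; split=> // x; rewrite h.
Qed.

Lemma rank1E n (N : 'M[int]_n) s (v : 'cV_n) i j :
  (s *: N - v *m v^T) i j = s * N i j - v i 0 * v j 0.
Proof. by rewrite !mxE big_ord1 !mxE. Qed.

Lemma proj_spec n A : gram_state (mxl n n (proj n A).1) (proj n A).2 (in_kernel A).
Proof.
rewrite /proj; elim/last_ind: A => [|A a IH].
  rewrite (_ : mxl _ _ _ = 1%:M); last first.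
    by apply/matrixP => i j; rewrite !mxE /= mget_mkseq // (inj_eq val_inj); case: eqP.
  by apply: gram_state_iff (gram_state0 n) => x; split.
rewrite foldl_rcons; move: (foldl _ _ A) IH => [N D] /= IH.
have [st0 st1] := gram_state_step (rowl n a) IH.
have eqk x : in_kernel A x /\ map_mx intr (rowl n a) *m x = 0 <-> in_kernel (rcons A a) x.
  split=> [[h1 h2] b|h]; first by rewrite mem_rcons inE => /orP [/eqP ->|/h1].
  by split=> [b ib|]; apply: h; rewrite mem_rcons inE ?ib ?orbT ?eqxx.
rewrite /proj_step /= dotzE; case: eqP => [/st0|/st1]; first exact: gram_state_iff.
case=> N' [eN' s0 /(gram_state_iff eqk)] /=; rewrite (_ : mxl _ _ (rank1_update _ _ _ _) = N') //.
apply/matrixP => i j; rewrite mxE mget_mkseq // !vget_mulmv /=.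
have [_ [_ [D0 _ _ _]]] := IH.
have := congr1 (fun M : 'M[int]_n => M i j) eN'.
rewrite rank1E [in RHS]mxE [mxl n n N i j]mxE => ->.
by rewrite mulrC quozE // gt_eqF.
Qed.

(** From [N *m N = D *: N] and symmetry, the squares in row [i] sum to [D * N i i]. Hence
    [N i i <= D], and then every entry of the row is at most [D] in absolute value. *)
Lemma gram_state_le n (N : 'M[int]_n) D P i j : gram_state N D P -> `|N i j| <= D.
Proof.
move=> [r [S [D0 eD eN _]]]; have t : N^T = N by rewrite eN gram_proj_sym.
have NN k : \sum_l N k l ^+ 2 = D * N k k.
  have : (N *m N) k k = (D *: N) k k by rewrite eN gram_proj_idem -eD.
  rewrite !mxE => <-; apply: eq_bigr => l _; rewrite expr2; congr (_ * _).
  by rewrite -[in LHS]t mxE.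
have le k l : N k l ^+ 2 <= D * N k k.
  by rewrite -NN (bigD1 l) //= lerDl sumr_ge0 // => ? _; rewrite sqr_ge0.
have h1 := le i i; have h2 := le i j.
have h3 : N i i <= D by nia.
rewrite -(ler_pXn2r (n := 2)) ?nnegrE ?normr_ge0 ?(ltW D0) //.
by rewrite real_normK ?num_real //; nia.
Qed.

Lemma sz_mkseq X (eX : enc X) (f : nat -> X) n c :
  (forall i, (i < n)%N -> (sz (f i) <= c)%N) -> (sz (mkseq f n) <= n * (c + 1) + 1)%N.
Proof.
rewrite /mkseq => h; have {}h i : i \in iota 0 n -> (sz (f i) <= c)%N.
  by rewrite mem_iota => /andP [_ lt]; apply: h.
rewrite -[n in leqRHS](size_iota 0 n); elim: (iota 0 n) h => [|k s IH] h; first by rewrite sz_nil.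
rewrite /= sz_cons; have := h k (mem_head _ _).
have : (sz [seq f i | i <- s] <= size s * (c + 1) + 1)%N.
  by apply: IH => i si; apply: h; rewrite inE si orbT.
by move=> h1 h2; rewrite mulSn -addnA -addSn leq_add // addn1 ltnS.
Qed.

Lemma eq_in_mkseq T (f g : nat -> T) n :
  (forall i, (i < n)%N -> f i = g i) -> mkseq f n = mkseq g n.
Proof. by move=> h; apply/eq_in_map => i; rewrite mem_iota => /andP [_]; apply: h. Qed.

Lemma vget_lt (v : seq int) k : (`|vget v k| < 2 ^ sz v)%N.
Proof.
case: (ltnP k (size v)) => h; last by rewrite /vget nth_default // expn_gt0.
apply: leq_trans (int_lt_sz _) _; rewrite leq_exp2l // ltnW //.
by apply: (sz_mem (l1 := take k v) (l2 := drop k.+1 v)); rewrite -drop_nth // cat_take_drop.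
Qed.

(** Each row multiplies the denominator by at most [n^2 * 4^S], because the entries of the scaled
    projection never exceed its denominator. *)
Lemma proj_denom_le n (S : nat) A : (forall a, a \in A -> forall k, (`|vget a k| < 2 ^ S)%N) ->
  (proj n A).2 <= (2 ^ (2 * (n + S) * size A))%N%:Z.
Proof.
elim/last_ind: A => [|A a IH] h; first by rewrite muln0.
have {}IH : (proj n A).2 <= (2 ^ (2 * (n + S) * size A))%N%:Z.
  by apply: IH => b ib; apply: h; rewrite mem_rcons inE ib orbT.
have st := proj_spec n A; have D0 : 0 < (proj n A).2 by case: st => ? [? []].
rewrite /proj foldl_rcons -/(proj n A) size_rcons.
have a_le k : `|vget a k| <= (2 ^ S)%N%:Z.
  by have := h a; rewrite mem_rcons mem_head => /(_ isT k); lia.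
rewrite /proj_step; case: eqP => _ /=.
  by apply: le_trans IH _; rewrite lez_nat leq_exp2l // leq_mul2l leqnSn orbT.
set D := (proj n A).2 in st D0 IH *.
have v_le (i : 'I_n) : `|vget (mulmv n (proj n A).1 a) i| <= n%:Z * (D * (2 ^ S)%N%:Z).
  rewrite vget_mkseq // sumzE; apply: le_trans (ler_norm_sum _ _ _) _.
  apply: (@le_trans _ _ (\sum_(k < n) D * (2 ^ S)%N%:Z)); last first.
    by rewrite sumr_const card_ord -mulr_natl natz.
  apply: ler_sum => k _; rewrite normrM ler_pM //.
  by have := gram_state_le i k st; rewrite mxE.
have : dotz n a (mulmv n (proj n A).1 a) <= n%:Z * ((2 ^ S)%N%:Z * (n%:Z * (D * (2 ^ S)%N%:Z))).
  rewrite /dotz sumzE; apply: le_trans (ler_norm _) _; apply: le_trans (ler_norm_sum _ _ _) _.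
  apply: (@le_trans _ _ (\sum_(k < n) (2 ^ S)%N%:Z * (n%:Z * (D * (2 ^ S)%N%:Z)))); last first.
    by rewrite sumr_const card_ord -mulr_natl natz.
  by apply: ler_sum => k _; rewrite normrM ler_pM.
move/le_trans; apply; rewrite mulnS expnD PoszM.
have n_le : n%:Z <= (2 ^ n)%N%:Z by rewrite lez_nat ltnW // ltn_expl.
apply: (@le_trans _ _ ((2 ^ n)%N%:Z * ((2 ^ S)%N%:Z * ((2 ^ n)%N%:Z * (D * (2 ^ S)%N%:Z))))).
  by rewrite !ler_pM ?mulr_ge0 // ltW.
have -> : (2 ^ (2 * (n + S)))%N%:Z = (2 ^ n)%N%:Z * (2 ^ S)%N%:Z * (2 ^ n)%N%:Z * (2 ^ S)%N%:Z.
  by rewrite -!PoszM -!expnD; congr (Posz (2 ^ _)); lia.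
have g : 0 <= (2 ^ n)%N%:Z * (2 ^ S)%N%:Z * (2 ^ n)%N%:Z * (2 ^ S)%N%:Z by rewrite !mulr_ge0.
by have := ler_wpM2l g IH; rewrite -!mulrA [D * _]mulrC.
Qed.

Definition proj_bits (p : nat * seq (seq int)) := (2 * (sz p.1 + sz p.2) * sz p.2 + 1)%N.

Lemma PT_proj : PT (fun p : nat * seq (seq int) => proj p.1 p.2).
Proof.
apply: (@PT_foldl _ _ _ _ _ _ (fun p => proj_step p.1) (fun p => proj_init p.1) snd
  (fun p => (sz p.1 * (sz p.1 * (4 * proj_bits p + 7) + 2) + (4 * proj_bits p + 6) + 2)%N)).
- by pt.
- by rewrite /proj_init; pt.
- by apply: (PT_comp3 PT_proj_step); pt.
- by rewrite /proj_bits; pb; pt.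
move=> [n A] l1 l2 /= e; rewrite -/(proj n l1).
have hS a k : a \in l1 -> (`|vget a k| < 2 ^ sz A)%N.
  move=> al1; apply: leq_trans (vget_lt _ _) _; rewrite leq_exp2l // ltnW //.
  case/splitPr: al1 e => u w e; apply: (sz_mem (l1 := u) (l2 := w ++ l2)).
  by rewrite e -catA.
have Dle := proj_denom_le n (fun a al1 k => hS a k al1).
have st := proj_spec n l1.
have DK : (2 ^ (2 * (n + sz A) * size l1) < 2 ^ proj_bits (n, A))%N.
  rewrite ltn_exp2l // /proj_bits /= addn1 ltnS leq_mul //; first by rewrite sz_nat; lia.
  pose proof (sz_size A) as szh; move: szh; rewrite e size_cat; lia.
have shape : (proj n l1).1 = mkseq (fun i => mkseq (mget (proj n l1).1 i) n) n.
  rewrite /proj; elim/last_ind: (l1) => [|l a IH].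
    rewrite /=; apply: eq_in_mkseq => i li; apply: eq_in_mkseq => j lj.
    by rewrite mget_mkseq.
  rewrite foldl_rcons /proj_step; case: ifP => _ //=.
  rewrite {1}/rank1_update; apply: eq_in_mkseq => i li; apply: eq_in_mkseq => j lj.
  by rewrite mget_mkseq.
have le_entry i j : (i < n)%N -> (j < n)%N -> (`|mget (proj n l1).1 i j| < 2 ^ proj_bits (n, A))%N.
  move=> li lj; have := gram_state_le (Ordinal li) (Ordinal lj) st; rewrite mxE /= => h.
  by apply: leq_ltn_trans DK; rewrite -lez_nat abszE; apply: le_trans h Dle.
rewrite [proj n l1]surjective_pairing sz_pair shape.
have h1 : (sz (mkseq (fun i => mkseq (mget (proj n l1).1 i) n) n) <=
    n * (n * (4 * proj_bits (n, A) + 6 + 1) + 1 + 1) + 1)%N.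
  apply: sz_mkseq => i li; apply: sz_mkseq => j lj; exact: sz_int (le_entry i j li lj).
have h2 : (sz (proj n l1).2 <= 4 * proj_bits (n, A) + 6)%N.
  have D0 : 0 < (proj n l1).2 by case: st => ? [? []].
  by apply: sz_int; apply: leq_ltn_trans DK; rewrite -lez_nat gez0_abs // ltW.
have h3 : (n <= sz n)%N by rewrite sz_nat; lia.
apply: (@leq_trans ((n * (n * (4 * proj_bits (n, A) + 7) + 2) + 1 + (4 * proj_bits (n, A) + 6)).+1)).
  by rewrite ltnS leq_add //; apply: leq_trans h1 _; rewrite -!addnA.
have h4 : (n * (n * (4 * proj_bits (n, A) + 7) + 2) <=
    sz n * (sz n * (4 * proj_bits (n, A) + 7) + 2))%N.
  by rewrite leq_mul // leq_add2r leq_mul.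
by move: h4; move: (n * _)%N (sz n * _)%N => u w; lia.
Qed.

#[export] Hint Resolve PT_proj : polytime.

Lemma PT_Posz : PT (fun k : nat => k%:Z).
Proof.
apply: (PT_ext (f := fun k : nat => iter k (fun z : int => z + 1) 0)).
  by move=> k; elim: k => //= k ->; lia.
apply: (@PT_iter _ _ _ _ id (fun _ (z : int) => z + 1) (fun=> 0) (fun k => 4 * sz k + 6)%N); pt; first by pb.
move=> k i le; apply: sz_int.
have -> : iter i (fun z : int => z + 1) 0 = i%:Z by elim: i {le} => //= i ->; lia.
by apply: leq_trans (ltn_expl _ (isT : (1 < 2)%N)) _; rewrite leq_exp2l // sz_nat; lia.
Qed.

#[export] Hint Resolve PT_Posz : polytime.

(** * The perceptron and its rescaling *)

Definition nget (y : seq nat) (i : nat) : nat := nth 0%N y i.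

Lemma PT_nget : PT (fun p : seq nat * nat => nget p.1 p.2).
Proof. by rewrite /nget; pt. Qed.

#[export] Hint Resolve PT_nget : polytime.

Definition nonpositive (n : nat) (N : seq (seq int)) (y : seq nat) : seq nat :=
  filter (fun i => vget (mulmv n N (map Posz y)) i <= 0) (iota 0 n).

Definition perceptron_step (n : nat) (N : seq (seq int)) (y : seq nat) : seq nat :=
  if nonpositive n N y is k :: _ then mkseq (fun i => if i == k then (nget y i).+1 else nget y i) n else y.

(** After this many unit increments some coordinate has weight at least [4 n^2], as the cut
    demands. *)
Definition horizon (n : nat) : nat := 4 * (n * (n * n)).

Definition perceptron (n : nat) (N : seq (seq int)) : seq nat :=
  iter (horizon n) (perceptron_step n N) (mkseq (fun=> 0%N) n).

Lemma PT_nonpositive : PT (fun p : nat * seq (seq int) * seq nat => nonpositive p.1.1 p.1.2 p.2).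
Proof.
rewrite /nonpositive; refine (PT_filter (f := fun p i => vget (mulmv p.1.1 p.1.2 (map Posz p.2)) i <= 0) _ _); pt.
Qed.

#[export] Hint Resolve PT_nonpositive : polytime.

Lemma PT_perceptron_step : PT (fun p : nat * seq (seq int) * seq nat => perceptron_step p.1.1 p.1.2 p.2).
Proof.
rewrite /perceptron_step.
apply: (PT_seq_case (l := fun p : nat * seq (seq int) * seq nat => nonpositive p.1.1 p.1.2 p.2)
  (g := fun p k _ => mkseq (fun i => if i == k then (nget p.2 i).+1 else nget p.2 i) p.1.1)); pt.
Qed.

Lemma PT_horizon : PT horizon.
Proof. by rewrite /horizon; pt. Qed.

#[export] Hint Resolve PT_perceptron_step PT_horizon : polytime.

Lemma iter_perceptron_le n N i : exists f : nat -> nat,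
  iter i (perceptron_step n N) (mkseq (fun=> 0%N) n) = mkseq f n /\ forall k, (f k <= i)%N.
Proof.
elim: i => [|i [f [/= -> fle]]]; first by exists (fun=> 0%N).
rewrite /perceptron_step; case: nonpositive => [|k _]; first by exists f; split=> // k; rewrite leqW.
exists (fun i => if i == k then (nget (mkseq f n) i).+1 else nget (mkseq f n) i); split=> // j.
have : (nget (mkseq f n) j <= i)%N.
  rewrite /nget; case: (ltnP j n) => h; last by rewrite nth_default ?size_mkseq.
  by rewrite nth_mkseq //; apply: fle.
by case: ifP => _ h; rewrite ?ltnS ?leqW.
Qed.

Lemma PT_perceptron : PT (fun p : nat * seq (seq int) => perceptron p.1 p.2).
Proof.
apply: (@PT_iter _ _ _ _ (fun p => horizon p.1) (fun p => perceptron_step p.1 p.2) (fun p => mkseq (fun=> 0%N) p.1)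
  (fun p => sz p.1 * (sz (horizon p.1) + 1) + 1)%N); pt; first by pb; pt.
move=> [n N] i /= le; have [f [-> fle]] := iter_perceptron_le n N i.
apply: leq_trans (sz_mkseq (c := sz (horizon n)) _) _.
  by move=> k _; have := fle k; rewrite !sz_nat; lia.
have h : (n <= sz n)%N by rewrite sz_nat; lia.
by rewrite leq_add2r leq_mul.
Qed.

#[export] Hint Resolve PT_perceptron : polytime.

(** The exponent 0 marks a coordinate already known to vanish; exponents are otherwise shifted by
    one. *)
Definition scaling (k : nat) : int := if k is k'.+1 then pow2 k' else 0.

Lemma PT_scaling : PT scaling.
Proof. by apply: (PT_nat_case (n := id) (g := fun _ k => pow2 k)); pt. Qed.

#[export] Hint Resolve PT_scaling : polytime.

Definition scale_rows (n : nat) (A : seq (seq int)) (e : seq nat) : seq (seq int) :=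
  map (fun a => mkseq (fun j => vget a j * scaling (nget e j)) n) A.

Definition scaled_proj n A e := (proj n (scale_rows n A e)).1.

Definition finished n A e : bool :=
  nonpositive n (scaled_proj n A e) (perceptron n (scaled_proj n A e)) == [::].

Definition heavy n (y : seq nat) : nat :=
  head 0%N (filter (fun i => horizon n <= n * nget y i)%N (iota 0 n)).

(* The weight of an unfinished perceptron concentrates on a coordinate that is at
   most 1/2 in the current box, whose scale is therefore halved. *)
Definition rescale n A e : seq nat :=
  if finished n A e then e
  else mkseq (fun i => if i == heavy n (perceptron n (scaled_proj n A e))
    then (nget e i).-1 else nget e i) n.

(** All scales start at [2 ^ L]. An unfinished round lowers one of the [n] exponents, which sum to
    [n * L.+1] at the start. *)
Definition rescalings n A L : seq nat := iter (n * L.+1) (rescale n A) (mkseq (fun=> L.+1) n).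

Definition solve (n : nat) (A : seq (seq int)) (L : nat) : seq int :=
  let e := rescalings n A L in
  let N := scaled_proj n A e in
  let w := mulmv n N (map Posz (perceptron n N)) in
  mkseq (fun j => scaling (nget e j) * vget w j) n.

Lemma PT_scale_rows : PT (fun p : nat * seq (seq int) * seq nat => scale_rows p.1.1 p.1.2 p.2).
Proof. by rewrite /scale_rows; pt. Qed.

#[export] Hint Resolve PT_scale_rows : polytime.

Lemma PT_scaled_proj : PT (fun p : nat * seq (seq int) * seq nat => scaled_proj p.1.1 p.1.2 p.2).
Proof. by rewrite /scaled_proj; pt. Qed.

#[export] Hint Resolve PT_scaled_proj : polytime.

Lemma PT_finished : PT (fun p : nat * seq (seq int) * seq nat => finished p.1.1 p.1.2 p.2).
Proof.
apply: (PT_ext (f := fun p : nat * seq (seq int) * seq nat =>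
  size (nonpositive p.1.1 (scaled_proj p.1.1 p.1.2 p.2)
    (perceptron p.1.1 (scaled_proj p.1.1 p.1.2 p.2))) == 0%N)); last by pt.
by move=> p; rewrite /finished size_eq0.
Qed.

Lemma PT_heavy : PT (fun p : nat * seq nat => heavy p.1 p.2).
Proof. by rewrite /heavy; pt. Qed.

#[export] Hint Resolve PT_finished PT_heavy : polytime.

Lemma PT_rescale : PT (fun p : nat * seq (seq int) * seq nat => rescale p.1.1 p.1.2 p.2).
Proof. by rewrite /rescale; pt. Qed.

#[export] Hint Resolve PT_rescale : polytime.

Lemma iter_rescale_le n A L i : exists f : nat -> nat,
  iter i (rescale n A) (mkseq (fun=> L.+1) n) = mkseq f n /\ forall k, (f k <= L.+1)%N.
Proof.
elim: i => [|i [f [/= -> fle]]]; first by exists (fun=> L.+1).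
rewrite /rescale; case: ifP => _; first by exists f.
eexists; split; first by reflexivity.
have le k : (nget (mkseq f n) k <= L.+1)%N.
  rewrite /nget; case: (ltnP k n) => h; last by rewrite nth_default ?size_mkseq.
  by rewrite nth_mkseq //; apply: fle.
by move=> k /=; have := le k; case: ifP => _; lia.
Qed.

Lemma PT_rescalings : PT (fun p : nat * seq (seq int) * nat => rescalings p.1.1 p.1.2 p.2).
Proof.
apply: (@PT_iter _ _ _ _ (fun p => p.1.1 * p.2.+1)%N (fun p => rescale p.1.1 p.1.2)
  (fun p => mkseq (fun=> p.2.+1) p.1.1) (fun p => sz p.1.1 * (sz p.2.+1 + 1) + 1)%N); pt; first by pb; pt.
move=> [[n A] L] i /= le; have [f [-> fle]] := iter_rescale_le n A L i.
apply: leq_trans (sz_mkseq (c := sz L.+1) _) _.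
  by move=> k _; have := fle k; rewrite !sz_nat; lia.
have h : (n <= sz n)%N by rewrite sz_nat; lia.
by rewrite leq_add2r leq_mul.
Qed.

#[export] Hint Resolve PT_rescalings : polytime.

Lemma PT_solve : PT (fun p : nat * seq (seq int) * nat => solve p.1.1 p.1.2 p.2).
Proof. by rewrite /solve; pt. Qed.

#[export] Hint Resolve PT_solve : polytime.

(** * Correctness of the rescaled perceptron *)

Section GramRat.
Variables (n : nat) (N : 'M[int]_n) (D : int) (ker : 'cV[rat]_n -> Prop).
Hypothesis st : gram_state N D ker.
Let Nq : 'M[rat]_n := map_mx intr N.

Lemma gram_state_gt0 : 0 < D. Proof. by case: st => ? [? []]. Qed.

Lemma gram_state_sym : Nq^T = Nq.
Proof. by case: st => ? [? [_ _ eN _]]; rewrite /Nq eN map_trmx gram_proj_sym. Qed.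

Lemma gram_state_idem : Nq *m Nq = D%:~R *: Nq.
Proof.
by case: st => ? [? [_ eD eN _]]; rewrite /Nq eN -map_mxM gram_proj_idem map_mxZ eD.
Qed.

Lemma gram_state_fix x : ker x -> Nq *m x = D%:~R *: x.
Proof.
case: st => r [S [_ eD eN h]] /h kx.
by rewrite /Nq eN -map_gram_proj gram_proj_ker // map_gram det_map_mx -eD.
Qed.

Lemma gram_state_range x : ker (Nq *m x).
Proof.
case: st => r [S [_ eD eN h]]; apply/h.
by rewrite /Nq eN -map_gram_proj mulmxA mul_gram_proj mul0mx.
Qed.
End GramRat.

Definition colz (n : nat) (y : seq nat) : 'cV[int]_n := \col_i (nget y i)%:Z.

Lemma rowl_Posz n y : (rowl n (map Posz y))^T = colz n y.
Proof.
apply/colP => i; rewrite !mxE /vget /nget.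
case: (ltnP i (size y)) => h; first by rewrite (nth_map 0%N).
by rewrite !nth_default ?size_map.
Qed.

Lemma vget_mulmv_Posz n N y (i : 'I_n) :
  vget (mulmv n N (map Posz y)) i = (mxl n n N *m colz n y) i 0.
Proof. by rewrite vget_mulmv rowl_Posz. Qed.

Lemma mem_nonpositive n N y k :
  (k \in nonpositive n N y) = (k < n)%N && (vget (mulmv n N (map Posz y)) k <= 0).
Proof. by rewrite mem_filter mem_iota add0n andbC. Qed.

Lemma nonpositive_nil n N y : nonpositive n N y = [::] ->
  forall i : 'I_n, 0 < (mxl n n N *m colz n y) i 0.
Proof.
move=> e i; rewrite -vget_mulmv_Posz ltNge; apply/negP => h.
have : (i : nat) \in nonpositive n N y by rewrite mem_nonpositive ltn_ord.
by rewrite e.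
Qed.

Definition energy n N y : int := ((colz n y)^T *m mxl n n N *m colz n y) 0 0.

(** Adding a unit vector at a coordinate where [N y] is nonpositive raises the energy by twice that
    coordinate of [N y] plus a diagonal entry of [N], hence by at most [D]. *)
Lemma perceptron_iter_spec n N D ker i : gram_state (mxl n n N) D ker ->
  let y := iter i (perceptron_step n N) (mkseq (fun=> 0%N) n) in
  nonpositive n N y = [::] \/ (\sum_(k < n) nget y k = i)%N /\ energy n N y <= i%:Z * D.
Proof.
move=> st; elim: i => [|i IH] /=.
  right; have e : colz n (mkseq (fun=> 0%N) n) = 0.
    by apply/colP => k; rewrite !mxE /nget nth_mkseq.
  split; first by rewrite big1 // => k _; rewrite /nget nth_mkseq.
  by rewrite /energy e mulmx0 mxE mul0r.
set y := iter i _ _ in IH *.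
rewrite /perceptron_step; case E: (nonpositive n N y) => [|k r]; first by left.
have : k \in nonpositive n N y by rewrite E mem_head.
rewrite mem_nonpositive => /andP [kn wk].
case: IH => [e|[sumy en]]; first by rewrite e in E.
pose y' := mkseq (fun i => if i == k then (nget y i).+1 else nget y i) n.
have y'E (j : 'I_n) : nget y' j = (nget y j + (j == Ordinal kn))%N.
  by rewrite /nget nth_mkseq // -val_eqE /=; case: eqP => _; rewrite ?addn1 ?addn0.
right; rewrite -/y'; split.
  under eq_bigr => j _ do rewrite y'E.
  by rewrite big_split /= sumy (bigD1 (Ordinal kn)) //= eqxx big1 ?addn1 // => j /negPf ->.
pose d : 'cV[int]_n := delta_mx (Ordinal kn) 0.
have ye : colz n y' = colz n y + d.
  by apply/colP => j; rewrite !mxE y'E PoszD andbT; case: eqP.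
pose M := mxl n n N.
have dM (w : 'cV[int]_n) : (d^T *m w) 0 0 = w (Ordinal kn) 0.
  by rewrite /d trmx_delta -rowE mxE.
have MT : M^T = M by case: (st) => ? [? [_ _ eN _]]; rewrite /M eN gram_proj_sym.
have cross : ((colz n y)^T *m M *m d) 0 0 = (M *m colz n y) (Ordinal kn) 0.
  have -> : (colz n y)^T *m M *m d = (d^T *m (M *m colz n y))^T by rewrite !trmx_mul trmxK MT.
  by rewrite mxE dM.
have enE : energy n N y' = energy n N y + (M *m colz n y) (Ordinal kn) 0 +
    ((M *m colz n y) (Ordinal kn) 0 + (M *m d) (Ordinal kn) 0).
  have tD : (colz n y + d)^T = (colz n y)^T + d^T by apply/matrixP => i' j'; rewrite !mxE.
  rewrite /energy ye tD !mulmxDl !mulmxDr -/M.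
  have E4 (a b c e : 'M[int]_1) : (a + b + (c + e)) 0 0 = a 0 0 + b 0 0 + (c 0 0 + e 0 0) by rewrite !mxE.
  by rewrite E4 cross -!(mulmxA d^T) !dM.
have Mkk : (M *m d) (Ordinal kn) 0 <= D.
  by rewrite -colE mxE; apply: le_trans (ler_norm _) (gram_state_le _ _ st).
have := wk; rewrite (vget_mulmv_Posz N y (Ordinal kn)) -/M => wk'.
have iD : i.+1%:Z * D = i%:Z * D + D by rewrite -addn1 PoszD mulrDl mul1r.
by rewrite enE iD; lia.
Qed.

Lemma heavyP n y : (0 < n)%N -> (\sum_(k < n) nget y k = horizon n)%N ->
  (heavy n y < n)%N /\ (horizon n <= n * nget y (heavy n y))%N.
Proof.
move=> n0 sumy; rewrite /heavy; set s := filter _ _.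
have sP k : k \in s -> (k < n)%N /\ (horizon n <= n * nget y k)%N.
  by rewrite mem_filter mem_iota => /andP [-> /andP [_]].
case E: s sP => [|k r] sP; last by apply: sP; apply: mem_head.
have lt (k : 'I_n) : (n * nget y k <= (horizon n).-1)%N.
  rewrite -ltnS prednK; last by rewrite /horizon !muln_gt0 n0.
  rewrite ltnNge; apply/negP => h.
  have : (k : nat) \in s by rewrite mem_filter h mem_iota add0n ltn_ord.
  by rewrite E.
have : (\sum_(k < n) n * nget y k <= n * (horizon n).-1)%N.
  apply: (@leq_trans (\sum_(k < n) (horizon n).-1)%N); first by apply: leq_sum => k _; apply: lt.
  by rewrite sum_nat_const card_ord.
rewrite -big_distrr /= sumy leq_mul2l; case: (horizon n) (isT : 0 < 1)%N (erefl (horizon n)) => [|T] _ e.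
  by move: e; rewrite /horizon; nia.
by rewrite ltnn orbF => /eqP n00; rewrite n00 in n0.
Qed.

Definition apply_scaling n (e : seq nat) (x : 'cV[rat]_n) : 'cV[rat]_n :=
  \col_i ((scaling (nget e i))%:~R * x i 0).

Lemma in_kernel_scale n A e (x : 'cV[rat]_n) :
  in_kernel (scale_rows n A e) x <-> in_kernel A (apply_scaling e x).
Proof.
have E a : map_mx intr (rowl n (mkseq (fun j => vget a j * scaling (nget e j)) n)) *m x =
    map_mx intr (rowl n a) *m apply_scaling e x.
  apply/colP => i; rewrite !mxE; apply: eq_bigr => j _.
  by rewrite !mxE vget_mkseq // rmorphM /= mulrA.
split=> h a ia; first by rewrite -E; apply: h; apply: map_f.
by case/mapP: ia => b ib ->; rewrite E; apply: h.
Qed.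

Lemma scaling_ge0 k : 0 <= scaling k.
Proof. by case: k => //= k; rewrite pow2E. Qed.

Lemma scaling_gt0 k : (0 < scaling k) = (0 < k)%N.
Proof. by case: k => //= k; rewrite pow2E ltz_nat expn_gt0. Qed.

Section Rescaling.
Variables (n : nat) (A : seq (seq int)) (L B : nat).
Hypotheses (n0 : (0 < n)%N) (B0 : (0 < B)%N).
Hypothesis hB : forall a, a \in A -> forall k, `|vget a k| <= B%:Z.
Hypothesis hL : (n`! * B ^ n <= 2 ^ L)%N.

Definition in_box (x : 'cV[rat]_n) := forall i, 0 <= x i 0 <= 1.

(** The invariant of the rescaling: the current box, measured in units of [2 ^ -L], still contains
    all kernel vectors of the unit box. *)
Definition bounded_by (e : seq nat) := forall x : 'cV[rat]_n, in_kernel A x -> in_box x ->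
  forall i : 'I_n, (2 ^ L)%N%:R * x i 0 <= (scaling (nget e i))%:~R.

Lemma unfinished_cut e (k := heavy n (perceptron n (scaled_proj n A e))) :
  ~~ finished n A e -> (k < n)%N /\
  forall (i : 'I_n) (x : 'cV[rat]_n), i = k :> nat ->
    in_kernel (scale_rows n A e) x -> in_box x -> 2 * x i 0 <= 1.
Proof.
move=> nf; pose N := mxl n n (scaled_proj n A e).
have st := proj_spec n (scale_rows n A e); rewrite -/(scaled_proj n A e) -/N in st.
set D := (proj n (scale_rows n A e)).2 in st.
case: (perceptron_iter_spec (horizon n) st) => [fin|].
  by move: nf; rewrite /finished /perceptron fin eqxx.
rewrite -/(perceptron n _); set y := perceptron n _ => -[sumy en].
have [kn hk] := heavyP n0 sumy; split=> // i x ei kx bx.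
have T4 : (horizon n)%:R = 4 * n%:R ^+ 3 :> rat by rewrite /horizon !natrM; ring.
apply: (@perceptron_cut _ n (map_mx intr N) D%:~R x (map_mx intr (colz n y)) i) => //.
- by rewrite ltr0z (gram_state_gt0 st).
- exact: gram_state_sym st.
- exact: gram_state_idem st.
- exact: gram_state_fix st _ kx.
- by move=> j; rewrite !mxE.
- rewrite -T4 map_trmx -!map_mxM mxE -[(horizon n)%:R]/((horizon n)%:Z%:~R) -intrM ler_int.
  exact: en.
- rewrite -T4 !mxE -natrM ler_nat ei; exact: hk.
Qed.

(** With exponent 0 the column of [k] would be zero in the scaled system, and the unit vector at [k]
    would be a kernel vector that violates the cut. *)
Lemma unfinished_pos e (k := heavy n (perceptron n (scaled_proj n A e))) :
  ~~ finished n A e -> (0 < nget e k)%N.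
Proof.
move=> nf; have [kn cut] := unfinished_cut nf; rewrite lt0n; apply/eqP => ek.
have := cut (Ordinal kn) (delta_mx (Ordinal kn) 0) (erefl _).
rewrite !mxE !eqxx /= mulr1 => h; suff : 2 <= 1 :> rat by [].
apply: h => [|i]; last by rewrite mxE; case: eqP => _; rewrite ?andbT ?andbF /=.
apply/in_kernel_scale => a _; rewrite (_ : apply_scaling _ _ = 0) ?mulmx0 //.
apply/colP => i; rewrite !mxE andbT; case: eqP => [->|]; rewrite ?mulr0 //=.
by rewrite -/k ek mul0r.
Qed.

(** Above exponent 1 the cut halves the bound. Passing from 1 to 0 claims that the coordinate
    vanishes: otherwise a small integral kernel vector, positive at [i] and divided by [2 ^ L], lies
    in the box and has [i]-th coordinate at least [2 ^ -L], against the cut. *)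
Lemma bounded_rescale e : bounded_by e -> bounded_by (rescale n A e).
Proof.
move=> be x kx bx i; rewrite /rescale; case: ifPn => [_|nf]; first exact: be.
have [kn cut] := unfinished_cut nf; set k := heavy n _ in kn cut *.
rewrite {1}/nget nth_mkseq //; case: eqP => ik; last exact: be.
have p0 : 0 < (2 ^ L)%N%:R :> rat by rewrite ltr0n expn_gt0.
have half z : in_kernel A z -> in_box z ->
    2 * ((2 ^ L)%N%:R * z i 0) <= (scaling (nget e i))%:~R.
  move=> kz bz.
  (* [z] in the coordinates of the current box. Where the scale is 0 the quotient is 0, which is
     correct because the invariant forces [z j 0 = 0] there. *)
  pose z' : 'cV[rat]_n := \col_j ((2 ^ L)%N%:R * z j 0 / (scaling (nget e j))%:~R).
  have sc (j : 'I_n) : (scaling (nget e j))%:~R * z' j 0 = (2 ^ L)%N%:R * z j 0.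
    rewrite mxE mulrC; case: (posnP (nget e j)) => [ej|ej].
      rewrite ej /= mulr0; have := be z kz bz j; have /andP [zj _] := bz j.
      have := mulr_ge0 (ltW p0) zj; rewrite ej /=; lra.
    by rewrite divfK // intr_eq0 gt_eqF // scaling_gt0.
  have : 2 * z' i 0 <= 1.
    apply: (cut i) => //.
      apply/in_kernel_scale => a ia.
      have -> : apply_scaling e z' = (2 ^ L)%N%:R *: z by apply/colP => j; rewrite mxE sc mxE.
      by rewrite -scalemxAr kz // scaler0.
    move=> j; rewrite mxE; have /andP [zj _] := bz j.
    rewrite divr_ge0 ?ler0z ?scaling_ge0 ?mulr_ge0 //=.
    case: (posnP (nget e j)) => [->|ej]; first by rewrite /= invr0 mulr0.
    by rewrite ler_pdivrMr ?mul1r ?ltr0z ?scaling_gt0 //; apply: be.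
  have s0 : 0 <= (scaling (nget e i))%:~R :> rat by rewrite ler0z scaling_ge0.
  by move=> h; rewrite -sc; have := ler_wpM2l s0 h; lra.
have ei : (0 < nget e i)%N by rewrite ik; apply: unfinished_pos.
case E: (nget e i) ei half => [//|[|m]] _ half; last first.
  have := half x kx bx; rewrite -[scaling m.+2]/(pow2 m.+1) -[scaling _.-1]/(pow2 m).
  by rewrite !pow2E expnS PoszM rmorphM /=; lra.
have [_ hle] := andP (bx i); have x0 := bx i.
have := half x kx bx; rewrite /= => hx.
suff -> : x i 0 = 0 by rewrite mulr0.
apply/eqP; apply: contraTT isT => xi.
have {}xi : 0 < x i 0 by rewrite lt_def xi; case/andP: x0.
pose M : 'M[int]_(size A, n) := mxl (size A) n A.
have rowM (r : 'I_(size A)) (z : 'cV[rat]_n) : (map_mx intr M *m z) r 0 =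
    (map_mx intr (rowl n (nth [::] A r)) *m z) 0 0.
  by rewrite !mxE; apply: eq_bigr => l _; rewrite !mxE.
have [||||u [Mu ub ui _]] := @circuit _ _ M B x i B0.
- by move=> r l; rewrite mxE; apply: hB; apply: mem_nth.
- by move=> l; have /andP [] := bx l.
- by apply/colP => r; rewrite rowM kx ?mem_nth // !mxE.
- exact: xi.
pose z := (2 ^ L)%N%:R^-1 *: map_mx intr u : 'cV[rat]_n.
have kz : in_kernel A z.
  move=> a ia; apply/matrixP => r c; rewrite !ord1.
  have ir : (index a A < size A)%N by rewrite index_mem.
  have := rowM (Ordinal ir) (map_mx intr u); rewrite nth_index // -map_mxM Mu map_mx0 mxE => e0.
  by rewrite /z -scalemxAr mxE -e0 mulr0 mxE.
have zE l : z l 0 = (u l 0)%:~R / (2 ^ L)%N%:R by rewrite !mxE mulrC.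
have bz : in_box z.
  move=> l; have /andP [u0 ul] := ub l; rewrite zE divr_ge0 ?ler0z ?ler0n //=.
  rewrite ler_pdivrMr // mul1r -[(2 ^ L)%N%:R]/((2 ^ L)%N%:Z%:~R) ler_int.
  by apply: le_trans ul _; rewrite lez_nat.
have := half z kz bz; rewrite zE [(2 ^ L)%N%:R * _]mulrC divfK ?gt_eqF //= => h.
by have : 2%:~R * (u i 0)%:~R <= 1%:~R :> rat by []; rewrite -intrM ler_int; lia.
Qed.

Lemma rescale_sum e : ~~ finished n A e ->
  (\sum_(i < n) nget (rescale n A e) i < \sum_(i < n) nget e i)%N.
Proof.
move=> nf; have [kn _] := unfinished_cut nf; have := unfinished_pos nf.
rewrite /rescale (negPf nf); set k := heavy _ _ in kn * => ek.
rewrite (bigD1 (Ordinal kn)) //= [in ltnRHS](bigD1 (Ordinal kn)) //=.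
rewrite {1}/nget nth_mkseq // eqxx -addSn prednK // leq_add2l.
rewrite leq_eqVlt; apply/orP; left; apply/eqP/eq_bigr => i ne.
by rewrite {1}/nget nth_mkseq // ifF //; apply: contraNF ne => /eqP e1; apply/eqP/val_inj.
Qed.

(** The sum of the exponents falls in every unfinished round. When it reaches 0 the perceptron must
    be finished, since the heavy coordinate of an unfinished one has a positive exponent. *)
Lemma rescalings_spec (e := rescalings n A L) : finished n A e /\ bounded_by e.
Proof.
have inv i : let e := iter i (rescale n A) (mkseq (fun=> L.+1) n) in
    bounded_by e /\ (finished n A e || (\sum_(k < n) nget e k + i <= n * L.+1)%N).
  elim: i => [|i [b f]] /=.
    split.
      move=> x _ bx i; rewrite /nget nth_mkseq //= pow2E.
      by rewrite -[X in _ <= X]mulr1 ler_pM2l ?ltr0n ?expn_gt0 //; case/andP: (bx i).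
    apply/orP; right; rewrite addn0 -[n in leqRHS]card_ord -sum_nat_const.
    by apply: leq_sum => k _; rewrite /nget nth_mkseq.
  split; first exact: bounded_rescale.
  set e' := iter i _ _ in b f *; case: (boolP (finished n A e')) f => [fin _|nf /= le].
    by rewrite /rescale fin fin.
  by apply/orP; right; apply: leq_trans le; rewrite addnS -addSn leq_add2r rescale_sum.
have [b f] := inv (n * L.+1)%N; split=> //; rewrite /e /rescalings.
case/orP: f => // le; apply/negPn/negP => nf.
have [kn _] := unfinished_cut nf; have := unfinished_pos nf.
move: le; rewrite -[leqRHS]add0n leq_add2r leqn0 sum_nat_eq0 => /forallP.
by move/(_ (Ordinal kn)) => /= /eqP ->.
Qed.

(** The perceptron ends with a positive kernel vector of the scaled system, so [x] is positive
    wherever the scale is; where the scale is 0, the invariant makes every nonnegative kernel vector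
    vanish. *)
Lemma solve_spec (x := solve n A L) :
  [/\ forall i, 0 <= vget x i,
      forall a, a \in A -> \sum_(j < n) vget a j * vget x j = 0 &
      forall z : 'cV[rat]_n, in_kernel A z -> (forall i, 0 <= z i 0) ->
        forall i : 'I_n, vget x i = 0 -> z i 0 = 0].
Proof.
have [fin be] := rescalings_spec; set e := rescalings n A L in fin be.
pose N := mxl n n (scaled_proj n A e); pose y := perceptron n (scaled_proj n A e).
have st := proj_spec n (scale_rows n A e); rewrite -/(scaled_proj n A e) -/N in st.
have w0 : forall i : 'I_n, 0 < (N *m colz n y) i 0 by apply: nonpositive_nil; apply/eqP.
have xE (i : 'I_n) : vget x i = scaling (nget e i) * (N *m colz n y) i 0.
  by rewrite /x /solve vget_mkseq // -/e (vget_mulmv_Posz _ _ i).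
split.
- move=> i; case: (ltnP i n) => h; last by rewrite /vget nth_default ?size_mkseq.
  by rewrite (xE (Ordinal h)) mulr_ge0 ?scaling_ge0 ?ltW.
- move=> a ia; apply: (@intr_inj rat).
  have := gram_state_range st (map_mx intr (colz n y)).
  have vE j : (map_mx intr N *m map_mx intr (colz n y)) j 0 = ((N *m colz n y) j 0)%:~R :> rat.
    by rewrite -map_mxM mxE.
  move: (map_mx intr N *m _) vE => v vE.
  move/in_kernel_scale/(_ a ia)/matrixP/(_ 0 0); rewrite !mxE => e0.
  rewrite rmorph_sum /= -[RHS]e0; apply: eq_bigr => j _.
  by rewrite xE !rmorphM /= -vE !mxE.
- move=> z kz z0 i; rewrite xE => /eqP; rewrite mulf_eq0 => /orP [s0|]; last by rewrite gt_eqF.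
  apply/eqP; apply: contraTT isT => zi.
  (* Dividing by the sum of its coordinates puts [z] into the unit box. *)
  pose c := \sum_j z j 0.
  have c0 : 0 < c.
    by rewrite /c (bigD1 i) //= ltr_pwDl ?sumr_ge0 // lt_def zi z0.
  have zc j : z j 0 <= c by rewrite /c (bigD1 j) //= lerDl sumr_ge0.
  have := be (c^-1 *: z) _ _ i; rewrite (eqP s0) mxE => h.
  have p0 : 0 < (2 ^ L)%N%:R :> rat by rewrite ltr0n expn_gt0.
  have : 0 < (2 ^ L)%N%:R * (c^-1 * z i 0) by rewrite !mulr_gt0 ?invr_gt0 // lt_def zi z0.
  rewrite ltNge h // => [a ia|j]; first by rewrite -scalemxAr kz // scaler0.
  by rewrite mxE mulr_ge0 ?invr_ge0 ?(ltW c0) //= mulrC ler_pdivrMr // mul1r.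
Qed.
End Rescaling.

From mathcomp Require Import boolp.

(** * Linear programming duality *)

Section Farkas.
Variable F : realFieldType.

Fixpoint in_cone n (s : seq 'rV[F]_n) (c : 'rV[F]_n) : Prop :=
  if s is a :: s' then exists2 l, 0 <= l & in_cone s' (c - l *: a) else c = 0.

(* Bartl's proof: a vector [x0] that violates the last constraint only allows
   one to eliminate it from the others. *)
Lemma in_coneP n (s : seq 'rV[F]_n) (c : 'rV[F]_n) :
  (forall x : 'cV_n, (forall a, a \in s -> (a *m x) 0 0 <= 0) -> (c *m x) 0 0 <= 0) ->
  in_cone s c.
Proof.
elim: {s}(size s) {-2}s (erefl (size s)) c => [|k IH] s ss c h.
  case: s ss h => //= _ h; apply/rowP => j; rewrite mxE.
  have E (t : F) : (c *m (t *: delta_mx j 0 : 'cV_n)) 0 0 = t * c 0 j.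
    rewrite mxE (bigD1 j) //= !mxE !eqxx mulr1 mulrC big1 ?addr0 // => k /negPf ne.
    by rewrite !mxE ne /= !mulr0.
  have h1 := h (1 *: delta_mx j 0) (fun a => ltac:(by [])).
  have h2 := h (-1 *: delta_mx j 0) (fun a => ltac:(by [])).
  by move: h1 h2; rewrite !E; lra.
case: s ss h => // a s [ss] h.
have [h'|] := pselect (forall x : 'cV_n, (forall b, b \in s -> (b *m x) 0 0 <= 0) -> (c *m x) 0 0 <= 0).
  by exists 0; rewrite // scale0r subr0; apply: IH.
move/existsNP => [x0 /not_implyP [sx0 /negP]]; rewrite -ltNge => cx0.
have ax0 : 0 < (a *m x0) 0 0.
  rewrite ltNge; apply/negP => ax; suff : (c *m x0) 0 0 <= 0 by rewrite leNgt cx0.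
  by apply: h => b; rewrite inE => /orP [/eqP ->|]; [exact: ax|exact: sx0].
(* [red b] is [b] after the projection along [x0] onto the hyperplane where [a] vanishes. *)
pose al := (a *m x0) 0 0; pose red (b : 'rV[F]_n) := b - ((b *m x0) 0 0 / al) *: a.
have al0 : al != 0 by rewrite gt_eqF.
have redE b (x : 'cV_n) : (red b *m x) 0 0 = (b *m (x - ((a *m x) 0 0 / al) *: x0)) 0 0.
  have E (u v : 'M[F]_1) p : (u - p *: v) 0 0 = u 0 0 - p * v 0 0 by rewrite !mxE.
  by rewrite /red mulmxBl mulmxBr -scalemxAl -scalemxAr !E; ring.
have kill (x : 'cV_n) : (a *m (x - ((a *m x) 0 0 / al) *: x0)) 0 0 = 0.
  rewrite mulmxBr -scalemxAr.
  have E (u v : 'M[F]_1) p : (u - p *: v) 0 0 = u 0 0 - p * v 0 0 by rewrite !mxE.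
  by rewrite E -/al divfK // subrr.
have : in_cone (map red s) (red c).
  apply: IH; first by rewrite size_map.
  move=> x hx; rewrite redE; apply: h => b; rewrite inE => /orP [/eqP ->|bs].
    by rewrite kill.
  by rewrite -redE; apply: hx; apply: map_f.
(* Undoing the elimination collects a multiple of [a], whose coefficient is nonnegative because the
   other constraints are nonpositive at [x0]. *)
have key : forall s' c', (forall b, b \in s' -> (b *m x0) 0 0 <= 0) -> in_cone (map red s') c' ->
    exists2 l, 0 <= l & in_cone s' (c' - l *: a).
  elim=> [|b s' IHs] c' hs' /=.
    by move=> ->; exists 0; rewrite // scale0r subrr.
  case=> m m0 /IHs [b' ib|l l0 il]; first by apply: hs'; rewrite inE ib orbT.
  have bx : (b *m x0) 0 0 <= 0 by apply: hs'; rewrite mem_head.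
  exists (l - m * ((b *m x0) 0 0 / al)).
    rewrite subr_ge0 (le_trans _ l0) // mulr_ge0_le0 // mulr_le0_ge0 // invr_ge0 ltW //.
  exists m => //; rewrite (_ : _ - _ - _ = c' - m *: red b - l *: a) //.
  rewrite /red scalerBr scalerA scalerBl !opprB; apply/rowP => j; rewrite !mxE; ring.
case/(key s); first exact: sx0.
move=> l l0 hl; exists (l + (c *m x0) 0 0 / al).
  by rewrite addr_ge0 // divr_ge0 // ltW.
by rewrite scalerDl opprD addrA addrAC; rewrite /red in hl.
Qed.

Lemma in_cone_comb n (s : seq 'rV[F]_n) c : in_cone s c ->
  exists2 f : nat -> F, (forall i, 0 <= f i) & c = \sum_(i < size s) f i *: nth 0 s i.
Proof.
elim: s c => [|a s IH] c /=; first by move=> ->; exists (fun=> 0) => //; rewrite big_ord0.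
case=> l l0 /IH [f f0 e]; exists (fun i => if i is i'.+1 then f i' else l); first by case.
by rewrite big_ord_recl /=; apply/eqP; rewrite addrC -subr_eq e.
Qed.

Definition nonneg m n (M : 'M[F]_(m, n)) := forall i j, 0 <= M i j.

Lemma cone_combination m n (G : 'M[F]_(m, n)) (c : 'rV[F]_n) :
  (forall x : 'cV_n, nonneg (- (G *m x)) -> (c *m x) 0 0 <= 0) ->
  exists2 u : 'rV[F]_m, nonneg u & c = u *m G.
Proof.
move=> h; have : in_cone [seq row i G | i <- enum 'I_m] c.
  apply: in_coneP => x hx; apply: h => i j; rewrite !ord1 mxE oppr_ge0.
  have := hx (row i G) (map_f _ (mem_enum _ _)).
  by rewrite -row_mul mxE.
case/in_cone_comb => f f0 ->; exists (\row_i f i); first by move=> i j; rewrite mxE.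
rewrite size_map size_enum_ord mulmx_sum_row; apply: eq_bigr => i _.
by rewrite mxE (nth_map i) ?size_enum_ord // nth_ord_enum.
Qed.

(** Homogenize with a variable [t]: if there is no solution, then [x >= 0] and [A x >= t b] imply
    [t <= 0], as division by a positive [t] would give one. So the functional [t] is a nonnegative
    combination of the constraints. *)
Lemma farkas m n (A : 'M[F]_(m, n)) (b : 'cV[F]_m) :
  (exists2 x : 'cV_n, nonneg x & nonneg (A *m x - b)) \/
  (exists u : 'rV_m, [/\ nonneg u, nonneg (- (u *m A)) & 0 < (u *m b) 0 0]).
Proof.
case: (pselect (exists2 x : 'cV_n, nonneg x & nonneg (A *m x - b))) => [|no]; first by left.
right; pose G : 'M[F]_(m + n, n + 1) := col_mx (row_mx (- A) b) (row_mx (- 1%:M) 0).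
have [|w w0 ew] := @cone_combination _ _ G (row_mx 0 1%:M).
  move=> z; rewrite -[z]vsubmxK; set x := usubmx z; set t := dsubmx z.
  rewrite /G mul_col_mx !mul_row_col !mulNmx !mul1mx !mul0mx add0r addr0 => h.
  rewrite leNgt; apply/negP => t0; apply: no; exists ((t 0 0)^-1 *: x).
    move=> i j; have hx : 0 <= x i j.
      by have := h (rshift m i) j; rewrite mxE col_mxEd mxE opprK.
    by rewrite mxE mulr_ge0 // invr_ge0 ltW.
  move=> i j; have := h (lshift n i) j; rewrite mxE col_mxEu -scalemxAr !ord1.
  have E (u v : 'cV[F]_m) s : (s *: u - v) i 0 = s * u i 0 - v i 0 by rewrite !mxE.
  rewrite E mxE [(- (A *m x)) i 0]mxE [(b *m t) i 0]mxE big_ord1 => hx.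
  rewrite subr_ge0 -ler_pdivrMl ?invr_gt0 // invrK; lra.
exists (lsubmx w); move: ew; rewrite -{1}[w]hsubmxK /G mul_row_col !mul_mx_row add_row_mx.
case/eq_row_mx; rewrite !mulmxN mulmx1 mulmx0 addr0 => e1 e2; split.
- by move=> i j; rewrite mxE; apply: w0.
- have -> : - (lsubmx w *m A) = rsubmx w by apply/eqP; rewrite -subr_eq0 -e1.
  by move=> i j; rewrite mxE; apply: w0.
- by rewrite -e2 mxE eqxx ltr01.
Qed.

(** For a feasible primal, Farkas' lemma is applied to the joint system of primal constraints, dual
    constraints and the reversed gap. The hypothesis says that the primal has no recession
    direction. *)
Lemma strong_duality m n (A : 'M[F]_(m, n)) (b : 'cV[F]_m) (c : 'cV[F]_n) :
  (forall w : 'cV_n, nonneg w -> nonneg (A *m w) -> w = 0) ->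
  (exists x y, [/\ nonneg x, nonneg y, nonneg (A *m x - b), nonneg (c - A^T *m y) &
     (c^T *m x) 0 0 <= (b^T *m y) 0 0]) \/
  (exists u : 'cV_m, [/\ nonneg u, nonneg (- (A^T *m u)) & 0 < (b^T *m u) 0 0]).
Proof.
move=> bnd; case: (farkas A b) => [[x1 x10 hx1]|[u [u0 uA ub]]]; last first.
  right; exists u^T; split.
  - by move=> i j; rewrite mxE.
  - by move=> i j; rewrite -trmx_mul mxE mxE; have := uA j i; rewrite mxE.
  - by rewrite -trmx_mul mxE.
left; pose G : 'M[F]_(m + (n + 1), n + m) :=
  col_mx (row_mx A 0) (col_mx (row_mx 0 (- A^T)) (row_mx (- c^T) b^T)).
pose h : 'cV[F]_(m + (n + 1)) := col_mx b (col_mx (- c) 0).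
case: (farkas G h) => [[z z0 hz]|[w [w0 wG wh]]].
  exists (usubmx z), (dsubmx z); move: hz; rewrite -[z in G *m z]vsubmxK /G /h.
  rewrite !mul_col_mx !mul_row_col !mul0mx addr0 add0r !opp_col_mx opprK !add_col_mx => hz.
  split.
  - by move=> i j; rewrite mxE; apply: z0.
  - by move=> i j; rewrite mxE; apply: z0.
  - by move=> i j; have := hz (lshift _ i) j; rewrite col_mxEu.
  - by move=> i j; have := hz (rshift _ (lshift _ i)) j; rewrite col_mxEd col_mxEu mulNmx addrC.
  - have := hz (rshift _ (rshift _ 0)) 0; rewrite !col_mxEd oppr0 addr0 mulNmx.
    have E (u v : 'M[F]_1) : (- u + v) 0 0 = v 0 0 - u 0 0 by rewrite !mxE addrC.
    by rewrite E subr_ge0.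
exfalso.
pose u := lsubmx w; pose v := lsubmx (rsubmx w); pose t := rsubmx (rsubmx w).
have u0 : nonneg u by move=> i j; rewrite mxE; apply: w0.
have v0 : nonneg v by move=> i j; rewrite !mxE; apply: w0.
have t0 : 0 <= t 0 0 by rewrite !mxE; apply: w0.
have ew : w = row_mx u (row_mx v t) by rewrite /u /v /t !hsubmxK.
clearbody u v t.
move: wG wh; rewrite ew /G /h !mul_row_col !mul_mx_row !add_row_mx !mulmx0 addr0 add0r.
rewrite !mulmxN opp_row_mx => wG wh.
have tE (k : nat) (M : 'rV[F]_k) j : (t *m M) 0 j = t 0 0 * M 0 j by rewrite mxE big_ord1.
have uA j : (u *m A) 0 j <= t 0 0 * c j 0.
  have := wG 0 (lshift _ j); rewrite row_mxEl.
  have E (p q : 'rV[F]_n) : (- (p + (0 - q))) 0 j = q 0 j - p 0 j by rewrite !mxE; ring.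
  have E' (p q : 'rV[F]_n) : (- (p - q)) 0 j = q 0 j - p 0 j by rewrite !mxE; ring.
  by rewrite ?add0r ?E ?E' tE [c^T 0 j]mxE subr_ge0.
have vA i : t 0 0 * b i 0 <= (v *m A^T) 0 i.
  have := wG 0 (rshift _ i); rewrite row_mxEr.
  have E (p q : 'rV[F]_m) : (- (- p + q)) 0 i = p 0 i - q 0 i by rewrite !mxE; ring.
  by rewrite add0r E tE [b^T 0 i]mxE subr_ge0.
have vc : (v *m c) 0 0 < (u *m b) 0 0.
  have E (p q : 'M[F]_1) : (p - q) 0 0 = p 0 0 - q 0 0 by rewrite !mxE.
  by move: wh; rewrite ?addr0 E subr_gt0.
have hu (x : 'cV_n) : nonneg x -> nonneg (A *m x - b) -> (u *m b) 0 0 <= t 0 0 * (c^T *m x) 0 0.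
  move=> x0 hx; have h1 : 0 <= (u *m (A *m x - b)) 0 0.
    by rewrite mxE sumr_ge0 // => i _; rewrite mulr_ge0 // ?u0 ?hx.
  have h2 : ((u *m A) *m x) 0 0 <= t 0 0 * (c^T *m x) 0 0.
    rewrite mxE [(c^T *m x) 0 0]mxE mulr_sumr ler_sum // => j _.
    by rewrite [c^T 0 j]mxE mulrA ler_wpM2r ?x0 ?uA.
  have E (p q : 'M[F]_1) : (p - q) 0 0 = p 0 0 - q 0 0 by rewrite !mxE.
  by move: h1; rewrite mulmxBr E mulmxA; lra.
(* For [t > 0] the vector [v / t] is primal feasible and contradicts [vc] through [hu]. For [t = 0]
   the vector [v] is a recession direction, hence zero, and [hu] at the known feasible point [x1]
   contradicts [vc]. *)
case: (ltrgtP (t 0 0) 0) => [|tpos|t00]; first by rewrite ltNge t0.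
  have cv : (c^T *m v^T) 0 0 = (v *m c) 0 0 by rewrite -trmx_mul mxE.
  have ev : (c^T *m ((t 0 0)^-1 *: v^T)) 0 0 = (t 0 0)^-1 * (v *m c) 0 0 by rewrite -scalemxAr mxE cv.
  have := hu ((t 0 0)^-1 *: v^T); rewrite ev mulrA divff ?gt_eqF // mul1r.
  move=> hf; suff : (u *m b) 0 0 <= (v *m c) 0 0 by rewrite leNgt vc.
  apply: hf.
    by move=> i j; rewrite !mxE mulr_ge0 ?invr_ge0 ?(ltW tpos) ?v0.
  move=> i j; rewrite !ord1 -scalemxAr -[A]trmxK -trmx_mul.
  have E (p q : 'cV[F]_m) s : (s *: p - q) i 0 = s * p i 0 - q i 0 by rewrite !mxE.
  by rewrite E mxE subr_ge0 mulrC ler_pdivlMr // mulrC; apply: vA.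
have v00 : v = 0.
  apply: trmx_inj; rewrite trmx0; apply: bnd => i j; first by rewrite mxE.
  by rewrite -[A]trmxK -trmx_mul mxE !ord1; have := vA i; rewrite t00 mul0r.
have := hu x1 x10 hx1; rewrite t00 mul0r leNgt.
by move: vc; rewrite v00 mul0mx mxE => ->.
Qed.
End Farkas.

(** * Linear programming in polynomial time *)

Section Programs.
Variables (F : realFieldType) (m n : nat) (A : nat -> nat -> F) (b c : nat -> F).

Definition lin (a x : nat -> F) : F := \sum_(j < n) a j * x j.

Definition primal (x : nat -> F) : Prop :=
  (forall j, (j < n)%N -> 0 <= x j) /\ (forall i, (i < m)%N -> b i <= lin (A i) x).

Definition dual (y : nat -> F) : Prop :=
  (forall i, (i < m)%N -> 0 <= y i) /\
  (forall j, (j < n)%N -> \sum_(i < m) y i * A i j <= c j).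

Definition infeasible (u : nat -> F) : Prop :=
  [/\ forall i, (i < m)%N -> 0 <= u i,
      forall j, (j < n)%N -> \sum_(i < m) u i * A i j <= 0 &
      0 < \sum_(i < m) u i * b i].

(** A trivial recession cone, for the given matrix and any right-hand side. *)
Definition bounded_program : Prop := forall w, (forall j, (j < n)%N -> 0 <= w j) ->
  (forall i, (i < m)%N -> 0 <= lin (A i) w) -> forall j, (j < n)%N -> w j = 0.

Lemma exchange_lin (x y : nat -> F) :
  \sum_(i < m) y i * lin (A i) x = \sum_(j < n) (\sum_(i < m) y i * A i j) * x j.
Proof.
under eq_bigr => i _ do rewrite mulr_sumr.
rewrite exchange_big /=; apply: eq_bigr => j _; rewrite mulr_suml.
by apply: eq_bigr => i _; rewrite mulrA.
Qed.

Lemma lp_weak_duality x y : primal x -> dual y -> \sum_(i < m) y i * b i <= lin c x.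
Proof.
move=> [x0 hx] [y0 hy]; apply: (@le_trans _ _ (\sum_(i < m) y i * lin (A i) x)).
  by apply: ler_sum => i _; rewrite ler_wpM2l ?y0 ?hx.
by rewrite exchange_lin; apply: ler_sum => j _; rewrite ler_wpM2r ?x0 ?hy.
Qed.

Lemma infeasible_primal u x : infeasible u -> ~ primal x.
Proof.
move=> [u0 hu ub] [x0 hx]; suff : \sum_(i < m) u i * b i <= 0 by rewrite leNgt ub.
apply: (@le_trans _ _ (\sum_(i < m) u i * lin (A i) x)).
  by apply: ler_sum => i _; rewrite ler_wpM2l ?u0 ?hx.
by rewrite exchange_lin; apply: sumr_le0 => j _; rewrite mulr_le0_ge0 ?hu ?x0.
Qed.

Definition fun_of_col k (x : 'cV[F]_k) (j : nat) : F := if insub j is Some o then x o 0 else 0.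

Lemma fun_of_colE k (x : 'cV[F]_k) (o : 'I_k) : fun_of_col x o = x o 0.
Proof. by rewrite /fun_of_col valK. Qed.

Lemma lp_strong_duality : bounded_program ->
  (exists x y, [/\ primal x, dual y & lin c x <= \sum_(i < m) y i * b i]) \/
  exists u, infeasible u.
Proof.
move=> bnd; pose Am : 'M[F]_(m, n) := \matrix_(i, j) A i j.
have mulA (x : 'cV[F]_n) (i : 'I_m) : (Am *m x) i 0 = lin (A i) (fun_of_col x).
  by rewrite mxE; apply: eq_bigr => j _; rewrite mxE fun_of_colE.
have mulAT (y : 'cV[F]_m) (j : 'I_n) : (Am^T *m y) j 0 = \sum_(i < m) fun_of_col y i * A i j.
  by rewrite mxE; apply: eq_bigr => i _; rewrite !mxE fun_of_colE mulrC.
have bE (y : 'cV[F]_m) : ((\col_i b i)^T *m y) 0 0 = \sum_(i < m) fun_of_col y i * b i.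
  by rewrite mxE; apply: eq_bigr => i _; rewrite !mxE fun_of_colE mulrC.
have sub0 k (u v : 'cV[F]_k) i : (u - v) i 0 = u i 0 - v i 0 by rewrite !mxE.
have [|[x [y [x0 y0 hx hy hc]]]|[u [u0 hu ub]]] := @strong_duality F m n Am (\col_i b i) (\col_j c j).
- move=> w w0 Aw; apply/colP => j; rewrite mxE -fun_of_colE; apply: bnd => // [k kn|i im].
    by rewrite -[k]/(val (Ordinal kn)) fun_of_colE.
  by have := Aw (Ordinal im) 0; rewrite mulA.
- left; exists (fun_of_col x), (fun_of_col y); split.
  + split=> [j jn|i im]; first by rewrite -[j]/(val (Ordinal jn)) fun_of_colE.
    by have := hx (Ordinal im) 0; rewrite sub0 mulA mxE subr_ge0.
  + split=> [i im|j jn]; first by rewrite -[i]/(val (Ordinal im)) fun_of_colE.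
    by have := hy (Ordinal jn) 0; rewrite sub0 mulAT mxE subr_ge0.
  + move: hc; rewrite bE mxE; apply: le_trans; rewrite le_eqVlt; apply/orP; left; apply/eqP.
    by apply: eq_bigr => j _; rewrite !mxE fun_of_colE.
- right; exists (fun_of_col u); split.
  + by move=> i im; rewrite -[i]/(val (Ordinal im)) fun_of_colE.
  + by move=> j jn; have := hu (Ordinal jn) 0; rewrite mxE mulAT oppr_ge0.
  + by rewrite -bE.
Qed.
End Programs.

(** * The homogeneous self-dual system *)

Section Skew.
Variables (R : comNzRingType) (m n : nat) (A : nat -> nat -> R) (b c : nat -> R).

(* The skew-symmetric matrix of the homogeneous primal-dual system in the
   unknowns [x], [y] and the homogenizing variable, whose index is [n + m]. *)
Definition skew (i j : nat) : R :=
  if (i < n)%N then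
    if (j < n)%N then 0 else if (j < n + m)%N then - A (j - n) i else c i
  else if (i < n + m)%N then
    if (j < n)%N then A (i - n) j else if (j < n + m)%N then 0 else - b (i - n)
  else if (j < n)%N then - c j else if (j < n + m)%N then b (j - n) else 0.

Lemma sum_blocks (f : nat -> R) : \sum_(j < n + m + 1) f j =
  \sum_(j < n) f j + \sum_(i < m) f (n + i)%N + f (n + m)%N.
Proof. by rewrite addn1 big_ord_recr /= big_split_ord. Qed.

Lemma skew_dual i (z : nat -> R) : (i < n)%N -> \sum_(j < n + m + 1) skew i j * z j =
  c i * z (n + m)%N - \sum_(k < m) z (n + k)%N * A k i.
Proof.
move=> li; rewrite (sum_blocks (fun j => skew i j * z j)) /skew li big1 => [|j _]; last first.
  by rewrite ltn_ord mul0r.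
rewrite ltnn ltnNge leq_addr /= add0r addrC -sumrN; congr (_ + _); apply: eq_bigr => k _.
by rewrite ltnNge leq_addr /= ltn_add2l ltn_ord addKn mulNr mulrC.
Qed.

Lemma skew_primal k (z : nat -> R) : (k < m)%N -> \sum_(j < n + m + 1) skew (n + k) j * z j =
  \sum_(j < n) A k j * z j - b k * z (n + m)%N.
Proof.
move=> lk; rewrite (sum_blocks (fun j => skew (n + k)%N j * z j)) /skew ltnNge leq_addr /=.
rewrite ltn_add2l lk addKn ltnn [(n + m < n)%N]ltnNge leq_addr /= mulNr [X in _ + X - _]big1 ?addr0.
  by congr (_ - _); apply: eq_bigr => j _; rewrite ltn_ord.
by move=> i _; rewrite ltnNge leq_addr /= ltn_add2l ltn_ord mul0r.
Qed.

Lemma skew_gap (z : nat -> R) : \sum_(j < n + m + 1) skew (n + m) j * z j =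
  \sum_(i < m) z (n + i)%N * b i - \sum_(j < n) c j * z j.
Proof.
rewrite (sum_blocks (fun j => skew (n + m)%N j * z j)) /skew ltnn ltnNge leq_addr /= mul0r addr0 addrC.
congr (_ + _).
  by apply: eq_bigr => i _; rewrite ltnNge leq_addr /= ltn_add2l ltn_ord addKn mulrC.
by rewrite -sumrN; apply: eq_bigr => j _; rewrite ltn_ord mulNr.
Qed.
End Skew.

Definition qget (v : seq rat) (i : nat) : rat := nth 0 v i.
Definition qmget (A : seq (seq rat)) (i j : nat) : rat := qget (nth [::] A i) j.

Lemma PT_qget : PT (fun p : seq rat * nat => qget p.1 p.2).
Proof. by rewrite /qget; pt. Qed.

#[export] Hint Resolve PT_qget : polytime.

Lemma PT_qmget : PT (fun p : seq (seq rat) * nat * nat => qmget p.1.1 p.1.2 p.2).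
Proof. by rewrite /qmget; pt. Qed.

#[export] Hint Resolve PT_qmget : polytime.

Definition clear_denq (Q : int) (a : rat) : int := numq (a * Q%:~R).

Lemma clear_denqE Q a : (denq a %| Q)%Z -> (clear_denq Q a)%:~R = a * Q%:~R.
Proof.
move=> /dvdzP [k ->]; rewrite /clear_denq.
have -> : a * (k * denq a)%:~R = (numq a * k)%:~R by rewrite !rmorphM /= numqE; ring.
by rewrite numq_int.
Qed.

Definition program := (nat * nat * seq (seq rat) * seq rat * seq rat)%type.

Section Instance.
Variable P : program.
Let m := P.1.1.1.1.
Let n := P.1.1.1.2.
Let A := P.1.1.2.
Let b := P.1.2.
Let c := P.2.

Definition program_denq : int :=
  prodz m (fun i => prodz n (fun j => denq (qmget A i j))) *
  (prodz m (fun i => denq (qget b i)) * prodz n (fun j => denq (qget c j))).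

Definition skew_entry (Q : int) (i j : nat) : int :=
  skew m n (fun i j => clear_denq Q (qmget A i j)) (fun i => clear_denq Q (qget b i))
    (fun j => clear_denq Q (qget c j)) i j.

(** One slack column per row turns the inequalities of the system into equations, so that its
    solutions are the nonnegative kernel vectors. *)
Definition self_dual_entry (Q : int) (i j : nat) : int :=
  let N := (n + m + 1)%N in
  if (j < N)%N then skew_entry Q i j else if j == (N + i)%N then -1 else 0.

Definition self_dual_matrix : seq (seq int) :=
  let Q := program_denq in
  mkseq (fun i => mkseq (self_dual_entry Q i) (n + m + 1 + (n + m + 1))) (n + m + 1).
End Instance.

Definition sumn_map (T : Type) (f : T -> nat) (s : seq T) : nat := foldl (fun k x => (k + f x)%N) 0%N s.

Definition matrix_bits (K : seq (seq int)) : nat :=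
  sumn_map (fun r => sumn_map (fun z => size (int_bits z)) r) K.

(** For [M = N + N] unknowns and entries at most [B = 2 ^ matrix_bits K], the exponent
    [M * (M + matrix_bits K)] exceeds the size of [M! * B^M], as the rescaling requires. *)
Definition lp_solution (P : program) : seq int :=
  let K := self_dual_matrix P in
  let N := (P.1.1.1.2 + P.1.1.1.1 + 1)%N in
  solve (N + N) K ((N + N) * (N + N + matrix_bits K)).

Definition lp_solve (P : program) : option (seq rat) :=
  let X := lp_solution P in
  let t := vget X (P.1.1.1.2 + P.1.1.1.1) in
  if t == 0 then None else Some (mkseq (fun j => mkrat (vget X j) t) P.1.1.1.2).

Lemma PT_clear_denq : PT (fun p : int * rat => clear_denq p.1 p.2).
Proof. by rewrite /clear_denq; pt. Qed.

#[export] Hint Resolve PT_clear_denq : polytime.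

Lemma PT_program_denq : PT program_denq.
Proof. by rewrite /program_denq; pt. Qed.

Lemma PT_skew_entry : PT (fun p : program * int * nat * nat => skew_entry p.1.1.1 p.1.1.2 p.1.2 p.2).
Proof. by rewrite /skew_entry /skew; pt. Qed.

#[export] Hint Resolve PT_program_denq PT_skew_entry : polytime.

Lemma PT_self_dual_entry :
  PT (fun p : program * int * nat * nat => self_dual_entry p.1.1.1 p.1.1.2 p.1.2 p.2).
Proof.
rewrite /self_dual_entry; apply: PT_if; pt.
by apply: (PT_comp4 PT_skew_entry); pt.
Qed.

Lemma PT_self_dual_matrix : PT self_dual_matrix.
Proof.
rewrite /self_dual_matrix; apply: PT_mkseq; last by pt.
by apply: PT_mkseq; last pt; apply: (PT_comp4 PT_self_dual_entry); pt.
Qed.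

Lemma sumn_mapE (T : eqType) (f : T -> nat) s : sumn_map f s = (\sum_(x <- s) f x)%N.
Proof.
rewrite /sumn_map -[RHS]add0n; move: {1 2}0%N => k.
elim: s k => [|x s IH] k; first by rewrite big_nil addn0.
by rewrite big_cons /= IH addnA.
Qed.

Lemma PT_sumn_map A (eA : enc A) X (eX : enc X) (f : A -> X -> nat) (s : A -> seq X) :
  PT (fun p : A * X => f p.1 p.2) -> PT s -> PT (fun a => sumn_map (f a) (s a)).
Proof.
move=> hf hs; have [g hg le] := PB_sz_mem hf hs.
apply: (@PT_foldl_incr _ _ _ _ _ _ (fun a k x => k + f a x)%N (fun=> 0%N) s g) => //; pt.
move=> a st l1 x l2 e; have := le _ _ _ _ e; rewrite !sz_nat /=; lia.
Qed.

Lemma PT_matrix_bits : PT matrix_bits.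
Proof.
rewrite /matrix_bits; apply: (PT_sumn_map (f := fun _ r => sumn_map (fun z => size (int_bits z)) r) (s := id)); pt.
by apply: (PT_sumn_map (f := fun _ z => size (int_bits z)) (s := snd)); pt.
Qed.

#[export] Hint Resolve PT_self_dual_matrix PT_matrix_bits : polytime.

Lemma PT_lp_solution : PT lp_solution.
Proof. by rewrite /lp_solution; pt. Qed.

#[export] Hint Resolve PT_lp_solution : polytime.

Lemma PT_lp_solve : PT lp_solve.
Proof. by rewrite /lp_solve; pt. Qed.

#[export] Hint Resolve PT_lp_solve : polytime.

Lemma fact_le_exp n : (n`! <= n ^ n)%N.
Proof.
elim: n => // n IH; rewrite factS expnS leq_mul2l /=; apply: leq_trans IH _.
by case: n => // n; rewrite leq_exp2r.
Qed.

Lemma leq_sumn_map (T : eqType) (f : T -> nat) s x : x \in s -> (f x <= sumn_map f s)%N.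
Proof. by move=> xs; rewrite sumn_mapE (big_rem x) //= leq_addr. Qed.

Lemma vget_matrix_bits K a k : a \in K -> `|vget a k| <= (2 ^ matrix_bits K)%N%:Z.
Proof.
move=> aK; case: (ltnP k (size a)) => h; last by rewrite /vget nth_default ?normr0.
rewrite -abszE lez_nat ltnW //; apply: leq_trans (nat_bits_lt _) _; rewrite leq_exp2l //.
apply: leq_trans (leq_sumn_map (fun r => sumn_map (fun z => size (int_bits z)) r) aK).
by apply: (leq_sumn_map (fun z => size (int_bits z))); rewrite mem_nth.
Qed.

Lemma prodz_dvd n (F : nat -> int) i : (i < n)%N -> (F i %| prodz n F)%Z.
Proof. by move=> lt; rewrite prodzE (bigD1 (Ordinal lt)) //= dvdz_mulr. Qed.

Lemma prodz_gt0 n (F : nat -> int) : (forall i, 0 < F i) -> 0 < prodz n F.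
Proof. by move=> h; rewrite prodzE prodr_gt0. Qed.

Lemma sub_ltn j n m : ~~ (j < n)%N -> (j < n + m)%N -> (j - n < m)%N.
Proof. by rewrite -leqNgt => h; rewrite -ltn_subLR. Qed.

(** * Correctness of the linear programming algorithm *)

Section Correctness.
Variable P : program.
Let m := P.1.1.1.1.
Let n := P.1.1.1.2.
Let A := qmget P.1.1.2.
Let b := qget P.1.2.
Let c := qget P.2.
Let N := (n + m + 1)%N.
Let Q := program_denq P.
Let K := self_dual_matrix P.
Let S := skew m n A b c.
Let X := lp_solution P.

Lemma program_denq_gt0 : 0 < Q.
Proof.
by rewrite /Q /program_denq !mulr_gt0 ?prodz_gt0 // => i; rewrite ?prodz_gt0 ?denq_gt0.
Qed.

Lemma skew_entryE i j : (i < N)%N -> (j < N)%N -> (skew_entry P Q i j)%:~R = S i j * Q%:~R.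
Proof.
move=> li lj.
have dA k l : (k < m)%N -> (l < n)%N -> (clear_denq Q (A k l))%:~R = A k l * Q%:~R.
  move=> lk ll; apply: clear_denqE; apply: dvdz_mulr.
  apply: dvdz_trans (prodz_dvd (fun i => prodz n (fun j => denq (A i j))) lk).
  exact: (prodz_dvd (fun j => denq (A k j)) ll).
have db k : (k < m)%N -> (clear_denq Q (b k))%:~R = b k * Q%:~R.
  move=> lk; apply: clear_denqE; apply: dvdz_mull; apply: dvdz_mulr.
  exact: (prodz_dvd (fun i => denq (b i)) lk).
have dc k : (k < n)%N -> (clear_denq Q (c k))%:~R = c k * Q%:~R.
  move=> lk; apply: clear_denqE; apply: dvdz_mull; apply: dvdz_mull.
  exact: (prodz_dvd (fun i => denq (c i)) lk).
rewrite /skew_entry /S /skew -/m -/n -/A -/b -/c.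
move: li lj; rewrite /N => li lj.
case: ifPn => hi.
  case: ifPn => hj; first by rewrite mul0r.
  by case: ifPn => hj'; rewrite ?rmorphN /= ?dA ?dc ?mulNr ?sub_ltn.
case: ifPn => hi'.
  case: ifPn => hj; first by rewrite dA ?sub_ltn.
  by case: ifPn => hj'; rewrite ?mul0r // rmorphN /= db ?mulNr ?sub_ltn.
case: ifPn => hj; first by rewrite rmorphN /= dc // mulNr.
by case: ifPn => hj'; rewrite ?mul0r // db ?sub_ltn.
Qed.

Lemma self_dual_row (R : comNzRingType) (z : nat -> R) i : (i < N)%N ->
  \sum_(j < N + N) (vget (nth [::] K i) j)%:~R * z j =
  \sum_(j < N) (skew_entry P Q i j)%:~R * z j - z (N + i)%N.
Proof.
move=> li; have e j : (j < N + N)%N -> vget (nth [::] K i) j = self_dual_entry P Q i j.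
  by move=> lj; rewrite /K /self_dual_matrix nth_mkseq // vget_mkseq.
rewrite big_split_ord /=; congr (_ + _).
  apply: eq_bigr => j _; rewrite e; last exact: leq_trans (ltn_ord j) (leq_addr _ _).
  by rewrite /self_dual_entry -/m -/n -/N ltn_ord.
rewrite (bigD1 (Ordinal li)) //= big1 => [|j ne]; rewrite e ?ltn_add2l //;
  rewrite /self_dual_entry -/m -/n -/N ltnNge leq_addr /= eqn_add2l.
  by rewrite eqxx addr0 mulrN1z mulN1r.
by rewrite ifN ?mul0r.
Qed.

Lemma mem_self_dual a : a \in K -> exists2 i, (i < N)%N & a = nth [::] K i.
Proof.
move=> aK; exists (index a K); last by rewrite nth_index.
by have := aK; rewrite -index_mem size_mkseq.
Qed.

Lemma in_kernel_self_dual (z : nat -> rat) :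
  (forall i, (i < N)%N -> Q%:~R * \sum_(j < N) S i j * z j = z (N + i)%N) ->
  in_kernel K (\col_(j < N + N) z j).
Proof.
move=> h a /mem_self_dual [i li ->]; apply/matrixP => r s; rewrite !mxE.
under eq_bigr => j _ do rewrite !mxE.
rewrite (self_dual_row z li) -h // mulr_sumr; apply/eqP; rewrite subr_eq0; apply/eqP.
by apply: eq_bigr => j _; rewrite skew_entryE // mulrAC mulrC mulrA.
Qed.

Lemma lp_solution_spec :
  [/\ forall j, 0 <= vget X j,
      forall i, (i < N)%N -> 0 <= \sum_(j < N) S i j * (vget X j)%:~R &
      forall z : nat -> rat, (forall j, (j < N + N)%N -> 0 <= z j) ->
        (forall i, (i < N)%N -> Q%:~R * \sum_(j < N) S i j * z j = z (N + i)%N) ->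
        vget X (n + m) = 0 -> z (n + m)%N = 0].
Proof.
have [X0 XK Xmax] : [/\ forall i, 0 <= vget X i,
      forall a, a \in K -> \sum_(j < N + N) vget a j * vget X j = 0 &
      forall z : 'cV[rat]_(N + N), in_kernel K z -> (forall i, 0 <= z i 0) ->
        forall i : 'I_(N + N), vget X i = 0 -> z i 0 = 0].
  apply: (@solve_spec _ _ _ (2 ^ matrix_bits K)).
  - by rewrite /N; lia.
  - by rewrite expn_gt0.
  - by move=> a aK k; apply: vget_matrix_bits.
  rewrite -/K -/N; move: (N + N)%N (matrix_bits K) => M beta.
  rewrite -expnM mulnDr expnD [(beta * M)%N]mulnC leq_mul2r; apply/orP; right.
  apply: leq_trans (fact_le_exp _) _; rewrite expnM; apply: leq_expr2.
  by rewrite ltnW // ltn_expl.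
split=> // [i li|z z0 hz Xt].
  have iK : nth [::] K i \in K by rewrite mem_nth // size_mkseq.
  have := congr1 (fun t : int => t%:~R : rat) (XK _ iK).
  rewrite rmorph_sum /=; under eq_bigr => j _ do rewrite rmorphM /=.
  rewrite (self_dual_row (fun j => (vget X j)%:~R) li) => /eqP; rewrite subr_eq0 => /eqP e.
  have : 0 <= Q%:~R * \sum_(j < N) S i j * (vget X j)%:~R.
    rewrite mulr_sumr (_ : \sum_(j < N) _ = (vget X (N + i))%:~R) ?ler0z //.
    by rewrite -e; apply: eq_bigr => j _; rewrite skew_entryE // mulrCA mulrA.
  by rewrite pmulr_rge0 // ltr0z program_denq_gt0.
have lt : (n + m < N + N)%N by rewrite /N; lia.
have := Xmax _ (in_kernel_self_dual hz) _ (Ordinal lt) Xt; rewrite mxE; apply.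
by move=> j; rewrite mxE z0.
Qed.

(** If the homogenizing variable is positive, the three blocks of the system, divided by it, are
    primal feasibility, dual feasibility and the absence of a gap. If it is zero, maximality of the
    support excludes every primal and dual pair without gap, and strong duality leaves only
    infeasibility. *)
Theorem lp_solveP : bounded_program m n A ->
  if lp_solve P is Some x then size x = n /\ exists y,
    [/\ primal m n A b (qget x), dual m n A c y & lin n c (qget x) <= \sum_(i < m) y i * b i]
  else exists u, infeasible m n A b u.
Proof.
move=> bnd; have [X0 XS Xmax] := lp_solution_spec.
rewrite /lp_solve -/X -/m -/n; case: eqP => [t0|/eqP t0].
  case: (lp_strong_duality b c bnd) => // -[x [y [[x0 hx] [y0 hy] gap]]].
  pose u j : rat := if (j < n)%N then x j else if (j < n + m)%N then y (j - n)%N else 1.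
  have ux j : (j < n)%N -> u j = x j by rewrite /u => ->.
  have uy k : (k < m)%N -> u (n + k)%N = y k.
    by move=> lk; rewrite /u ltnNge leq_addr /= ltn_add2l lk addKn.
  have ut : u (n + m)%N = 1 by rewrite /u ltnNge leq_addr /= ltnn.
  (* The integral matrix is [Q] times the skew one, so the slacks carry the same factor. *)
  pose z j : rat := if (j < N)%N then u j else Q%:~R * \sum_(l < N) S (j - N) l * u l.
  have Q0 : 0 <= Q%:~R :> rat by rewrite ler0z ltW // program_denq_gt0.
  have Su i : (i < N)%N -> 0 <= \sum_(j < N) S i j * u j.
    rewrite /N /S => li; case: (ltnP i n) => [lin|gein].
      rewrite skew_dual // ut mulr1 subr_ge0; apply: le_trans (hy i lin).
      by rewrite le_eqVlt; apply/orP; left; apply/eqP/eq_bigr => k _; rewrite uy.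
    have [k ei] : exists k, i = (n + k)%N by exists (i - n)%N; lia.
    rewrite ei in li *.
    case: (ltnP k m) => lk.
      rewrite skew_primal // ut mulr1 subr_ge0; apply: le_trans (hx k lk) _.
      by rewrite le_eqVlt; apply/orP; left; apply/eqP/eq_bigr => j _; rewrite ux.
    have -> : k = m.
      apply/eqP; rewrite eqn_leq lk andbT; move: li.
      by rewrite -addnA ltn_add2l addn1 ltnS.
    rewrite skew_gap subr_ge0; move: gap; rewrite /lin => gap.
    under eq_bigr => j _ do rewrite ux //.
    by apply: le_trans gap _; rewrite le_eqVlt; apply/orP; left; apply/eqP/eq_bigr => k' _; rewrite uy.
  have u0 j : (j < N)%N -> 0 <= u j.
    move=> lj; rewrite /u; case: ifPn => h1; first exact: x0.
    by case: ifPn => h2; [apply: y0; lia | exact: ler01].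
  have zt : z (n + m)%N = 1 by rewrite /z /N addn1 ltnSn ut.
  have zl l : (l < N)%N -> z l = u l by rewrite /z => ->.
  have := Xmax z; rewrite zt => h; have : (1 : rat) = 0; last by move/eqP; rewrite oner_eq0.
  apply: h => // [j lj|i li].
    by rewrite /z; case: ifPn => h1; [exact: u0|rewrite mulr_ge0 // Su //; lia].
  rewrite {2}/z ltnNge leq_addr /= addKn; congr (_ * _); apply: eq_bigr => j _.
  by rewrite zl.
have tpos : 0 < (vget X (n + m))%:~R :> rat by rewrite ltr0z lt_def t0 X0.
set t := (vget X (n + m))%:~R in tpos; pose x j : rat := (vget X j)%:~R.
have x0 j : 0 <= x j by rewrite /x ler0z X0.
split; first by rewrite size_mkseq.
have xE j : (j < n)%N -> qget (mkseq (fun j => mkrat (vget X j) (vget X (n + m))) n) j = x j / t.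
  by move=> lj; rewrite /qget nth_mkseq.
have linE a : lin n a (qget (mkseq (fun j => mkrat (vget X j) (vget X (n + m))) n)) =
    (\sum_(j < n) a j * x j) / t.
  by rewrite /lin mulr_suml; apply: eq_bigr => j _; rewrite xE // mulrA.
exists (fun k => x (n + k)%N / t); split.
- split=> [j lj|k lk].
    by rewrite xE // divr_ge0 ?x0 // ltW.
  rewrite linE ler_pdivlMr // -subr_ge0 -(@skew_primal _ m n A b c k x lk); apply: XS.
  by rewrite /N; lia.
- split=> [k lk|j lj]; first by rewrite divr_ge0 ?x0 // ltW.
  rewrite (_ : \sum_(i < m) _ = (\sum_(k < m) x (n + k)%N * A k j) / t); last first.
    by rewrite mulr_suml; apply: eq_bigr => k _; rewrite mulrAC.
  rewrite ler_pdivrMr // -subr_ge0 -(@skew_dual _ m n A b c j x lj); apply: XS.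
  by rewrite /N; lia.
- rewrite linE (_ : \sum_(i < m) _ = (\sum_(k < m) x (n + k)%N * b k) / t); last first.
    by rewrite mulr_suml; apply: eq_bigr => k _; rewrite mulrAC.
  rewrite ler_pM2r ?invr_gt0 // -subr_ge0 -(@skew_gap _ m n A b c x); apply: XS.
  by rewrite /N; lia.
Qed.
End Correctness.

(** * The optimal value function of the lower level *)

(** Distinct fractions with denominators at most [G] differ by a nonzero integer over a number of
    size at most [G * G]. *)
Lemma crossing_gap (G : nat) (d1 d2 n1 n2 : int) (t1 t2 : rat) :
  d1 != 0 -> d2 != 0 -> `|d1| <= G%:Z -> `|d2| <= G%:Z ->
  d1%:~R * t1 = n1%:~R -> d2%:~R * t2 = n2%:~R -> t1 < t2 ->
  1 <= (G * G)%N%:R * (t2 - t1).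
Proof.
move=> d10 d20 h1 h2 e1 e2 lt.
have dd : 0 < `|(d1 * d2)%:~R| :> rat by rewrite normr_gt0 rmorphM /= mulf_neq0 // intr_eq0.
have e : (d1 * d2)%:~R * (t2 - t1) = (d1 * n2 - d2 * n1)%:~R :> rat.
  by rewrite !(rmorphM, rmorphB) /= -e1 -e2; ring.
have ne : d1 * n2 - d2 * n1 != 0.
  apply/eqP => e0; move: e; rewrite e0 mulr0z => /eqP.
  by rewrite mulf_eq0 subr_eq0 (gt_eqF lt) orbF => /eqP e; move: dd; rewrite e normr0 ltxx.
have : 1 <= `|(d1 * d2)%:~R| * (t2 - t1).
  have -> : `|(d1 * d2)%:~R| * (t2 - t1) = `|(d1 * n2 - d2 * n1)%:~R|.
    by rewrite -e normrM [`|t2 - t1|]gtr0_norm ?subr_gt0.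
  by rewrite -intr_norm -[1]/(1%:~R) ler_int; lia.
move/le_trans; apply; rewrite ler_wpM2r ?subr_ge0 ?(ltW lt) //.
rewrite -intr_norm -[(G * G)%N%:R]/((G * G)%N%:Z%:~R) ler_int normrM PoszM.
by rewrite ler_pM.
Qed.

Section Search.
Variables (R : realFieldType) (n : nat) (c1 : nat -> rat) (feas : R -> (nat -> R) -> Prop).

Definition dotr (v : nat -> rat) (x : nat -> R) : R := \sum_(j < n) ratr (v j) * x j.
Definition dotq (v z : nat -> rat) : rat := \sum_(j < n) v j * z j.

Definition embed (z : nat -> rat) : nat -> R := fun j => ratr (z j).

Lemma dotr_embed v z : dotr v (embed z) = ratr (dotq v z).
Proof. by rewrite /dotq rmorph_sum; apply: eq_bigr => j _; rewrite rmorphM. Qed.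

Definition mix (mu : R) (x y : nat -> R) : nat -> R := fun j => (1 - mu) * x j + mu * y j.

Lemma dotr_mix v mu x y : dotr v (mix mu x y) = (1 - mu) * dotr v x + mu * dotr v y.
Proof.
rewrite /dotr !mulr_sumr -big_split /=; apply: eq_bigr => j _; rewrite /mix; ring.
Qed.

Hypothesis feas_mix : forall mu s t x y, 0 <= mu <= 1 -> feas s x -> feas t y ->
  feas ((1 - mu) * s + mu * t) (mix mu x y).

Definition optimal (t : R) (x : nat -> R) : Prop :=
  feas t x /\ forall x', feas t x' -> dotr c1 x <= dotr c1 x'.

Definition valid_line (f0 f1 : rat) : Prop :=
  forall t x, feas t x -> ratr f0 + ratr f1 * t <= dotr c1 x.

Definition value_at (p v : rat) : Prop :=
  (exists2 z, feas (ratr p) (embed z) & dotq c1 z = v) /\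
  forall x, feas (ratr p) x -> ratr v <= dotr c1 x.

(** A line below the value function that touches it at [p] and [q]; by convexity the function is
    affine in between. *)
Definition tight_pair (p vp q vq : rat) : Prop :=
  exists f0 f1, [/\ valid_line f0 f1, f0 + f1 * p = vp & f0 + f1 * q = vq].

Lemma piece_optimal p vp q vq (l : rat) z : tight_pair p vp q vq ->
  feas (ratr (p + l * (q - p))) (embed z) -> dotq c1 z <= vp + l * (vq - vp) ->
  optimal (ratr (p + l * (q - p))) (embed z).
Proof.
move=> [f0 [f1 [valid <- <-]]] fz le; split=> // x' fx'.
apply: le_trans (valid _ _ fx'); rewrite dotr_embed -rmorphM -rmorphD /= ler_rat.
by apply: le_trans le _; rewrite le_eqVlt; apply/orP; left; apply/eqP; ring.
Qed.

Lemma piece_upper p vp q vq (mu : R) x : value_at p vp -> value_at q vq -> 0 <= mu <= 1 ->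
  optimal (ratr p + mu * (ratr q - ratr p)) x ->
  dotr c1 x <= ratr vp + mu * (ratr vq - ratr vp).
Proof.
move=> [[zp fp ep] _] [[zq fq eq] _] hmu [fx ox].
have fm := feas_mix hmu fp fq.
have e : (1 - mu) * ratr p + mu * ratr q = ratr p + mu * (ratr q - ratr p) by ring.
rewrite e in fm; apply: le_trans (ox _ fm) _.
by rewrite dotr_mix !dotr_embed ep eq le_eqVlt; apply/orP; left; apply/eqP; ring.
Qed.

Lemma value_at_mix p vp q vq (l : rat) r vr : value_at p vp -> value_at q vq -> 0 <= l <= 1 ->
  r = p + l * (q - p) -> value_at r vr -> vr <= vp + l * (vq - vp).
Proof.
move=> [[zp fp ep] _] [[zq fq eq] _] /andP [l0 l1] er [_ ge].
have hl : 0 <= (ratr l : R) <= 1 by rewrite -[1](rmorph1 ratr) ler0q ler_rat l0.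
have fm := feas_mix hl fp fq.
have e : (1 - ratr l) * ratr p + ratr l * ratr q = ratr r :> R.
  by rewrite er !(rmorphD, rmorphM, rmorphB) /=; ring.
rewrite e in fm; have := ge _ fm; rewrite dotr_mix !dotr_embed ep eq.
rewrite -(ler_rat R) !(rmorphD, rmorphM, rmorphB) /= => h.
by apply: le_trans h _; rewrite le_eqVlt; apply/orP; left; apply/eqP; ring.
Qed.

Lemma valid_line_value f0 f1 p vp : valid_line f0 f1 -> value_at p vp -> f0 + f1 * p <= vp.
Proof.
move=> valid [[z fz ez] _]; have := valid _ _ fz.
by rewrite dotr_embed ez -rmorphM -rmorphD ler_rat.
Qed.

(* The lines come from basic dual solutions, which bounds their denominators;
   two consecutive breakpoints of the value function are crossings of such
   lines and hence cannot be too close. *)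
Variable G : nat.
Definition basic_line (al be de : int) : Prop :=
  [/\ 0 < de, `|be| <= G%:Z, `|de| <= G%:Z & valid_line (al%:~R / de%:~R) (- be%:~R / de%:~R)].

Definition has_basic_line (p vp : rat) : Prop :=
  exists al be de, basic_line al be de /\ al%:~R / de%:~R + - be%:~R / de%:~R * p = vp.

(** Clearing denominators in [f1 = f2] gives [d * r = nn] with [d = be1 * de2 - be2 * de1]. The
    disjunctions say that an end where [f1] is strictly larger is not the crossing. *)
Lemma line_crossing al1 be1 de1 al2 be2 de2 s t :
  basic_line al1 be1 de1 -> basic_line al2 be2 de2 -> s < t ->
  let f1 x := al1%:~R / de1%:~R + - be1%:~R / de1%:~R * x : rat in
  let f2 x := al2%:~R / de2%:~R + - be2%:~R / de2%:~R * x : rat in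
  (f1 s <= f2 s /\ f2 t < f1 t \/ f2 s < f1 s /\ f1 t <= f2 t) ->
  exists r (d nn : int), [/\ s <= r <= t, (r < t \/ f1 t <= f2 t), (s < r \/ f1 s <= f2 s) & [/\ d != 0,
    `|d| <= (2 * (G * G))%N%:Z & d%:~R * r = nn%:~R]].
Proof.
move=> [d1 b1 g1 _] [d2 b2 g2 _] st f1 f2 h.
pose d := be1 * de2 - be2 * de1; pose nn := al1 * de2 - al2 * de1.
have q1 : (de1%:~R : rat) != 0 by rewrite intr_eq0 gt_eqF.
have q2 : (de2%:~R : rat) != 0 by rewrite intr_eq0 gt_eqF.
pose k : rat := de1%:~R * de2%:~R; have k0 : 0 < k by rewrite mulr_gt0 ?ltr0z.
have diff x : k * (f1 x - f2 x) = nn%:~R - d%:~R * x.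
  rewrite /k /f1 /f2 /nn /d !(rmorphB, rmorphM) /=; field; by rewrite q1 q2.
have le12 x : (f1 x <= f2 x) = (nn%:~R <= d%:~R * x).
  by rewrite -subr_le0 -(pmulr_rle0 _ k0) diff subr_le0.
have lt21 x : (f2 x < f1 x) = (d%:~R * x < nn%:~R).
  by rewrite -subr_gt0 -(pmulr_rgt0 _ k0) diff subr_gt0.
have dn0 : d != 0.
  by apply/eqP => d0; move: h; rewrite !le12 !lt21 d0 !mul0r => -[[]|[]]; lra.
have dq0 : (d%:~R : rat) != 0 by rewrite intr_eq0.
exists (nn%:~R / d%:~R), d, nn; move: h; rewrite !le12 !lt21 => h.
have dbound : `|d| <= (2 * (G * G))%N%:Z.
  have : `|be1 * de2| <= G%:Z * G%:Z by rewrite normrM ler_pM.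
  have : `|be2 * de1| <= G%:Z * G%:Z by rewrite normrM ler_pM.
  by rewrite /d !PoszM; lia.
have er : d%:~R * (nn%:~R / d%:~R) = nn%:~R :> rat by rewrite mulrC divfK.
move: er; set r := _ / _ => er.
case: (ltrP 0 (d%:~R : rat)) => dpos.
  have cmp (x y : rat) : (d%:~R * x <= d%:~R * y) = (x <= y) by rewrite ler_pM2l.
  have cmp' (x y : rat) : (d%:~R * x < d%:~R * y) = (x < y) by rewrite ltr_pM2l.
  by move: h; rewrite -er !cmp !cmp' => h; split; first lra; [lra|lra|].
have dneg : d%:~R < 0 :> rat by rewrite lt_def eq_sym dq0.
have cmp (x y : rat) : (d%:~R * x <= d%:~R * y) = (y <= x) by rewrite ler_nM2l.
have cmp' (x y : rat) : (d%:~R * x < d%:~R * y) = (y < x) by rewrite ltr_nM2l.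
by move: h; rewrite -er !cmp !cmp' => h; split; first lra; [lra|lra|].
Qed.

Let G2 := (2 * (G * G))%N.

(* [q] minimizes the value function tilted by the slope of its chord over
   [[a, b]], so it is the only possible breakpoint there. *)
Lemma breakpoint_pieces a va b vb q vq : a <= b -> (G2 * G2)%N%:R * (b - a) < 1 ->
  (forall p, a <= p <= b -> exists2 vp, value_at p vp & has_basic_line p vp) ->
  value_at a va -> value_at b vb -> value_at q vq -> a <= q <= b ->
  (forall p vp, a <= p <= b -> value_at p vp ->
    (b - a) * vq - (vb - va) * q <= (b - a) * vp - (vb - va) * p) ->
  tight_pair a va q vq /\ tight_pair q vq b vb.
Proof.
move=> ab small lines Va Vb Vq hq minq.
have value_uniq p v w : value_at p v -> value_at p w -> v = w.
  move=> [[z fz ez] gz] [[z' fz' ez'] gz']; apply/eqP; rewrite eq_le.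
  have := gz _ fz'; have := gz' _ fz; rewrite !dotr_embed !ler_rat ez ez'.
  by move=> -> ->.
have [va' Va' [al1 [be1 [de1 [L1 e1]]]]] := lines a ltac:(by rewrite lexx).
have {va' Va' e1}e1 : al1%:~R / de1%:~R + - be1%:~R / de1%:~R * a = va by rewrite e1; apply: value_uniq Va' Va.
have [vb' Vb' [al2 [be2 [de2 [L2 e2]]]]] := lines b ltac:(by rewrite lexx andbT).
have {vb' Vb' e2}e2 : al2%:~R / de2%:~R + - be2%:~R / de2%:~R * b = vb by rewrite e2; apply: value_uniq Vb' Vb.
move: (L1) (L2) e1 e2 => [d1 _ _ ok1] [d2 _ _ ok2].
(* [f1] is tight at [a] and [f2] is tight at [b]. If one of them is tight at both ends, the value
   function is affine on the whole interval. *)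
pose f1 x : rat := al1%:~R / de1%:~R + - be1%:~R / de1%:~R * x.
pose f2 x : rat := al2%:~R / de2%:~R + - be2%:~R / de2%:~R * x.
rewrite -/(f1 a) -/(f2 b) => e1 e2.
have le1 p vp : value_at p vp -> f1 p <= vp by apply: valid_line_value.
have le2 p vp : value_at p vp -> f2 p <= vp by apply: valid_line_value.
have chord p vp : a <= p <= b -> value_at p vp -> (b - a) * vp <= (b - a) * va + (p - a) * (vb - va).
  move=> hp Vp; case: (ltrgtP a b) ab => // [ltab _|eab _]; last first.
    have ep : p = a by lra.
    by rewrite ep -eab !subrr !mul0r addr0.
  have ba : 0 < b - a by rewrite subr_gt0.
  have hl : 0 <= (p - a) / (b - a) <= 1.
    by rewrite divr_ge0 ?subr_ge0 ?ler_pdivrMr //=; lra.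
  have er : p = a + (p - a) / (b - a) * (b - a) by rewrite divfK ?gt_eqF //; ring.
  have := value_at_mix Va Vb hl er Vp; rewrite -(ler_pM2l ba) => /le_trans; apply.
  by rewrite le_eqVlt; apply/orP; left; apply/eqP; field; rewrite gt_eqF.
have pair1 p vp r vr : f1 p = vp -> f1 r = vr -> tight_pair p vp r vr.
  by move=> <- <-; exists (al1%:~R / de1%:~R), (- be1%:~R / de1%:~R).
have pair2 p vp r vr : f2 p = vp -> f2 r = vr -> tight_pair p vp r vr.
  by move=> <- <-; exists (al2%:~R / de2%:~R), (- be2%:~R / de2%:~R).
case: (ltrgtP a b) ab => // [ltab _|eab _]; last first.
  have eqa : q = a by lra.
  have vqa : vq = va by apply: value_uniq Vq _; rewrite eqa.
  have vba : vb = va by apply: value_uniq Vb _; rewrite -eab.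
  by rewrite eqa vqa -eab vba; split; apply: pair1.
have ba : 0 < b - a by rewrite subr_gt0.
have affine (f0 f : rat) p : (b - a) * (f0 + f * p) = (b - a) * (f0 + f * a) + (p - a) * ((f0 + f * b) - (f0 + f * a)) by ring.
case: (ltrgtP (f1 b) vb) (le1 _ _ Vb) => // [lt1 _|eq1 _]; last first.
  have e1q : f1 q = vq.
    apply/eqP; rewrite eq_le (le1 _ _ Vq) /= -(ler_pM2l ba) (affine _ _ q) -/(f1 a) -/(f1 b) e1 eq1.
    exact: chord.
  by split; apply: pair1.
case: (ltrgtP (f2 a) va) (le2 _ _ Va) => // [lt2 _|eq2 _]; last first.
  have e2q : f2 q = vq.
    apply/eqP; rewrite eq_le (le2 _ _ Vq) /= -(ler_pM2l ba) (affine _ _ q) -/(f2 a) -/(f2 b) e2 eq2.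
    exact: chord.
  by split; apply: pair2.
(* Otherwise the lines cross at [q0], which divides the interval in the ratio of these two gaps. *)
pose w1 := va - f2 a; pose w2 := vb - f1 b.
have w10 : 0 < w1 by rewrite subr_gt0.
have w20 : 0 < w2 by rewrite subr_gt0.
pose l := w1 / (w1 + w2).
have l01 : 0 < l < 1.
  by rewrite divr_gt0 ?(addr_gt0 w10 w20) //= /l (ltr_pdivrMr _ _ (addr_gt0 w10 w20)) mul1r ltrDl w20.
pose q0 := a + l * (b - a).
have aq0 : a < q0 < b by rewrite /q0; nra.
have cross : f1 q0 = f2 q0.
  have E f0 f : f0 + f * q0 = (1 - l) * (f0 + f * a) + l * (f0 + f * b) by rewrite /q0; ring.
  rewrite /f1 /f2 !E -!/(f1 _) -!/(f2 _) e1 e2.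
  have -> : f2 a = va - w1 by rewrite /w1; ring.
  have -> : f1 b = vb - w2 by rewrite /w2; ring.
  rewrite /l; field; by rewrite gt_eqF // addr_gt0.
have hq0 : a <= q0 <= b by case/andP: aq0 => /ltW -> /ltW ->.
have [v0 V0 [al [be [de [L e0]]]]] := lines q0 hq0.
pose f x : rat := al%:~R / de%:~R + - be%:~R / de%:~R * x.
rewrite -/(f q0) in e0; case: (L) => _ _ _ okf.
have lef p vp : value_at p vp -> f p <= vp by apply: valid_line_value.
(* If the value at [q0] were above the crossing, a basic line tight at [q0] would cross [f1] on its
   left and [f2] on its right, and these crossings would be closer than [crossing_gap] permits. *)
have top : f1 q0 = v0.
  apply/eqP; rewrite eq_le (le1 _ _ V0) /= leNgt; apply/negP => lt0.
  have [aq qb] := andP aq0.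
  have c1' : f1 q0 < f q0 by rewrite e0.
  have ha : f a <= f1 a by rewrite e1; apply: lef.
  have hb : f b <= f2 b by rewrite e2; apply: lef.
  have [r1 [dd1 [n1 [r1b r1t _ [z1 b1 x1]]]]] :=
    line_crossing L L1 aq (or_introl (conj ha c1')).
  have c2' : f2 q0 < f q0 by rewrite -cross.
  have [r2 [dd2 [n2 [r2b _ r2s [z2 b2 x2]]]]] :=
    line_crossing L L2 qb (or_intror (conj c2' hb)).
  have r1q : r1 < q0 by case: r1t => // h; move: (lt_le_trans c1' h); rewrite ltxx.
  have r2q : q0 < r2 by case: r2s => // h; move: (lt_le_trans c2' h); rewrite ltxx.
  have := crossing_gap z1 z2 b1 b2 x1 x2 (lt_trans r1q r2q); rewrite leNgt => /negP; apply.
  apply: le_lt_trans small; rewrite ler_wpM2l ?ler0n // lerB //; first by case/andP: r2b.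
  by case/andP: r1b.
have top2 : f2 q0 = v0 by rewrite -cross.
(* After the tilt [f1] strictly decreases and [f2] strictly increases, so the maximum of the two has
   its only minimum at [q0]. *)
have vq0 : q = q0.
  have := minq q0 v0 hq0 V0; rewrite -top.
  have A1 x : (b - a) * f1 x - (vb - va) * x = (b - a) * va - (vb - va) * a - (x - a) * w2.
    rewrite /w2 -e1 /f1; ring.
  have A2 x : (b - a) * f2 x - (vb - va) * x = (b - a) * vb - (vb - va) * b - (b - x) * w1.
    rewrite /w1 -e2 /f2; ring.
  have h1 := le1 _ _ Vq; have h2 := le2 _ _ Vq.
  have k1 : (b - a) * f1 q <= (b - a) * vq by rewrite ler_pM2l.
  have k2 : (b - a) * f2 q <= (b - a) * vq by rewrite ler_pM2l.
  have B1 := A1 q; have B2 := A2 q; have B3 := A1 q0; have B4 := A2 q0.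
  rewrite -cross in B4 => h.
  have i1 : (q0 - a) * w2 <= (q - a) * w2 by lra.
  have i2 : (b - q0) * w1 <= (b - q) * w1 by lra.
  move: i1 i2; rewrite !ler_pM2r // => i1 i2; lra.
have vq1 : vq = v0 by apply: value_uniq Vq _; rewrite vq0.
split; [apply: pair1 => //|apply: pair2 => //]; by rewrite vq0 vq1.
Qed.
End Search.

(** * The local search *)

(** The state stands for the window of the [2 ^ st.2] grid points from [st.1] on; the two points
    compared are the middle ones. *)
Definition search_step (phi : int -> rat) (st : int * nat) : int * nat :=
  let h := pow2 st.2.-1 in
  (if phi (st.1 + h - 1) <= phi (st.1 + h) then st.1 else st.1 + h, st.2.-1).

(** Either end of the window is no worse than its neighbour outside, or lies at the end of the grid.
    The comparison in the middle restores this for one half; in a window of one point both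
    conditions concern that point. *)
Lemma search_stepP phi K i : (i <= K)%N ->
  let st := iter i (search_step phi) (0, K) in
  let w := (2 ^ (K - i))%N%:Z in
  [/\ st.2 = (K - i)%N, 0 <= st.1, st.1 + w <= (2 ^ K)%N%:Z,
      st.1 = 0 \/ phi st.1 <= phi (st.1 - 1) &
      st.1 + w = (2 ^ K)%N%:Z \/ phi (st.1 + w - 1) <= phi (st.1 + w)].
Proof.
elim: i => [|i IH] ltK; first by rewrite /= subn0 add0r; split=> //; left.
move: (IH (ltnW ltK)) => /=; case: (iter _ _ _) => lo r /= [er lo0 hi left right].
have eK : (K - i = (K - i.+1).+1)%N by lia.
rewrite /search_step er eK /= pow2E; rewrite eK expnS in hi right.
have : 0 < (2 ^ (K - i.+1))%N%:Z by rewrite ltz_nat expn_gt0.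
move: hi right; rewrite PoszM; move: (2 ^ (K - i.+1))%N%:Z (2 ^ K)%N%:Z => w W hi right w0.
case: ifP => cmp /=; split=> //; try lia.
- by right; rewrite ltW // ltNge cmp.
- by have -> : lo + w + w = lo + 2%:Z * w by lia.
Qed.

Definition instance := (nat * nat * (seq rat * seq rat * rat) * (seq (seq rat) * seq rat * seq rat))%type.

Section Instance.
Variable D : instance.
Let n := D.1.1.1.
Let m := D.1.1.2.
Let c1 := D.1.2.1.1.
Let c2 := D.1.2.1.2.
Let c0 := D.1.2.2.
Let A := D.2.1.1.
Let h := D.2.1.2.
Let b := D.2.2.

(** After the [m] constraints come [n + 1] rows that bound every variable, including [l], by 1; the
    last row is [g]. *)
Definition sub_entry (pq : rat * rat) (g : seq rat) (i j : nat) : rat :=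
  if (i < m)%N then if (j < n)%N then qmget A i j else qget h i * (pq.2 - pq.1)
  else if (i <= m + n)%N then if (m + j == i)%N then -1 else 0
  else qget g j.

Definition sub_rhs (p gam : rat) (i : nat) : rat :=
  if (i < m)%N then qget b i - qget h i * p else if (i <= m + n)%N then -1 else gam.

(* The variables are [x1] and a number [l] in [0, 1]; the parameter is
   [x2 = p + l * (q - p)] and [g . (x1, l) >= gam] is an extra constraint. *)
Definition sub_program (pq : rat * rat) (r : seq rat * rat * seq rat) : program :=
  ((m + n).+2, n.+1, mkseq (fun i => mkseq (sub_entry pq r.1.1 i) n.+1) (m + n).+2,
   mkseq (sub_rhs pq.1 r.1.2) (m + n).+2, r.2).

Definition extend (v : nat -> rat) (a : rat) : seq rat :=
  mkseq (fun j => if (j < n)%N then v j else a) n.+1.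

(** With equal end points the parameter is constantly [p], and the empty list turns the extra
    constraint into [0 >= 0]. *)
Definition lower_value (p : rat) : rat :=
  if lp_solve (sub_program (p, p) ([::], 0, extend (qget c1) 0)) is Some x then
    sumq n (fun j => qget c1 j * qget x j) else 0.

Definition objective (s : seq rat * rat) : rat :=
  sumq n (fun j => qget c2 j * qget s.1 j) + c0 * s.2.

(** The extra constraint is [c1 . x <= v(p) + l (v(q) - v(p))] with opposite signs: optimality for
    the lower level if v is affine between [p] and [q]. *)
Definition candidate (pq : rat * rat) : seq rat * rat :=
  if lp_solve (sub_program pq
      (extend (fun j => - qget c1 j) (lower_value pq.2 - lower_value pq.1), - lower_value pq.1,
       extend (qget c2) (c0 * (pq.2 - pq.1)))) is Some x
  then (mkseq (qget x) n, pq.1 + qget x n * (pq.2 - pq.1)) else ([::], 0).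

(** Minimizing [c1 . x + (v(a) - v(b)) l] over all [x] and [l] minimizes v minus its chord. *)
Definition split_point (ab : rat * rat) : rat :=
  if lp_solve (sub_program ab
      ([::], 0, extend (qget c1) (lower_value ab.1 - lower_value ab.2))) is Some x
  then ab.1 + qget x n * (ab.2 - ab.1) else 0.

Definition common_denom : int :=
  prodz m (fun i => prodz n (fun j => denq (qmget A i j))) *
  (prodz m (fun i => denq (qget h i) * denq (qget b i)) * prodz n (fun j => denq (qget c1 j))).

Definition integral_data : seq (seq int) :=
  let Q := common_denom in
  (Q :: mkseq (fun i => clear_denq Q (qget h i)) m) ::
  (mkseq (fun j => clear_denq Q (qget c1 j)) n ::
   mkseq (fun i => mkseq (fun j => clear_denq Q (qmget A i j)) n) m).

Definition line_bits : nat :=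
  let k := (m + (n + n.+1))%N in
  let be := matrix_bits integral_data in (m + k * (k + be) + be)%N.

(** With [G = 2 ^ line_bits] the grid has [32 G^4] points in an interval of length at most 1, so two
    cells together are shorter than [1 / (4 G^4)], the least distance between distinct crossings of
    basic lines. *)
Definition grid_bits : nat := (4 * line_bits + 5)%N.

Definition grid_point (lu : rat * rat) (i : int) : rat :=
  lu.1 + (lu.2 - lu.1) * mkrat i (pow2 grid_bits - 1).

Definition grid_value (lu : rat * rat) (i : int) : rat :=
  objective (candidate (grid_point lu i, grid_point lu i)).

Definition grid_minimum (lu : rat * rat) : int :=
  (iter grid_bits (search_step (grid_value lu)) (0, grid_bits)).1.

Definition better (s t : seq rat * rat) : seq rat * rat :=
  if objective s < objective t then s else t.

Definition refine_grid (lu : rat * rat) (i : int) : seq rat * rat :=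
  let a := grid_point lu (if i == 0 then 0 else i - 1) in
  let b := grid_point lu (if i == pow2 grid_bits - 1 then i else i + 1) in
  let q := split_point (a, b) in
  better (better (candidate (a, q)) (candidate (q, b)))
    (candidate (grid_point lu i, grid_point lu i)).

(** Between 0 and 1 the variable [l] is the parameter itself; the sign of [s] selects its least or
    greatest feasible value. *)
Definition extreme_point (s : rat) : option (seq rat) :=
  lp_solve (sub_program (0, 1) ([::], 0, extend (fun=> 0) s)).

Definition bilevel_solve : option (seq rat * rat) :=
  if extreme_point 1 is Some x then
    if extreme_point (-1) is Some y then
      Some (refine_grid (qget x n, qget y n) (grid_minimum (qget x n, qget y n)))
    else None
  else None.
End Instance.

Lemma PT_sub_entry : PT (fun p : instance * ((rat * rat) * seq rat) * (nat * nat) =>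
  sub_entry p.1.1 p.1.2.1 p.1.2.2 p.2.1 p.2.2).
Proof. by rewrite /sub_entry; pt. Qed.

Lemma PT_sub_rhs : PT (fun p : instance * (rat * rat) * nat => sub_rhs p.1.1 p.1.2.1 p.1.2.2 p.2).
Proof. by rewrite /sub_rhs; pt. Qed.

Lemma PT_sub_program : PT (fun p : instance * (rat * rat) * (seq rat * rat * seq rat) =>
  sub_program p.1.1 p.1.2 p.2).
Proof.
rewrite /sub_program; apply: PT_pair; last by pt.
apply: PT_pair; last first.
  apply: PT_mkseq; last by pt.
  by apply: (PT_comp (f := fun p => (p.1.1.1, (p.1.1.2.1, p.1.2.1.2), p.2)) PT_sub_rhs); pt.
apply: PT_pair; first by pt.
apply: PT_mkseq; last by pt.
apply: PT_mkseq; last by pt.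
by apply: (PT_comp (f := fun p => (p.1.1.1.1, (p.1.1.1.2, p.1.1.2.1.1), (p.1.2, p.2))) PT_sub_entry); pt.
Qed.

#[export] Hint Resolve PT_sub_program : polytime.

Lemma PT_lower_value : PT (fun p : instance * rat => lower_value p.1 p.2).
Proof.
rewrite /lower_value /extend; apply: (PT_option_case
  (g := fun p x => sumq p.1.1.1.1 (fun j => qget p.1.1.2.1.1 j * qget x j))); pt.
Qed.

#[export] Hint Resolve PT_lower_value : polytime.

Lemma PT_objective : PT (fun p : instance * (seq rat * rat) => objective p.1 p.2).
Proof. by rewrite /objective; pt. Qed.

#[export] Hint Resolve PT_objective : polytime.

Lemma PT_candidate : PT (fun p : instance * (rat * rat) => candidate p.1 p.2).
Proof.
rewrite /candidate /extend; apply: (PT_option_case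
  (g := fun p x => (mkseq (qget x) p.1.1.1.1, p.2.1 + qget x p.1.1.1.1 * (p.2.2 - p.2.1)))); pt.
Qed.

Lemma PT_split_point : PT (fun p : instance * (rat * rat) => split_point p.1 p.2).
Proof.
rewrite /split_point /extend; apply: (PT_option_case
  (g := fun p x => p.2.1 + qget x p.1.1.1.1 * (p.2.2 - p.2.1))); pt.
Qed.

#[export] Hint Resolve PT_candidate PT_split_point : polytime.

Lemma PT_common_denom : PT common_denom.
Proof. by rewrite /common_denom; pt. Qed.

#[export] Hint Resolve PT_common_denom : polytime.

Lemma PT_integral_data : PT integral_data.
Proof. by rewrite /integral_data; cbv zeta; pt. Qed.

#[export] Hint Resolve PT_integral_data : polytime.

Lemma PT_grid_bits : PT grid_bits.
Proof. by rewrite /grid_bits /line_bits; cbv zeta; pt. Qed.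

#[export] Hint Resolve PT_grid_bits : polytime.

Lemma PT_grid_point : PT (fun p : instance * (rat * rat) * int => grid_point p.1.1 p.1.2 p.2).
Proof. by rewrite /grid_point; pt. Qed.

#[export] Hint Resolve PT_grid_point : polytime.

Lemma PT_grid_value : PT (fun p : instance * (rat * rat) * int => grid_value p.1.1 p.1.2 p.2).
Proof. by rewrite /grid_value; pt. Qed.

#[export] Hint Resolve PT_grid_value : polytime.

Lemma PT_grid_minimum : PT (fun p : instance * (rat * rat) => grid_minimum p.1 p.2).
Proof.
rewrite /grid_minimum; apply: PT_fst.
apply: (@PT_iter _ _ _ _ (fun p => grid_bits p.1) (fun p => search_step (grid_value p.1 p.2))
  (fun p => (0, grid_bits p.1)) (fun p => (4 * (sz (grid_bits p.1)).+1 + 6 + sz (grid_bits p.1) + 5)%N)).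
- by pt.
- by pt.
- by rewrite /search_step; cbv zeta; pt.
- by pb; pt.
move=> p i le; have [] := search_stepP (grid_value p.1 p.2) le.
case: (iter _ _ _) => lo r /= -> lo0 hi _ _.
have hs : (sz (grid_bits p.1 - i)%N <= sz (grid_bits p.1))%N by rewrite !sz_nat; lia.
have : (sz lo <= 4 * (sz (grid_bits p.1)).+1 + 6)%N.
  apply: sz_int; apply: (@leq_ltn_trans (2 ^ grid_bits p.1)).
    by rewrite -lez_nat abszE ger0_norm //; apply: le_trans hi; rewrite lerDl.
  by rewrite ltn_exp2l // sz_nat; lia.
by rewrite sz_pair; lia.
Qed.

#[export] Hint Resolve PT_grid_minimum : polytime.

Lemma PT_better : PT (fun p : instance * (seq rat * rat) * (seq rat * rat) => better p.1.1 p.1.2 p.2).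
Proof. by rewrite /better; pt. Qed.

#[export] Hint Resolve PT_better : polytime.

Lemma PT_refine_grid : PT (fun p : instance * (rat * rat) * int => refine_grid p.1.1 p.1.2 p.2).
Proof. by rewrite /refine_grid; cbv zeta; pt. Qed.

#[export] Hint Resolve PT_refine_grid : polytime.

Lemma PT_extreme_point : PT (fun p : instance * rat => extreme_point p.1 p.2).
Proof. by rewrite /extreme_point /extend; pt. Qed.

#[export] Hint Resolve PT_extreme_point : polytime.

Lemma PT_bilevel_solve : PT bilevel_solve.
Proof.
rewrite /bilevel_solve; apply: (PT_option_case (o := fun D => extreme_point D 1)
  (g := fun D x => if extreme_point D (-1) is Some y then
     Some (refine_grid D (qget x D.1.1.1, qget y D.1.1.1) (grid_minimum D (qget x D.1.1.1, qget y D.1.1.1)))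
     else None)); [pt| |pt].
apply: (PT_option_case (o := fun p => extreme_point p.1 (-1))
  (g := fun p y => Some (refine_grid p.1 (qget p.2 p.1.1.1.1, qget y p.1.1.1.1)
     (grid_minimum p.1 (qget p.2 p.1.1.1.1, qget y p.1.1.1.1))))); pt.
Qed.

#[export] Hint Resolve PT_bilevel_solve : polytime.

(** * Correctness of the linear programs over a segment of parameters *)

Lemma lin_ratr (R : realFieldType) n (a x : nat -> rat) :
  lin n (fun j => ratr (a j)) (embed R x) = ratr (lin n a x).
Proof. by rewrite /lin rmorph_sum; apply: eq_bigr => j _; rewrite rmorphM. Qed.

(** The rational dual solution, or the rational certificate of infeasibility, stays valid over [R],
    where weak duality applies to real competitors. *)
Lemma lp_solve_real (R : realFieldType) (P : program) :
  let m := P.1.1.1.1 in let n := P.1.1.1.2 in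
  let A i j := ratr (qmget P.1.1.2 i j) : R in let b i := ratr (qget P.1.2 i) : R in
  bounded_program m n (qmget P.1.1.2) ->
  if lp_solve P is Some x then
    [/\ size x = n, primal m n A b (embed R (qget x)) &
      forall x', primal m n A b x' -> ratr (lin n (qget P.2) (qget x)) <= lin n (fun j => ratr (qget P.2 j)) x']
  else forall x', ~ primal m n A b x'.
Proof.
move=> m n A b /lp_solveP; case: lp_solve => [x|].
  move=> [sx [y [[x0 hx] [y0 hy] gap]]]; split=> //.
    split=> [j lj|i li]; first by rewrite /embed ler0q x0.
    by rewrite lin_ratr ler_rat hx.
  move=> x' px'; apply: le_trans (_ : ratr (\sum_(i < m) y i * qget P.1.2 i) <= _).
    by rewrite ler_rat.
  have dy : dual m n A (fun j => ratr (qget P.2 j)) (embed R y).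
    split=> [i li|j lj]; first by rewrite /embed ler0q y0.
    rewrite (_ : \sum_(i < m) _ = ratr (\sum_(i < m) y i * qmget P.1.1.2 i j)) ?ler_rat ?hy //.
    by rewrite rmorph_sum; apply: eq_bigr => i _; rewrite rmorphM.
  apply: le_trans (lp_weak_duality px' dy); rewrite le_eqVlt; apply/orP; left; apply/eqP.
  by rewrite rmorph_sum; apply: eq_bigr => i _; rewrite rmorphM.
move=> [u [u0 hu ub]] x'; apply: (@infeasible_primal _ _ _ _ _ (embed R u)); split.
- by move=> i li; rewrite /embed ler0q u0.
- move=> j lj; rewrite (_ : \sum_(i < m) _ = ratr (\sum_(i < m) u i * qmget P.1.1.2 i j)) ?lerq0 ?hu //.
  by rewrite rmorph_sum; apply: eq_bigr => i _; rewrite rmorphM.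
rewrite (_ : \sum_(i < m) _ = ratr (\sum_(i < m) u i * qget P.1.2 i)) ?ltr0q //.
by rewrite rmorph_sum; apply: eq_bigr => i _; rewrite rmorphM.
Qed.

Section Instance.
Variables (R : realFieldType) (D : instance).
Let n := D.1.1.1.
Let m := D.1.1.2.
Let c1 := D.1.2.1.1.
Let c2 := D.1.2.1.2.
Let c0 := D.1.2.2.
Let A := D.2.1.1.
Let h := D.2.1.2.
Let b := D.2.2.

Definition rfeas (t : R) (x : nat -> R) : Prop :=
  [/\ forall i, (i < m)%N -> ratr (qget b i) <= dotr n (qmget A i) x + ratr (qget h i) * t,
      forall j, (j < n)%N -> 0 <= x j <= 1 & 0 <= t <= 1].

Lemma rfeas_eq t x x' : (forall j, (j < n)%N -> x j = x' j) -> rfeas t x -> rfeas t x'.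
Proof.
move=> e [h1 h2 h3]; split=> // [i li|j lj]; last by rewrite -e ?h2.
rewrite (_ : dotr n _ x' = dotr n (qmget A i) x) ?h1 //.
by apply: eq_bigr => j _; rewrite e.
Qed.

Lemma rfeas_mix mu s t x y : 0 <= mu <= 1 -> rfeas s x -> rfeas t y ->
  rfeas ((1 - mu) * s + mu * t) (mix mu x y).
Proof.
move=> /andP [mu0 mu1] [x1 x2 x3] [y1 y2 y3].
have nu0 : 0 <= 1 - mu by rewrite subr_ge0.
have conv (u v : R) : 0 <= u <= 1 -> 0 <= v <= 1 -> 0 <= (1 - mu) * u + mu * v <= 1.
  by move=> /andP [u0 u1] /andP [v0 v1]; nra.
split=> [i li|j lj|]; [|by apply: conv; auto|by apply: conv].
have hx := ler_wpM2l nu0 (x1 i li); have hy := ler_wpM2l mu0 (y1 i li).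
rewrite dotr_mix; move: hx hy.
set B := ratr (qget b i); set X := dotr _ _ x; set Y := dotr _ _ y; set H := ratr (qget h i).
move=> hx hy; have -> : B = (1 - mu) * B + mu * B by ring.
have -> : (1 - mu) * X + mu * Y + H * ((1 - mu) * s + mu * t) =
  (1 - mu) * (X + H * s) + mu * (Y + H * t) by ring.
exact: lerD.
Qed.

Section SubProgram.
Variables (pq : rat * rat) (g : seq rat) (gam : rat) (o : seq rat).
Let P := sub_program D pq (g, gam, o).

Lemma sub_entryE i j : (i < (m + n).+2)%N -> (j < n.+1)%N -> qmget P.1.1.2 i j = sub_entry D pq g i j.
Proof. by move=> li lj; rewrite /qmget /qget /= nth_mkseq // nth_mkseq. Qed.

Lemma sub_rhsE i : (i < (m + n).+2)%N -> qget P.1.2 i = sub_rhs D pq.1 gam i.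
Proof. by move=> li; rewrite /qget /= nth_mkseq. Qed.

Lemma box_sum (F : comNzRingType) (x : nat -> F) (a : nat -> rat) (f : rat -> F) i :
  (forall j, a j = if (m + j == i)%N then -1 else 0) -> f (-1) = -1 -> f 0 = 0 ->
  (m <= i <= m + n)%N -> \sum_(j < n.+1) f (a j) * x j = - x (i - m)%N.
Proof.
move=> ea f1 f0 /andP [mi ilt]; have lt : (i - m < n.+1)%N by rewrite ltnS leq_subLR.
rewrite (bigD1 (Ordinal lt)) //= ea subnKC // eqxx f1 mulN1r big1 ?addr0 // => j nej.
rewrite ea; case: eqP => [e|_]; last by rewrite f0 mul0r.
by case/eqP: nej; apply: val_inj; rewrite /= -e addKn.
Qed.

(** The upper bound rows force [- w j >= 0] on a recession direction. *)
Lemma sub_bounded : bounded_program P.1.1.1.1 P.1.1.1.2 (qmget P.1.1.2).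
Proof.
move=> w w0 hw j lj; apply/eqP; rewrite eq_le w0 // andbT -oppr_ge0.
have li : (m + j < (m + n).+2)%N by move: lj; rewrite /=; lia.
have := hw _ li; rewrite /lin.
under eq_bigr => k _ do rewrite sub_entryE //.
have -> : \sum_(k < n.+1) sub_entry D pq g (m + j) k * w k = - w (m + j - m)%N.
  apply: (@box_sum rat w (sub_entry D pq g (m + j)) (fun z => z)) => //; last first.
    by rewrite leq_addr leq_add2l -ltnS.
  by move=> k; rewrite /sub_entry -/m -/n ltnNge leq_addr /= leq_add2l -ltnS lj.
by rewrite addKn.
Qed.

Lemma sub_row (x : nat -> R) i : (i < (m + n).+2)%N ->
  lin n.+1 (fun j => ratr (qmget P.1.1.2 i j)) x =
  if (i < m)%N then dotr n (qmget A i) x + ratr (qget h i) * (x n * (ratr pq.2 - ratr pq.1))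
  else if (i <= m + n)%N then - x (i - m)%N else dotr n.+1 (qget g) x.
Proof.
move=> li; rewrite /lin /dotr; under eq_bigr => k _ do rewrite sub_entryE //.
case: (ltnP i m) => lim.
  rewrite big_ord_recr /= /sub_entry -/m -/n lim ltnn !(rmorphM, rmorphB) /=; congr (_ + _); last by ring.
  by apply: eq_bigr => j _; rewrite ltn_ord.
case: (leqP i (m + n)) => lin.
  apply: (@box_sum R x (sub_entry D pq g i) ratr); rewrite ?lim ?lin ?rmorphN1 ?rmorph0 // => j.
  by rewrite /sub_entry -/m -/n ltnNge lim lin.
by apply: eq_bigr => j _; rewrite /sub_entry -/m -/n (leq_gtF lim) (ltn_geF lin).
Qed.

Lemma sub_programP (x : nat -> R) : 0 <= pq.1 <= 1 -> 0 <= pq.2 <= 1 ->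
  primal P.1.1.1.1 P.1.1.1.2 (fun i j => ratr (qmget P.1.1.2 i j)) (fun i => ratr (qget P.1.2 i)) x <->
  [/\ rfeas (ratr pq.1 + x n * (ratr pq.2 - ratr pq.1)) x, 0 <= x n <= 1 & ratr gam <= dotr n.+1 (qget g) x].
Proof.
move=> hp hq; rewrite /primal /=; split=> [[x0 rows]|[[f1 f2 f3] xn gx]].
  have box j : (j < n.+1)%N -> 0 <= x j <= 1.
    move=> lj; rewrite x0 //=; have li : (m + j < (m + n).+2)%N by lia.
    have := rows _ li; rewrite sub_row // sub_rhsE // /sub_rhs -/m -/n ltnNge leq_addr /=.
    by rewrite leq_add2l -ltnS lj rmorphN1 addKn lerN2.
  split; last first.
  - have := rows (m + n).+1 (ltnSn _); rewrite sub_row // sub_rhsE // /sub_rhs -/m -/n.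
    by rewrite ltnNge ltnW ?ltnS ?leq_addr //= ltnn.
  - exact: box.
  split=> [i li|j lj|]; last 1 first.
  - have /andP [l0 l1] := box n (ltnSn _); move: hp hq => /andP [p0 p1] /andP [q0 q1].
    have P0 : 0 <= (ratr pq.1 : R) by rewrite ler0q.
    have P1 : (ratr pq.1 : R) <= 1 by rewrite -[1](rmorph1 ratr) ler_rat.
    have Q0 : 0 <= (ratr pq.2 : R) by rewrite ler0q.
    have Q1 : (ratr pq.2 : R) <= 1 by rewrite -[1](rmorph1 ratr) ler_rat.
    by nra.
  - have li' : (i < (m + n).+2)%N by lia.
    have := rows i li'; rewrite sub_row // sub_rhsE // /sub_rhs -/m -/n li.
    by rewrite rmorphB rmorphM /= lerBlDr => /le_trans; apply; rewrite le_eqVlt; apply/orP; left; apply/eqP; ring.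
  - by apply: box; lia.
split=> [j|i li].
  by rewrite ltnS leq_eqVlt => /orP [/eqP ->|/f2 /andP []] //; case/andP: xn.
rewrite sub_row // sub_rhsE // /sub_rhs -/m -/n; case: (ltnP i m) => lim.
  rewrite rmorphB rmorphM /= lerBlDr; apply: le_trans (f1 i lim) _.
  by rewrite le_eqVlt; apply/orP; left; apply/eqP; ring.
case: (leqP i (m + n)) => lin //.
rewrite rmorphN1 lerN2; have : (i - m <= n)%N by lia.
by rewrite leq_eqVlt => /orP [/eqP ->|/f2]; [case/andP: xn|case/andP].
Qed.

Lemma sub_solve : 0 <= pq.1 <= 1 -> 0 <= pq.2 <= 1 ->
  if lp_solve P is Some x then
    [/\ size x = n.+1, rfeas (ratr (pq.1 + qget x n * (pq.2 - pq.1))) (embed R (qget x)),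
      0 <= qget x n <= 1, gam <= dotq n.+1 (qget g) (qget x) &
      forall (l : R) y, 0 <= l <= 1 -> rfeas (ratr pq.1 + l * (ratr pq.2 - ratr pq.1)) y ->
        ratr gam <= dotr n (qget g) y + ratr (qget g n) * l ->
        ratr (dotq n.+1 (qget o) (qget x)) <= dotr n (qget o) y + ratr (qget o n) * l]
  else forall (l : R) y, 0 <= l <= 1 -> rfeas (ratr pq.1 + l * (ratr pq.2 - ratr pq.1)) y ->
        ~ (ratr gam <= dotr n (qget g) y + ratr (qget g n) * l).
Proof.
move=> hp hq; have := @lp_solve_real R P sub_bounded.
pose ext (l : R) (y : nat -> R) j := if (j < n)%N then y j else l.
have extn l y : ext l y n = l by rewrite /ext ltnn.
have dot_ext v l y : dotr n.+1 v (ext l y) = dotr n v y + ratr (v n) * l.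
  by rewrite /dotr big_ord_recr /= extn; congr (_ + _); apply: eq_bigr => j _; rewrite /ext ltn_ord.
have toP l y : 0 <= l <= 1 -> rfeas (ratr pq.1 + l * (ratr pq.2 - ratr pq.1)) y ->
    ratr gam <= dotr n (qget g) y + ratr (qget g n) * l ->
    primal P.1.1.1.1 P.1.1.1.2 (fun i j => ratr (qmget P.1.1.2 i j)) (fun i => ratr (qget P.1.2 i)) (ext l y).
  move=> hl fy gy; apply/sub_programP => //; rewrite extn dot_ext; split=> //.
  by apply: rfeas_eq fy => j lj; rewrite /ext lj.
case: lp_solve => [x [sx px opt]|none].
  case/sub_programP: (px) => // fx xn gx; split=> //.
  - rewrite (_ : ratr _ = ratr pq.1 + embed R (qget x) n * (ratr pq.2 - ratr pq.1)) //.
    by rewrite /embed rmorphD rmorphM rmorphB.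
  - by move: xn; rewrite /embed ler0q -[1](rmorph1 ratr) ler_rat.
  - by move: gx; rewrite dotr_embed ler_rat.
  by move=> l y hl fy gy; have := opt _ (toP l y hl fy gy); rewrite -dot_ext.
by move=> l y hl fy gy; apply: none (toP l y hl fy gy).
Qed.
End SubProgram.

Lemma qget_extend v a j : (j < n.+1)%N -> qget (extend D v a) j = if (j < n)%N then v j else a.
Proof. by move=> lj; rewrite /qget nth_mkseq. Qed.

Lemma dotq_extend v a x : dotq n.+1 (qget (extend D v a)) x = dotq n v x + a * x n.
Proof.
rewrite /dotq big_ord_recr /= qget_extend // ltnn; congr (_ + _).
by apply: eq_bigr => j _; rewrite qget_extend ?ltn_ord // ltnW // ltnS.
Qed.

Lemma dotr_extend v a (x : nat -> R) : dotr n (qget (extend D v a)) x = dotr n v x.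
Proof. by apply: eq_bigr => j _; rewrite qget_extend ?ltn_ord // ltnW // ltnS. Qed.

Lemma extend_last v a : qget (extend D v a) n = a.
Proof. by rewrite qget_extend ?ltnn. Qed.

Lemma no_constraint (l : R) y : ratr 0 <= dotr n (qget [::]) y + ratr (qget [::] n) * l :> R.
Proof.
rewrite rmorph0 /qget nth_nil rmorph0 mul0r addr0 /dotr big1 // => j _.
by rewrite nth_nil rmorph0 mul0r.
Qed.

Lemma lower_valueP p x0 : 0 <= p <= 1 -> rfeas (ratr p) x0 -> value_at n (qget c1) rfeas p (lower_value D p).
Proof.
move=> hp f0; rewrite /lower_value.
have hl : 0 <= (0 : R) <= 1 by rewrite lexx ler01.
have := @sub_solve (p, p) [::] 0 (extend D (qget c1) 0) hp hp; case: lp_solve => [x|].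
  rewrite /= !subrr mulr0 addr0 => -[sx fx xn _ opt]; rewrite sumqE -/n -/c1; split.
    by exists (qget x).
  move=> y fy; have fy' : rfeas (ratr p + 0 * 0) y by rewrite mulr0 addr0.
  have := opt 0 y hl fy' (no_constraint _ _).
  by rewrite dotr_extend extend_last mulr0 addr0 dotq_extend mul0r addr0.
move=> none; case: (none 0 x0 hl _ (no_constraint _ _)).
by rewrite /= subrr mul0r addr0.
Qed.
End Instance.

(** * Basic dual solutions and the lines below the value function *)

Lemma sum_dual_blocks (F : nmodType) m n (f : nat -> F) : \sum_(k < m + (n + n.+1)) f k =
  \sum_(i < m) f i + (\sum_(j < n) f (m + j)%N + (\sum_(j < n) f (m + (n + j))%N + f (m + (n + n))%N)).
Proof. by rewrite big_split_ord /= big_split_ord /= big_ord_recr. Qed.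

Section Instance.
Variables (R : realFieldType) (D : instance).
Let n := D.1.1.1.
Let m := D.1.1.2.
Let c1 := D.1.2.1.1.
Let A := D.2.1.1.
Let h := D.2.1.2.
Let b := D.2.2.
Let Q := common_denom D.
Let k := (m + (n + n.+1))%N.

Lemma common_denom_gt0 : 0 < Q.
Proof. by rewrite /Q /common_denom !mulr_gt0 ?prodz_gt0 // => i; rewrite ?mulr_gt0 ?prodz_gt0 ?denq_gt0. Qed.

Lemma clear_A i j : (i < m)%N -> (j < n)%N -> (clear_denq Q (qmget A i j))%:~R = qmget A i j * Q%:~R.
Proof.
move=> li lj; apply: clear_denqE; apply: dvdz_mulr.
apply: dvdz_trans (prodz_dvd (fun i => prodz n (fun j => denq (qmget A i j))) li).
exact: (prodz_dvd (fun j => denq (qmget A i j)) lj).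
Qed.

Lemma clear_h i : (i < m)%N -> (clear_denq Q (qget h i))%:~R = qget h i * Q%:~R.
Proof.
move=> li; apply: clear_denqE; apply: dvdz_mull; apply: dvdz_mulr.
by apply: dvdz_trans (prodz_dvd (fun i => denq (qget h i) * denq (qget b i)) li); apply: dvdz_mulr.
Qed.

Lemma clear_b i : (i < m)%N -> (clear_denq Q (qget b i))%:~R = qget b i * Q%:~R.
Proof.
move=> li; apply: clear_denqE; apply: dvdz_mull; apply: dvdz_mulr.
by apply: dvdz_trans (prodz_dvd (fun i => denq (qget h i) * denq (qget b i)) li); apply: dvdz_mull.
Qed.

Lemma clear_c j : (j < n)%N -> (clear_denq Q (qget c1 j))%:~R = qget c1 j * Q%:~R.
Proof.
move=> lj; apply: clear_denqE; apply: dvdz_mull; apply: dvdz_mull.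
exact: (prodz_dvd (fun j => denq (qget c1 j)) lj).
Qed.

(* The dual constraints of the lower level, with slack variables and
   homogenized: the unknowns are the multipliers of the rows, those of the
   bounds [x <= 1], the slacks and the homogenizing variable. *)
Definition dual_entry (j l : nat) : int :=
  if (l < m)%N then clear_denq Q (qmget A l j)
  else if (l - m < n)%N then if (l - m == j)%N then - Q else 0
  else if (l - m - n < n)%N then if (l - m - n == j)%N then Q else 0
  else - clear_denq Q (qget c1 j).

Definition dual_kernel (z : nat -> rat) : Prop := forall j, (j < n)%N ->
  \sum_(i < m) qmget A i j * z i - z (m + j)%N + z (m + (n + j))%N = qget c1 j * z (m + (n + n))%N.

Lemma block1 j : ((m + j < m)%N = false) * ((m + j - m)%N = j).
Proof. by rewrite ltnNge leq_addr addKn. Qed.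

Lemma block2 j : ((n + j < n)%N = false) * ((n + j - n)%N = j).
Proof. by rewrite ltnNge leq_addr addKn. Qed.

Lemma pick_term (F : pzRingType) (a : F) (f : nat -> F) j : (j < n)%N ->
  \sum_(l < n) (if (l == j :> nat)%N then a else 0) * f l = a * f j.
Proof.
move=> lj; rewrite (bigD1 (Ordinal lj)) //= eqxx big1 ?addr0 // => l nel.
by case: eqP => [e|_]; [case/eqP: nel; apply: val_inj|rewrite mul0r].
Qed.

Lemma dual_entry_sum (z : nat -> rat) j : (j < n)%N -> \sum_(l < k) (dual_entry j l)%:~R * z l =
  Q%:~R * (\sum_(i < m) qmget A i j * z i - z (m + j)%N + z (m + (n + j))%N - qget c1 j * z (m + (n + n))%N).
Proof.
move=> lj; rewrite (sum_dual_blocks m n (fun l => (dual_entry j l)%:~R * z l)) /dual_entry.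
have -> : \sum_(i < m) (if (i < m)%N then clear_denq Q (qmget A i j)
    else if (i - m < n)%N then if (i - m == j)%N then - Q else 0
    else if (i - m - n < n)%N then if (i - m - n == j)%N then Q else 0
    else - clear_denq Q (qget c1 j))%:~R * z i = Q%:~R * \sum_(i < m) qmget A i j * z i.
  by rewrite mulr_sumr; apply: eq_bigr => i _; rewrite ltn_ord clear_A //; ring.
have -> : \sum_(j0 < n) (if (m + j0 < m)%N then clear_denq Q (qmget A (m + j0) j)
    else if (m + j0 - m < n)%N then if (m + j0 - m == j)%N then - Q else 0
    else if (m + j0 - m - n < n)%N then if (m + j0 - m - n == j)%N then Q else 0
    else - clear_denq Q (qget c1 j))%:~R * z (m + j0)%N = - Q%:~R * z (m + j)%N.
  rewrite -(pick_term (- Q%:~R) (fun l => z (m + l)%N) lj); apply: eq_bigr => l _.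
  by rewrite !block1 ltn_ord; case: eqP => _; rewrite ?rmorphN ?rmorph0.
have -> : \sum_(j0 < n) (if (m + (n + j0) < m)%N then clear_denq Q (qmget A (m + (n + j0)) j)
    else if (m + (n + j0) - m < n)%N then if (m + (n + j0) - m == j)%N then - Q else 0
    else if (m + (n + j0) - m - n < n)%N then if (m + (n + j0) - m - n == j)%N then Q else 0
    else - clear_denq Q (qget c1 j))%:~R * z (m + (n + j0))%N = Q%:~R * z (m + (n + j))%N.
  rewrite -(pick_term Q%:~R (fun l => z (m + (n + l))%N) lj); apply: eq_bigr => l _.
  by rewrite !block1 !block2 ltn_ord; case: eqP => _; rewrite ?rmorph0.
by rewrite !block1 !block2 ltnn rmorphN /= clear_c //; ring.
Qed.

Definition dual_matrix : 'M[int]_(n, k) := \matrix_(j, l) dual_entry j l.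

Lemma dual_matrixP (z : nat -> rat) : map_mx intr dual_matrix *m (\col_l z l) = 0 <-> dual_kernel z.
Proof.
have Q0 : (Q%:~R : rat) != 0 by rewrite intr_eq0 gt_eqF // common_denom_gt0.
have row j : (map_mx intr dual_matrix *m (\col_l z l)) j 0 = \sum_(l < k) (dual_entry j l)%:~R * z l.
  by rewrite mxE; apply: eq_bigr => l _; rewrite !mxE.
split=> [e j lj|ker].
  have := congr1 (fun M : 'cV[rat]_n => M (Ordinal lj) 0) e; rewrite [RHS]mxE row dual_entry_sum //.
  by move/eqP; rewrite mulf_eq0 (negPf Q0) /= subr_eq0 => /eqP.
apply/matrixP => j o; rewrite ord1 row dual_entry_sum // ker // subrr mulr0 mxE //.
Qed.

Let B := (2 ^ matrix_bits (integral_data D))%N.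

Lemma data_bound r l : r \in integral_data D -> `|vget r l| <= B%:Z.
Proof. exact: vget_matrix_bits. Qed.

Lemma Q_bound : `|Q| <= B%:Z.
Proof.
have := @data_bound (Q :: mkseq (fun i => clear_denq Q (qget h i)) m) 0.
by rewrite /vget /=; apply; rewrite /integral_data !inE eqxx.
Qed.

Lemma h_bound i : (i < m)%N -> `|clear_denq Q (qget h i)| <= B%:Z.
Proof.
move=> li; have := @data_bound (Q :: mkseq (fun i => clear_denq Q (qget h i)) m) i.+1.
by rewrite /vget /= nth_mkseq // /integral_data !inE eqxx; apply.
Qed.

Lemma dual_entry_bound j l : (j < n)%N -> `|dual_entry j l| <= B%:Z.
Proof.
have B0 : 0 <= B%:Z by [].
move=> lj; rewrite /dual_entry; case: ltnP => lm; last first.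
  case: ifP => _; first by case: eqP => _; rewrite ?normrN ?normr0 ?Q_bound.
  case: ifP => _; first by case: eqP => _; rewrite ?normr0 ?Q_bound.
  have := @data_bound (mkseq (fun j => clear_denq Q (qget c1 j)) n) j.
  by rewrite normrN /vget nth_mkseq // /integral_data !inE eqxx orbT; apply.
have := @data_bound (mkseq (fun j => clear_denq Q (qmget A l j)) n) j.
rewrite /vget nth_mkseq //; apply; rewrite /integral_data !inE; apply/orP; right; apply/orP; right.
by apply/(nthP [::]); exists l; rewrite ?size_mkseq // nth_mkseq.
Qed.

Lemma line_bits_bound : (m * (k`! * B ^ k) * B <= 2 ^ line_bits D)%N /\ (B * (k`! * B ^ k) <= 2 ^ line_bits D)%N.
Proof.
have hk : (k`! * B ^ k <= 2 ^ (k * (k + matrix_bits (integral_data D))))%N.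
  rewrite mulnDr expnD leq_mul //; last by rewrite /B -expnM mulnC.
  apply: leq_trans (fact_le_exp k) _; rewrite expnM leq_exp2r; last by rewrite /k !addnS.
  exact/ltnW/ltn_expl.
have hm : (m <= 2 ^ m)%N by apply/ltnW/ltn_expl.
have -> : (2 ^ line_bits D = 2 ^ m * 2 ^ (k * (k + matrix_bits (integral_data D))) * B)%N by rewrite -!expnD.
split; first exact: leq_mul (leq_mul hm hk) (leqnn _).
rewrite mulnC; apply: leq_mul (leqnn _); rewrite -[X in (X <= _)%N]mul1n.
by apply: leq_mul hk; rewrite expn_gt0.
Qed.

Definition dual_slack (x : nat -> R) (t : R) (l : nat) : R :=
  if (l < m)%N then dotr n (qmget A l) x + ratr (qget h l) * t - ratr (qget b l)
  else if (l - m < n)%N then 1 - x (l - m)%N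
  else if (l - m - n < n)%N then x (l - m - n)%N else 0.

Lemma dual_slack_ge0 x t l : rfeas D t x -> 0 <= dual_slack x t l.
Proof.
move=> [f1 f2 f3]; rewrite /dual_slack; case: ifP => [lm|_]; first by rewrite subr_ge0 f1.
case: ifP => [ln|_]; first by rewrite subr_ge0; case/andP: (f2 _ ln).
by case: ifP => [ln|_] //; case/andP: (f2 _ ln).
Qed.

Definition dual_value (z : nat -> rat) (t : R) : R :=
  \sum_(i < m) ratr (z i) * (ratr (qget b i) - ratr (qget h i) * t) - \sum_(j < n) ratr (z (m + j)%N).

(** Multipliers times slacks add up to the duality gap. For nonnegative [z] this yields weak
    duality, and complementary slackness when the gap is zero. *)
Lemma slack_identity z x t : dual_kernel z ->
  \sum_(l < k) ratr (z l) * dual_slack x t l = ratr (z (m + (n + n))%N) * dotr n (qget c1) x - dual_value z t.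
Proof.
move=> ker; rewrite (sum_dual_blocks m n (fun l => ratr (z l) * dual_slack x t l)) /dual_slack /dual_value.
under eq_bigr => i _ do rewrite ltn_ord.
under [X in _ + (X + _)]eq_bigr => j _ do rewrite !block1 ltn_ord.
under [X in _ + (_ + (X + _))]eq_bigr => j _ do rewrite !block1 !block2 ltn_ord.
rewrite !block1 !block2 ltnn mulr0 addr0.
have -> : ratr (z (m + (n + n))%N) * dotr n (qget c1) x =
    \sum_(i < m) ratr (z i) * dotr n (qmget A i) x - \sum_(j < n) ratr (z (m + j)%N) * x j
    + \sum_(j < n) ratr (z (m + (n + j))%N) * x j.
  have -> : \sum_(i < m) ratr (z i) * dotr n (qmget A i) x =
      \sum_(j < n) ratr (\sum_(i < m) qmget A i j * z i) * x j.
    under eq_bigr => i _ do rewrite /dotr mulr_sumr.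
    rewrite exchange_big /=; apply: eq_bigr => j _; rewrite rmorph_sum mulr_suml.
    by apply: eq_bigr => i _; rewrite rmorphM /=; ring.
  rewrite -sumrB -big_split /= /dotr mulr_sumr; apply: eq_bigr => j _.
  by rewrite mulrA [ratr _ * ratr _]mulrC -rmorphM -(ker j (ltn_ord j)) !(rmorphD, rmorphN) /=; ring.
under eq_bigr => i _ do rewrite -addrA mulrDr.
under [\sum_(i < m) ratr (z i) * (_ - _)]eq_bigr => i _ do rewrite -opprB mulrN.
under [X in _ + (X + _)]eq_bigr => j _ do rewrite mulrBr mulr1.
rewrite big_split /= sumrB sumrN; ring.
Qed.

Lemma last_row : (((m + n).+1 < m)%N = false) * (((m + n).+1 <= m + n)%N = false).
Proof. by rewrite ltnn ltnNge leqW ?leq_addr. Qed.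

Lemma sub_rows_sum (F : nmodType) (f : nat -> F) : \sum_(i < (m + n).+2) f i =
  \sum_(i < m) f i + \sum_(j < n) f (m + j)%N + f (m + n)%N + f (m + n).+1.
Proof. by rewrite !big_ord_recr big_split_ord. Qed.

Lemma line_value (U : nat -> int) (t : R) :
  (\sum_(i < m) U i * clear_denq Q (qget b i) - Q * \sum_(j < n) U (m + j)%N)%:~R -
    (\sum_(i < m) U i * clear_denq Q (qget h i))%:~R * t =
  Q%:~R * dual_value (fun l => (U l)%:~R) t.
Proof.
have ratr_clear (q : rat) (a : int) : a%:~R = q * Q%:~R -> a%:~R = ratr q * Q%:~R :> R.
  by move=> e; rewrite -[LHS]ratr_int e rmorphM /= ratr_int.
rewrite rmorphB rmorphM !rmorph_sum /= /dual_value mulrBr !mulr_sumr mulr_suml addrAC -sumrB.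
congr (_ - _); last by apply: eq_bigr => j _; rewrite ratr_int.
apply: eq_bigr => i _; rewrite [(U i * clear_denq Q (qget b i))%:~R]rmorphM [(U i * clear_denq Q (qget h i))%:~R]rmorphM /=.
rewrite (ratr_clear _ _ (clear_b (ltn_ord i))) (ratr_clear _ _ (clear_h (ltn_ord i))).
by rewrite ratr_int; ring.
Qed.

(** An optimal dual solution at [p] is replaced by a small integral kernel vector supported in it
    and positive at the homogenizing variable. Its dual value is a line below the value function,
    and complementary slackness, which depends only on the support, keeps it tight at [p]. *)
Lemma basic_line_exists p (x0 : nat -> R) : 0 <= p <= 1 -> rfeas D (ratr p) x0 ->
  has_basic_line n (qget c1) (@rfeas R D) (2 ^ line_bits D)%N p (lower_value D p).
Proof.
move=> hp f0.
have [[z0 fz0 ez0] opt0] := lower_valueP hp f0.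
set v := lower_value D p in ez0 opt0 *.
have := lp_solveP (@sub_bounded D (p, p) [::] 0 (extend D (qget c1) 0)).
have hl : 0 <= (0 : R) <= 1 by rewrite lexx ler01.
have := @sub_solve R D (p, p) [::] 0 (extend D (qget c1) 0) hp hp.
case: lp_solve => [xq|]; last first.
  move=> none; case: (none 0 x0 hl _ (no_constraint _ _ _)).
  by rewrite /= subrr mul0r addr0.
rewrite /= !subrr mulr0 addr0 -/n -/m => -[_ fx _ _ _] [_ [y [_ [y0 hy] gap]]].
have ge_v : v <= lin n.+1 (qget (extend D (qget c1) 0)) (qget xq).
  rewrite -[lin _ _ _]/(dotq n.+1 _ _) dotq_extend mul0r addr0 -(ler_rat R) -dotr_embed.
  exact: opt0.
have {gap ge_v}gap := le_trans ge_v gap.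
pose P := sub_program D (p, p) ([::], 0, extend D (qget c1) 0).
(* The multipliers of the constraints and of the bounds on [x], then the dual slacks, then 1 for the
   homogenizing variable. *)
pose z l : rat := if (l < m)%N then y l else if (l - m < n)%N then y l
  else if (l - m - n < n)%N then qget c1 (l - m - n)%N - (\sum_(i < m) y i * qmget A i (l - m - n)%N - y (m + (l - m - n))%N)
  else 1.
have rowsum j : (j < n)%N -> \sum_(i < (m + n).+2) y i * qmget P.1.1.2 i j =
    \sum_(i < m) y i * qmget A i j - y (m + j)%N.
  move=> lj; have lj' : (j < n.+1)%N by rewrite ltnW.
  under eq_bigr => i _ do rewrite sub_entryE //.
  rewrite (sub_rows_sum (fun i => y i * sub_entry D (p, p) [::] i j)) /sub_entry -/m -/n.
  rewrite !block1 !last_row leqnn eqn_add2l (ltn_eqF lj) mulr0 /qget nth_nil mulr0 !addr0.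
  congr (_ + _); first by apply: eq_bigr => i _; rewrite ltn_ord lj.
  rewrite -[RHS]mulN1r; apply: etrans (pick_term (-1) (fun l => y (m + l)%N) lj); apply: eq_bigr => l _.
  by rewrite !block1 leq_add2l ltnW ?ltn_ord // eqn_add2l eq_sym mulrC.
have z_ge0 l : (l < k)%N -> 0 <= z l.
  rewrite /z => lk; case: ifP => lm; first by apply: y0; lia.
  case: ifP => ln; first by apply: y0; lia.
  case: ifP => ls //; have := hy (l - m - n)%N ltac:(by rewrite ltnS ltnW).
  by rewrite [X in X <= _](rowsum _ ls) qget_extend ?ls ?ltnS ?(ltnW ls) // subr_ge0.
have z_ker : dual_kernel z.
  move=> j lj; rewrite /z !block1 !block2 lj ltnn.
  have -> : \sum_(i < m) qmget A i j * (if (i < m)%N then y i else if (i - m < n)%N then y i else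
      if (i - m - n < n)%N then qget c1 (i - m - n)%N - (\sum_(i0 < m) y i0 * qmget A i0 (i - m - n)%N - y (m + (i - m - n))%N) else 1)
     = \sum_(i < m) y i * qmget A i j by apply: eq_bigr => i _; rewrite ltn_ord mulrC.
  by ring.
have z_val : ratr v <= dual_value z (ratr p).
  have -> : dual_value z (ratr p) =
      ratr (\sum_(i < m) y i * (qget b i - qget h i * p) - \sum_(j < n) y (m + j)%N).
    rewrite rmorphB !rmorph_sum /=; congr (_ - _); last first.
      by apply: eq_bigr => j _; rewrite /z !block1 ltn_ord.
    by apply: eq_bigr => i _; rewrite /z ltn_ord !(rmorphM, rmorphB).
  rewrite ler_rat; apply: le_trans gap _.
  rewrite (_ : \sum_(i < _) _ = \sum_(i < (m + n).+2) y i * sub_rhs D p 0 i); last first.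
    by apply: eq_bigr => i _; rewrite /qget nth_mkseq.
  rewrite (sub_rows_sum (fun i => y i * sub_rhs D p 0 i)) /sub_rhs -/m -/n.
  rewrite !block1 !last_row leqnn mulr0 addr0.
  have -> : \sum_(i < m) y i * (if (i < m)%N then qget b i - qget h i * p else if (i <= m + n)%N then -1 else 0) =
      \sum_(i < m) y i * (qget b i - qget h i * p) by apply: eq_bigr => i _; rewrite ltn_ord.
  have -> : \sum_(j < n) y (m + j)%N * (if (m + j < m)%N then qget b (m + j) - qget h (m + j) * p
      else if (m + j <= m + n)%N then -1 else 0) = - \sum_(j < n) y (m + j)%N.
    by rewrite -sumrN; apply: eq_bigr => j _; rewrite block1 leq_add2l ltnW ?ltn_ord // mulrN1.
  (* The multiplier of the bound on [l] is dropped, which can only increase the dual value. *)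
  by rewrite mulrN1 lerBlDr lerDl; apply: y0; lia.
(* These nonnegative terms add up to the duality gap, which is at most 0. *)
have terms0 (l : 'I_k) : ratr (z l) * dual_slack (embed R z0) (ratr p) l = 0.
  have sum0 : \sum_(l < k) ratr (z l) * dual_slack (embed R z0) (ratr p) l = 0.
    apply/eqP; rewrite eq_le sumr_ge0 ?andbT => [|i _]; last by rewrite mulr_ge0 ?ler0q ?z_ge0 ?dual_slack_ge0.
    by rewrite slack_identity // /z !block1 !block2 ltnn rmorph1 mul1r dotr_embed ez0 subr_le0.
  apply: (psumr_eq0P _ sum0) => // i _; by rewrite mulr_ge0 ?ler0q ?z_ge0 ?dual_slack_ge0.
have lk : (m + (n + n) < k)%N by rewrite /k !ltn_add2l.
have B0 : (0 < B)%N by rewrite expn_gt0.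
have [|i|||u [u_ker u_bound u_pos u_supp]] :=
    @circuit n k dual_matrix B (\col_l z l) (Ordinal lk) B0.
- by move=> i l; rewrite mxE dual_entry_bound.
- by rewrite mxE z_ge0.
- exact/dual_matrixP.
- by rewrite mxE /z !block1 !block2 ltnn.
pose U l : int := if insub l is Some o then u o 0 else 0.
have UE (o : 'I_k) : U o = u o 0 by rewrite /U valK.
have U_bound l : 0 <= U l <= (k`! * B ^ k)%N%:Z.
  by rewrite /U; case: insub => [o|]; rewrite ?u_bound.
have U_pos : 0 < U (m + (n + n))%N by rewrite -[(m + _)%N]/(val (Ordinal lk)) UE.
have U_ker : dual_kernel (fun l => (U l)%:~R).
  apply/dual_matrixP; rewrite (_ : \col_l _ = map_mx intr u); first by rewrite -map_mxM u_ker map_mx0.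
  by apply/matrixP => i o; rewrite ord1 !mxE UE.
have Q0 : 0 < (Q%:~R : R) by rewrite ltr0z common_denom_gt0.
have U0 : 0 < ((U (m + (n + n))%N)%:~R : R) by rewrite ltr0z.
(* The line is the dual value divided by the homogenizing entry, with numerator and denominator
   multiplied by [Q] to become integral. *)
pose al := \sum_(i < m) U i * clear_denq Q (qget b i) - Q * \sum_(j < n) U (m + j)%N.
pose be := \sum_(i < m) U i * clear_denq Q (qget h i).
pose de := Q * U (m + (n + n))%N.
have de0 : 0 < de by rewrite mulr_gt0 ?common_denom_gt0.
have deR : 0 < (de%:~R : R) by rewrite ltr0z.
have deE : (de%:~R : R) = Q%:~R * (U (m + (n + n))%N)%:~R by rewrite rmorphM.
have U_abs l : `|U l| <= (k`! * B ^ k)%N%:Z by have /andP [u0 ule] := U_bound l; rewrite ger0_norm.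
have [bound1 bound2] := line_bits_bound.
exists al, be, de; split; first split=> //.
- apply: le_trans (_ : (m * (k`! * B ^ k) * B)%N%:Z <= _); last by rewrite lez_nat.
  apply: le_trans (ler_norm_sum _ _ _) _; apply: le_trans (_ : \sum_(i < m) ((k`! * B ^ k)%N%:Z * B%:Z) <= _).
    by apply: ler_sum => i _; rewrite normrM ler_pM ?h_bound.
  by rewrite sumr_const card_ord -mulr_natl natz -!PoszM mulnA.
- apply: le_trans (_ : (B * (k`! * B ^ k))%N%:Z <= _); last by rewrite lez_nat.
  by rewrite normrM PoszM ler_pM ?Q_bound.
- move=> t x hx; rewrite !fmorph_div !rmorphN /= !ratr_int mulrAC -mulrDl ler_pdivrMr // mulNr.
  have : 0 <= (U (m + (n + n))%N)%:~R * dotr n (qget c1) x - dual_value (fun l => (U l)%:~R) t.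
    have := slack_identity x t U_ker; rewrite ratr_int => <-; apply: sumr_ge0 => l _.
    by rewrite mulr_ge0 ?dual_slack_ge0 // ratr_int ler0z; case/andP: (U_bound l).
  by rewrite line_value deE mulrCA ler_pM2l // subr_ge0 mulrC.
have tight : dual_value (fun l => (U l)%:~R) (ratr p) = (U (m + (n + n))%N)%:~R * ratr v.
  have := slack_identity (embed R z0) (ratr p) U_ker.
  rewrite dotr_embed ez0 ratr_int big1 => [/esym/eqP|l _]; first by rewrite subr_eq0 => /eqP.
  case: (eqVneq (z l) 0) => [zl|zl]; first by rewrite UE u_supp ?mxE // rmorph0 mul0r.
  move/eqP: (terms0 l); rewrite mulf_eq0 fmorph_eq0 (negPf zl) /= => /eqP ->.
  by rewrite mulr0.
have deq : (de%:~R : rat) != 0 by rewrite intr_eq0 gt_eqF.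
apply: (mulfI deq); have -> : de%:~R * (al%:~R / de%:~R + - be%:~R / de%:~R * p) = al%:~R - be%:~R * p.
  by field.
apply: (fmorph_inj (ratr : {rmorphism rat -> R})).
have ratrM (y1 y2 : rat) : ratr (y1 * y2) = ratr y1 * ratr y2 :> R by rewrite rmorphM.
rewrite rmorphB /= ratrM ratrM !ratr_int.
by rewrite line_value tight deE mulrA.
Qed.
End Instance.

(** * Correctness of the local search *)

Lemma neighbours (i N : int) : 0 < N -> 0 <= i <= N ->
  let ia := if i == 0 then 0 else i - 1 in let ib := if i == N then i else i + 1 in
  [/\ 0 <= ia <= N, 0 <= ib <= N, ia <= i <= ib & ia <= ib <= ia + 2%:Z].
Proof. by move=> N0 hi /=; case: eqP => ?; case: eqP => ?; split; lia. Qed.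

Lemma grid_scale (H : nat) (d : int) : (0 < H)%N -> d <= 2%:Z -> (4 * H)%N%:Z * d < (32 * H)%N%:Z - 1.
Proof. by move=> H0 hd; nia. Qed.

Section Instance.
Variables (R : realFieldType) (D : instance).
Let n := D.1.1.1.
Let c1 := D.1.2.1.1.
Let c2 := D.1.2.1.2.
Let c0 := D.1.2.2.
Let V := lower_value D.
Let feas := @rfeas R D.
Let opt := optimal n (qget c1) feas.
Let at_value p := value_at n (qget c1) feas p (V p).

Definition upper_value (t : R) (x : nat -> R) : R := dotr n (qget c2) x + ratr c0 * t.

Lemma objectiveE s : ratr (objective D s) = upper_value (ratr s.2) (embed R (qget s.1)).
Proof. by rewrite /objective /upper_value sumqE dotr_embed rmorphD rmorphM. Qed.

Lemma dotr_opp (v : nat -> rat) (x : nat -> R) : dotr n (fun j => - v j) x = - dotr n v x.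
Proof. by rewrite /dotr -sumrN; apply: eq_bigr => j _; rewrite rmorphN mulNr. Qed.

Lemma dotq_opp (v : nat -> rat) (x : nat -> rat) : dotq n (fun j => - v j) x = - dotq n v x.
Proof. by rewrite /dotq -sumrN; apply: eq_bigr => j _; rewrite mulNr. Qed.

Lemma qget_mkseq (v : nat -> rat) j : (j < n)%N -> qget (mkseq v n) j = v j.
Proof. by move=> lj; rewrite /qget nth_mkseq. Qed.

Lemma dotq_mkseq (v x : nat -> rat) : dotq n v (qget (mkseq x n)) = dotq n v x.
Proof. by apply: eq_bigr => j _; rewrite qget_mkseq. Qed.

(** The extra constraint is exact: the touching line makes every point that satisfies it optimal for
    the lower level, and convexity of the value makes every optimal point satisfy it. *)
Lemma candidateP a b : 0 <= a <= 1 -> 0 <= b <= 1 -> at_value a -> at_value b ->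
  tight_pair n (qget c1) feas a (V a) b (V b) ->
  let s := candidate D (a, b) in
  [/\ size s.1 = n, exists2 l, 0 <= l <= 1 & s.2 = a + l * (b - a),
    opt (ratr s.2) (embed R (qget s.1)) &
    forall (l : R) x', 0 <= l <= 1 -> opt (ratr a + l * (ratr b - ratr a)) x' ->
      ratr (objective D s) <= upper_value (ratr a + l * (ratr b - ratr a)) x'].
Proof.
have aux1 (d va vb l : R) : d <= va + l * (vb - va) -> - va <= - d + (vb - va) * l by lra.
have aux2 (v v' e x l a' b' : R) : v + e * (b' - a') * x <= v' + e * (b' - a') * l ->
  v + e * (a' + x * (b' - a')) <= v' + e * (a' + l * (b' - a')) by lra.
move=> ha hb Va Vb tight s.
pose g := extend D (fun j => - qget c1 j) (V b - V a).
pose o := extend D (qget c2) (c0 * (b - a)).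
have := @sub_solve R D (a, b) g (- V a) o ha hb; rewrite /s /candidate -/g -/o -/V /=.
have hl : 0 <= (0 : R) <= 1 by rewrite lexx ler01.
case: lp_solve => [x|none]; last first.
  case: (Va) => -[z fz ez] _; case: (none 0 (embed R z) hl).
    by rewrite mul0r addr0.
  by rewrite dotr_extend mulr0 addr0 dotr_opp dotr_embed ez rmorphN.
move=> [sx fx xn gx ox]; split=> /=; first by rewrite size_mkseq.
- by exists (qget x n).
- apply: (piece_optimal tight).
    by apply: rfeas_eq fx => j lj; rewrite /embed qget_mkseq.
  rewrite dotq_mkseq; move: gx; rewrite dotq_extend dotq_opp -/n.
  by move: (V a) (V b) (dotq _ _ _) (qget x n) => va vb cx w; lra.
move=> l x' hl' optx'; have up := piece_upper (@rfeas_mix R D) Va Vb hl' optx'.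
have := ox l x' hl' optx'.1; rewrite !dotr_extend !extend_last dotr_opp rmorphN rmorphB /=.
have -> : - ratr (V a) <= - dotr D.1.1.1 (qget c1) x' + (ratr (V b) - ratr (V a)) * l.
  exact: aux1 up.
move=> /(_ isT); rewrite dotq_extend objectiveE /upper_value /= dotr_embed dotq_mkseq -/n -/c2 -/c0.
rewrite !(rmorphD, rmorphM, rmorphB, rmorphN) /=.
exact: aux2.
Qed.

Lemma grid_pointE lu i : grid_point D lu i = lu.1 + (lu.2 - lu.1) * (i%:~R / (pow2 (grid_bits D) - 1)%:~R).
Proof. by []. Qed.

#[local] Opaque lp_solve lower_value qget grid_point.

(** A single point counts as a linear piece, so the values at grid points are instances of
    [candidateP]. *)
Lemma tight_refl p x0 : 0 <= p <= 1 -> feas (ratr p) x0 -> tight_pair n (qget c1) feas p (V p) p (V p).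
Proof.
by move=> hp /(basic_line_exists hp) [al [be [de [[_ _ _ valid] e]]]]; exists (al%:~R / de%:~R), (- be%:~R / de%:~R).
Qed.

(** The tilted function is multiplied by [b - a], which avoids a division and covers [a = b]. *)
Lemma split_pointP a b : 0 <= a <= 1 -> 0 <= b <= 1 -> a <= b -> at_value a -> at_value b ->
  let q := split_point D (a, b) in
  [/\ a <= q <= b, exists x, feas (ratr q) x &
    forall vq, value_at n (qget c1) feas q vq -> forall p vp, a <= p <= b -> value_at n (qget c1) feas p vp ->
      (b - a) * vq - (V b - V a) * q <= (b - a) * vp - (V b - V a) * p].
Proof.
have aux (va vb vq vp x' l' a' b' p' : rat) : l' * (b' - a') = p' - a' ->
    (b' - a') * (vq + (va - vb) * x') <= (b' - a') * (vp + (va - vb) * l') ->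
    (b' - a') * vq - (vb - va) * (a' + x' * (b' - a')) <= (b' - a') * vp - (vb - va) * p'.
  move=> e; have -> : p' = a' + l' * (b' - a') by rewrite e; ring.
  lra.
move=> ha hb ab Va Vb q.
have := @sub_solve R D (a, b) [::] 0 (extend D (qget c1) (V a - V b)) ha hb; rewrite /q /split_point -/V /=.
have hl : 0 <= (0 : R) <= 1 by rewrite lexx ler01.
case: lp_solve => [x|none]; last first.
  case: (Va) => -[z fz ez] _; case: (none 0 (embed R z) hl _ (no_constraint _ _ _)).
  by rewrite mul0r addr0.
move=> [sx fx /andP [x0 x1] _ ox]; rewrite -/n.
have ba : 0 <= b - a by rewrite subr_ge0.
split; first by rewrite lerDl mulr_ge0 //= -lerBrDl ler_piMl.
  by exists (embed R (qget x)).
move=> vq [_ minq] p vp hp [[zp fp ep] _].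
case: (ltrgtP a b) ab => // [ltab _|eab _]; last first.
  by move: hp; rewrite /n -eab !subrr !mul0r.
have ba0 : 0 < b - a by rewrite subr_gt0.
pose l := (p - a) / (b - a).
have hlp : 0 <= (ratr l : R) <= 1.
  rewrite ler0q -[1](rmorph1 ratr) ler_rat; case/andP: hp => ap pb.
  apply/andP; split; first by rewrite /l divr_ge0 ?subr_ge0 ?(ltW ltab).
  by rewrite /l ler_pdivrMr // mul1r lerD2r.
have lE : l * (b - a) = p - a by rewrite divfK // gt_eqF.
have fp' : feas (ratr a + ratr l * (ratr b - ratr a)) (embed R zp).
  by rewrite -rmorphB -rmorphM -rmorphD /= lE addrC subrK.
have := ox _ _ hlp fp' (no_constraint _ _ _).
rewrite dotr_extend extend_last dotq_extend dotr_embed -rmorphM -rmorphD ler_rat -/n -/c1 ep => le1.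
have := minq _ fx; rewrite dotr_embed ler_rat -/n -/c1 => le2.
have le3 : vq + (V a - V b) * qget x n <= vp + (V a - V b) * l by apply: le_trans le1; rewrite lerD2r.
exact: aux lE (ler_wpM2l ba le3).
Qed.

Lemma extreme_pointP s : s != 0 ->
  if extreme_point D s is Some x then
    [/\ 0 <= qget x n <= 1, exists y, feas (ratr (qget x n)) y &
      forall t y, feas t y -> ratr (s * qget x n) <= ratr s * t]
  else forall t y, ~ feas t y.
Proof.
move=> s0; have := @sub_solve R D (0, 1) [::] 0 (extend D (fun=> 0) s); rewrite /extreme_point /=.
rewrite !lexx ler01 => /(_ isT isT).
have par (t : R) : ratr 0 + t * (ratr 1 - ratr 0) = t by rewrite rmorph0 rmorph1 subr0 mulr1 add0r.
have zero (x : nat -> R) : dotr D.1.1.1 (fun=> 0) x = 0.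
  by rewrite /dotr big1 // => j _; rewrite rmorph0 mul0r.
have zeroq x : dotq D.1.1.1 (fun=> 0) x = 0 by rewrite /dotq big1 // => j _; rewrite mul0r.
case: lp_solve => [x [_ fx hx _ ox]|none].
  split=> //; first by exists (embed R (qget x)); move: fx; rewrite subr0 mulr1 add0r.
  move=> t y fy; have ht : 0 <= t <= 1 by case: fy.
  have := ox t y ht; rewrite par => /(_ fy (no_constraint _ _ _)).
  by rewrite dotq_extend zeroq add0r dotr_extend zero add0r extend_last.
move=> t y fy; have ht : 0 <= t <= 1 by case: fy.
by apply: (none t y ht _ (no_constraint _ _ _)); rewrite par.
Qed.

Lemma interval_param (s t e : R) : s <= t <= e -> exists2 l, 0 <= l <= 1 & t = s + l * (e - s).
Proof.
move=> /andP [st te]; case: (ltrgtP s e) (le_trans st te) => // [lt _|eq _].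
  have d0 : 0 < e - s by rewrite subr_gt0.
  exists ((t - s) / (e - s)); last by rewrite divfK ?gt_eqF // addrC subrK.
  by rewrite divr_ge0 ?subr_ge0 ?(ltW lt) //= ler_pdivrMr // mul1r lerD2r.
by exists 0; rewrite ?lexx ?ler01 // mul0r addr0; apply/eqP; rewrite eq_le st eq te.
Qed.

Section Domain.
Variables l u : rat.
Hypotheses (hl : 0 <= l <= 1) (hu : 0 <= u <= 1).
Hypotheses (fl : exists y, feas (ratr l) y) (fu : exists y, feas (ratr u) y).
Hypothesis dom : forall t y, feas t y -> ratr l <= t <= ratr u.
Let K := grid_bits D.
Let N := pow2 K - 1.
Let pt := grid_point D (l, u).

Lemma le_lu : l <= u.
Proof. by have [y /dom] := fl; rewrite !ler_rat => /andP []. Qed.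

Lemma in_unit p : l <= p <= u -> 0 <= p <= 1.
Proof. by move: hl hu => /andP [l0 _] /andP [_ u1] /andP [lp pu]; rewrite (le_trans l0 lp) (le_trans pu u1). Qed.

Lemma domain_feas p : l <= p <= u -> exists x, feas (ratr p) x.
Proof.
move=> hp; have [x fx] := fl; have [y fy] := fu.
have hpR : (ratr l : R) <= (ratr p : R) <= ratr u by rewrite !ler_rat.
have [mu hmu ->] := interval_param hpR.
exists (mix mu x y); rewrite (_ : ratr l + _ = (1 - mu) * ratr l + mu * ratr u); last by ring.
exact: rfeas_mix.
Qed.

Lemma domain_value p : l <= p <= u -> at_value p.
Proof. by move=> hp; have [x fx] := domain_feas hp; apply: lower_valueP (in_unit hp) fx. Qed.

Lemma N_gt0 : 0 < N.
Proof.
rewrite /N /K pow2E /grid_bits addnS expnS subr_gt0 ltz_nat.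
by apply: (@leq_trans (2 * 1)); rewrite // leq_mul2l expn_gt0.
Qed.

Lemma gridE i : pt i = l + (u - l) * (i%:~R / N%:~R).
Proof. by rewrite [LHS]grid_pointE. Qed.

Lemma N0 : 0 < (N%:~R : rat). Proof. by rewrite ltr0z N_gt0. Qed.

Lemma grid_le i j : i <= j -> pt i <= pt j.
Proof.
move=> ij; rewrite !gridE lerD2l ler_wpM2l ?subr_ge0 ?le_lu // ler_wpM2r ?invr_ge0 ?(ltW N0) //.
by rewrite ler_int.
Qed.

Lemma grid_lt i j : l < u -> i < j -> pt i < pt j.
Proof.
move=> lu ij; rewrite !gridE ltrD2l ltr_pM2l ?subr_gt0 // ltr_pM2r ?invr_gt0 ?N0 //.
by rewrite ltr_int.
Qed.

Lemma grid0 : pt 0 = l. Proof. by rewrite gridE mul0r mulr0 addr0. Qed.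
Lemma gridN : pt N = u. Proof. by rewrite gridE divff ?gt_eqF ?N0 // mulr1 addrC subrK. Qed.

Lemma grid_in i : 0 <= i <= N -> l <= pt i <= u.
Proof. by move=> /andP [i0 iN]; rewrite -{1}grid0 -gridN !grid_le. Qed.

Let G := (2 ^ line_bits D)%N.

Lemma grid_small i j : i <= j <= i + 2%:Z ->
  ((2 * (G * G)) * (2 * (G * G)))%N%:R * (pt j - pt i) < 1 :> rat.
Proof.
move=> /andP [ij ji].
have -> : pt j - pt i = (u - l) * ((j - i)%:~R / N%:~R) by rewrite !gridE rmorphB /=; ring.
have d1 : u - l <= 1 by move: hl hu => /andP [l0 _] /andP [_ u1]; rewrite lerBlDr (le_trans u1) // lerDl.
have d0 : 0 <= u - l by rewrite subr_ge0 le_lu.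
have r0 : 0 <= (j - i)%:~R / N%:~R :> rat by rewrite divr_ge0 ?(ltW N0) // ler0z subr_ge0.
apply: (@le_lt_trans _ _ (((2 * (G * G)) * (2 * (G * G)))%N%:R * ((j - i)%:~R / N%:~R))).
  by rewrite ler_wpM2l ?ler0n // ler_piMl.
rewrite mulrA ltr_pdivrMr ?N0 // mul1r.
rewrite -[_%N%:R]/((_%N%:Z)%:~R) -rmorphM ltr_int /=.
have eN : N = (2 ^ (4 * line_bits D + 5))%N%:Z - 1 by rewrite /N /K pow2E.
have e4 : (2 ^ (4 * line_bits D + 5) = 32 * (G * G * (G * G)))%N.
  rewrite expnD [(4 * _)%N]mulnC expnM -/G; move: G => g.
  by rewrite [(g ^ 4)%N]expnS !expnS expn0 muln1; ring.
rewrite eN e4; have : (0 < G * G * (G * G))%N by rewrite !muln_gt0 !expn_gt0.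
have -> : (2 * (G * G) * (2 * (G * G)) = 4 * (G * G * (G * G)))%N by ring.
by move=> H0; apply: grid_scale => //; rewrite lerBlDl.
Qed.

Let phi := grid_value D (l, u).
Let i := grid_minimum D (l, u).
Let ia := if i == 0 then 0 else i - 1.
Let ib := if i == N then i else i + 1.
Let a := pt ia.
Let b := pt ib.
Let q := split_point D (a, b).

Lemma better_le s t : objective D (better D s t) <= objective D s /\ objective D (better D s t) <= objective D t.
Proof. by rewrite /better; case: ltrP => h; split=> //; apply: ltW. Qed.

Lemma grid_candidate j : 0 <= j <= N ->
  let s := candidate D (pt j, pt j) in
  [/\ size s.1 = n, s.2 = pt j, opt (ratr s.2) (embed R (qget s.1)), objective D s = phi j &
    forall x', opt (ratr (pt j)) x' -> ratr (phi j) <= upper_value (ratr (pt j)) x'].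
Proof.
move=> hj s; have hp := grid_in hj; have hp1 := in_unit hp; have Vp := domain_value hp.
have [x fx] := domain_feas hp.
have [sz_s [l' _ e] os ms] := candidateP hp1 hp1 Vp Vp (tight_refl hp1 fx).
split=> //; first by rewrite e subrr mulr0 addr0.
move=> x' ox'; have h0 : 0 <= (0 : R) <= 1 by rewrite lexx ler01.
by have := ms 0 x' h0; rewrite mul0r addr0; apply.
Qed.

Lemma refine_gridP (s := refine_grid D (l, u) i) :
  [/\ size s.1 = n, opt (ratr s.2) (embed R (qget s.1)) &
    exists2 eps : R, 0 < eps & forall t x, opt t x -> `|t - ratr s.2| <= eps ->
      upper_value (ratr s.2) (embed R (qget s.1)) <= upper_value t x].
Proof.
have near1 (t s' e a' : R) : `|t - s'| <= e -> e <= s' - a' -> a' <= t.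
  by rewrite ler_norml => /andP [h _]; lra.
have near2 (t s' e b' : R) : `|t - s'| <= e -> e <= b' - s' -> t <= b'.
  by rewrite ler_norml => /andP [_ h]; lra.
have [er i0 iN1 left right] := search_stepP phi (leqnn K).
rewrite subnn expn0 -[(iter _ _ _).1]/i in i0 iN1 left right.
rewrite -[(2 ^ K)%N%:Z](pow2E K) in iN1 right.
have iN : i <= N by rewrite /N lerBrDr.
have {}right : i = N \/ phi i <= phi (i + 1).
  by case: right => [e|]; [left; rewrite /N -e addrK|rewrite addrK; right].
have hi : 0 <= i <= N by rewrite i0.
have [hia hib iab iab2] := neighbours N_gt0 hi.
have [ia_i i_ib] := andP iab.
have ha := grid_in hia; have hb := grid_in hib.
have ab : a <= b by apply: grid_le (le_trans ia_i i_ib).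
have Va := domain_value ha; have Vb := domain_value hb.
have [/andP [aq qb] fq minq] := split_pointP (in_unit ha) (in_unit hb) ab Va Vb; rewrite -/q in aq qb fq minq.
have sub p : a <= p <= b -> l <= p <= u.
  by move: ha hb => /andP [la _] /andP [_ bu] /andP [ap pb]; rewrite (le_trans la ap) (le_trans pb bu).
have hq : l <= q <= u by apply: sub; rewrite aq.
have Vq := domain_value hq.
have small : ((2 * (G * G)) * (2 * (G * G)))%N%:R * (b - a) < 1.
  exact: grid_small.
have lines p : a <= p <= b -> exists2 vp, value_at n (qget c1) feas p vp & has_basic_line n (qget c1) feas G p vp.
  move=> /sub hp; have [x fx] := domain_feas hp; exists (V p); first exact: domain_value.
  exact: basic_line_exists (in_unit hp) fx.
have [t1 t2] := breakpoint_pieces (@rfeas_mix R D) ab small lines Va Vb Vq ltac:(by rewrite aq) (minq _ Vq).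
have [z1 [l1 hl1 e1] o1 m1] := candidateP (in_unit ha) (in_unit hq) Va Vq t1.
have [z2 [l2 hl2 e2] o2 m2] := candidateP (in_unit hq) (in_unit hb) Vq Vb t2.
have [z0 e0 o0 p0 m0] := grid_candidate hi.
set s1 := candidate D (a, q) in z1 e1 o1 m1.
set s2 := candidate D (q, b) in z2 e2 o2 m2.
set s0 := candidate D (pt i, pt i) in z0 e0 o0 p0.
have es : s = better D (better D s1 s2) s0 by [].
set sm := better D s1 s2 in es.
have between (x y w : rat) : x <= y -> 0 <= w <= 1 -> x <= x + w * (y - x) <= y.
  by rewrite -subr_ge0 => xy /andP [w0 w1]; rewrite lerDl mulr_ge0 //= -lerBrDl ler_piMl.
have [zm om hm] : [/\ size sm.1 = n, opt (ratr sm.2) (embed R (qget sm.1)) & a <= sm.2 <= b].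
  rewrite /sm /better; case: ifP => _; split=> //; rewrite ?e1 ?e2.
    by have /andP [h h'] := between _ _ _ aq hl1; rewrite h (le_trans h' qb).
  by have /andP [h h'] := between _ _ _ qb hl2; rewrite h' (le_trans aq h).
have cover t x : ratr a <= t <= ratr b -> opt t x -> ratr (objective D s) <= upper_value t x.
  have [h1 h2] := better_le s1 s2; have [h3 _] := better_le sm s0; rewrite -es in h3.
  move=> /andP [at_ tb] ox; case: (lerP t (ratr q)) => tq.
    apply: (@le_trans _ _ (ratr (objective D s1))); first by rewrite ler_rat (le_trans h3).
    have /interval_param [w hw et] : ratr a <= t <= ratr q by rewrite at_ tq.
    by rewrite et in ox *; apply: m1.
  apply: (@le_trans _ _ (ratr (objective D s2))); first by rewrite ler_rat (le_trans h3).
  have /interval_param [w hw et] : ratr q <= t <= ratr b by rewrite (ltW tq) tb.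
  by rewrite et in ox *; apply: m2.
have [zs os pos] : [/\ size s.1 = n, opt (ratr s.2) (embed R (qget s.1)) &
    (a < s.2 \/ a = l) /\ (s.2 < b \/ b = u)].
  rewrite es /better; case: ifP => cmp; split=> //; last first.
    rewrite e0; case: (ltrgtP l u) le_lu => // [lu _|lu _]; last first.
      by split; right; apply/eqP; rewrite eq_le; [move: ha|move: hb]; rewrite -lu => /andP [-> ->].
    split; [rewrite /a /ia|rewrite /b /ib]; case: eqP => ei.
    - by right; rewrite grid0.
    - by left; apply: grid_lt; rewrite ?ltrBlDr ?ltrDl.
    - by right; rewrite ei gridN.
    - by left; apply: grid_lt; rewrite ?ltrDl.
  (* Here the winner beats the candidate at [i]. At a neighbouring grid point it could not be better
     than the best value there, which is at least [phi i]; so it can reach an end of the two cells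
     only at the end of the domain. *)
  have [am mb] := andP hm; rewrite p0 in cmp; split.
    case: (ltrgtP a sm.2) am => // [am _|am _]; first by left.
    case: (eqVneq i 0) => [ei|nei]; first by right; rewrite /a /ia ei eqxx grid0.
    have ea : ia = i - 1 by rewrite /ia (negPf nei).
    have [_ _ _ _ ma] := grid_candidate hia.
    have le1 : phi i <= phi ia by case: left nei => [->|]; rewrite ?eqxx // ea.
    have := ma (embed R (qget sm.1)); rewrite -/a am => /(_ om); rewrite -objectiveE ler_rat => le2.
    by move: (lt_le_trans cmp (le_trans le1 le2)); rewrite ltxx.
  case: (ltrgtP sm.2 b) mb => // [mb _|mb _]; first by left.
  case: (eqVneq i N) => [ei|nei]; first by right; rewrite /b /ib ei eqxx gridN.
  have eb : ib = i + 1 by rewrite /ib (negPf nei).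
  have [_ _ _ _ mb'] := grid_candidate hib.
  have le1 : phi i <= phi ib by case: right nei => [->|]; rewrite ?eqxx // eb.
  have := mb' (embed R (qget sm.1)); rewrite -/b -mb => /(_ om); rewrite -objectiveE ler_rat => le2.
  by move: (lt_le_trans cmp (le_trans le1 le2)); rewrite ltxx.
split=> //; case: pos => posa posb.
(* At an end of the domain any radius will do on that side, since no feasible parameter lies
   beyond. *)
have [ea ea0 eaP] : exists2 e : R, 0 < e & a = l \/ e <= ratr s.2 - ratr a.
  case: posa => h; last by exists 1; [exact: ltr01|left].
  by exists (ratr s.2 - ratr a); [rewrite subr_gt0 ltr_rat|right].
have [eb eb0 ebP] : exists2 e : R, 0 < e & b = u \/ e <= ratr b - ratr s.2.
  case: posb => h; last by exists 1; [exact: ltr01|left].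
  by exists (ratr b - ratr s.2); [rewrite subr_gt0 ltr_rat|right].
exists (Num.min ea eb); first by rewrite lt_min ea0.
move=> t x ox; rewrite le_min => /andP [ta tb]; rewrite -objectiveE; apply: cover => //.
have /andP [lt tu] := dom ox.1; apply/andP; split.
  case: eaP => [->|h] //; exact: near1 ta h.
case: ebP => [->|h] //; exact: near2 tb h.
Qed.
End Domain.

Theorem bilevel_solveP :
  if bilevel_solve D is Some s then
    [/\ size s.1 = n, opt (ratr s.2) (embed R (qget s.1)) &
      exists2 eps : R, 0 < eps & forall t x, opt t x -> `|t - ratr s.2| <= eps ->
        upper_value (ratr s.2) (embed R (qget s.1)) <= upper_value t x]
  else forall t x, ~ feas t x.
Proof.
rewrite /bilevel_solve; have := extreme_pointP (oner_neq0 rat).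
case: extreme_point => [x [hx fx mx]|] //.
have := @extreme_pointP (-1) ltac:(by rewrite oppr_eq0 oner_neq0).
case: extreme_point => [y [hy fy my]|] //.
apply: refine_gridP => // t z fz; have := mx t z fz; have := my t z fz.
by rewrite !(rmorphM, rmorphN, rmorph1) /= !mul1r !mulN1r lerN2 => -> ->.
Qed.
End Instance.

(** * Reading instances and writing answers *)

Definition split_step (st : seq (seq bool) * seq bool) (s : symbol) : seq (seq bool) * seq bool :=
  if symbol_code s is Some b then (st.1, b :: st.2) else (st.2 :: st.1, [::]).

Definition read_int (r : seq bool) : int :=
  let d := rev r in int_of_bits (head false d) (behead d).

Definition read_ints (w : seq symbol) : seq int :=
  rev (map read_int (foldl split_step ([::], [::]) w).1).

(** The offset skips the two dimensions; each rational takes two integers. *)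
Definition read_rat (zs : seq int) (r : nat) : rat :=
  mkrat (vget zs (r + r + 2)) (vget zs (r + r + 3)).

(** A dimension is written in binary but serves as a unary loop bound. Capping it by the length of
    the list keeps the conversion polynomial on every word, and it is exact on encodings, which
    contain at least that many integers. *)
Definition read_nat (zs : seq int) (i : nat) : nat :=
  size (filter (fun k => k%:Z < vget zs i) (iota 0 (size zs))).

Definition read_instance (zs : seq int) : instance :=
  let n := read_nat zs 0 in let m := read_nat zs 1 in let q := read_rat zs in
  (n, m, (mkseq q n, mkseq (fun j => q (n + j)%N) n, q (n + n)%N),
   (mkseq (fun i => mkseq (fun j => q (n + n + 1 + (i * n + j))%N) n) m,
    mkseq (fun i => q (n + n + 1 + m * n + i)%N) m,
    mkseq (fun i => q (n + n + 1 + m * n + m + i)%N) m)).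

Definition int_word (z : int) : seq symbol := map Bit (int_neg z :: int_bits z) ++ [:: Sep].

Definition rat_word (q : rat) : seq symbol := int_word (numq q) ++ int_word (denq q).

Definition answer_word (o : option (seq rat * rat)) : seq symbol :=
  if o is Some s then foldl (fun w q => w ++ rat_word q) [::] s.1 ++ rat_word s.2 else [::].

Definition solve_word (w : seq symbol) : seq symbol :=
  answer_word (bilevel_solve (read_instance (read_ints w))).

Lemma PT_symbol_code : PT symbol_code.
Proof. by apply: PT_cast. Qed.

Lemma PT_Bit : PT Bit.
Proof. by apply: (PT_recode (f := fun b : bool => Some b)); [case|pt]. Qed.

#[export] Hint Resolve PT_symbol_code PT_Bit : polytime.

Lemma PT_read_int : PT read_int.
Proof. by rewrite /read_int; cbv zeta; pt. Qed.

#[export] Hint Resolve PT_read_int : polytime.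

Lemma PT_read_ints : PT read_ints.
Proof.
rewrite /read_ints; refine (PT_comp (@PT_rev _ _) _); refine (PT_map (f := fun _ => read_int) _ _); first by pt.
apply: PT_fst; apply: (@PT_foldl_incr _ _ _ _ _ _ (fun=> split_step) (fun=> ([::], [::])) id (fun=> 10%N)).
- by pt.
- by pt.
- rewrite /split_step; apply: (PT_option_case
    (o := fun p : seq symbol * (seq (seq bool) * seq bool) * symbol => symbol_code p.2)
    (g := fun p b => (p.1.2.1, b :: p.1.2.2)) (h := fun p => (p.1.2.2 :: p.1.2.1, [::]))); pt.
- by pb.
move=> a [ws r] l1 s l2 _; rewrite /split_step /=; case: s => [b|] /=; rewrite !sz_pair !sz_cons /=.
  by case: b; rewrite /sz /tsize /=; lia.
have -> : sz ([::] : seq bool) = 1%N by [].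
lia.
Qed.

#[export] Hint Resolve PT_read_ints : polytime.

Lemma PT_read_rat : PT (fun p : seq int * nat => read_rat p.1 p.2).
Proof. by rewrite /read_rat; pt. Qed.

Lemma PT_read_nat : PT (fun p : seq int * nat => read_nat p.1 p.2).
Proof. by rewrite /read_nat; pt. Qed.

#[export] Hint Resolve PT_read_rat PT_read_nat : polytime.

Lemma PT_read_instance : PT read_instance.
Proof. by rewrite /read_instance; cbv zeta; pt. Qed.

#[export] Hint Resolve PT_read_instance : polytime.

Lemma PT_int_word : PT int_word.
Proof. by rewrite /int_word; pt. Qed.

#[export] Hint Resolve PT_int_word : polytime.

Lemma PT_rat_word : PT rat_word.
Proof. by rewrite /rat_word; pt. Qed.

#[export] Hint Resolve PT_rat_word : polytime.

Lemma PT_answer_word : PT answer_word.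
Proof.
rewrite /answer_word; apply: (PT_option_case (o := id)
  (g := fun _ s => foldl (fun w q => w ++ rat_word q) [::] s.1 ++ rat_word s.2) (h := fun=> [::])); [pt| |pt].
apply: (PT_comp2 (h := cat)); [pt| |pt].
have hl : PT (fun p : option (seq rat * rat) * (seq rat * rat) => p.2.1) by pt.
have [g hg le] := PB_sz_mem (f := fun t : (option (seq rat * rat) * (seq rat * rat)) * rat => rat_word t.2) (PT_comp PT_rat_word (PT_snd (PT_id _))) hl.
apply: (@PT_foldl_incr _ _ _ _ _ _ (fun _ w q => w ++ rat_word q) (fun=> [::]) _ g) => //.
- by pt.
- by pt.
move=> a st l1 x l2 e; pose proof (le _ _ _ _ e) as h; apply: leq_trans (leq_add (leqnn _) h).
by pose proof (sz_cat st (rat_word x)) as szh; rewrite -szh leq_addr.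
Qed.

#[export] Hint Resolve PT_answer_word : polytime.

Lemma PT_solve_word : PT solve_word.
Proof. by rewrite /solve_word; pt. Qed.

(** * Correctness of reading and writing *)

Definition int_words (zs : seq int) : seq symbol := flatten (map encode_int zs).

Lemma encode_int_cat z w : encode_int z ++ w = map Bit ((z < 0) :: nat_bits `|z|%N) ++ Sep :: w.
Proof. by rewrite /encode_int -cats1 -catA. Qed.

Lemma split_bits ws r bs w : foldl split_step (ws, r) (map Bit bs ++ w) = foldl split_step (ws, rev bs ++ r) w.
Proof. by elim: bs r => [|b bs IH] r //=; rewrite IH rev_cons cat_rcons. Qed.

Lemma int_of_encoding z : int_of_bits (z < 0) (nat_bits `|z|%N) = z.
Proof. by rewrite /int_of_bits bval_nat_bits; case: ltrP => h; rewrite ?expr1 ?expr0; lia. Qed.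

Lemma read_int_words zs : read_ints (int_words zs) = zs.
Proof.
rewrite /read_ints.
have -> ws : foldl split_step (ws, [::]) (int_words zs) =
    (catrev (map (fun z : int => rev ((z < 0) :: nat_bits `|z|%N)) zs) ws, [::]).
  elim: zs ws => [|z zs IH] ws //; rewrite -[int_words _]/(encode_int z ++ int_words zs) encode_int_cat split_bits.
  by rewrite cats0 /= IH.
rewrite /= catrevE cats0 map_rev revK -map_comp -[RHS]map_id; apply: eq_map => z.
by rewrite /= /read_int revK /= int_of_encoding.
Qed.

Definition rat_ints (qs : seq rat) : seq int := flatten [seq [:: numq q; denq q] | q <- qs].

Definition mx_entries m n (A : 'M[rat]_(m, n)) : seq rat := [seq A i j | i <- enum 'I_m, j <- enum 'I_n].

Definition bilevel_entries (I : bilevel) : seq rat :=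
  mx_entries (Defs.c11 I) ++ (mx_entries (Defs.c21 I) ++ (Defs.c22 I ::
    (mx_entries (Defs.A11 I) ++ (mx_entries (Defs.A12 I) ++ (mx_entries (Defs.b1 I) ++ [::]))))).

Definition bilevel_ints (I : bilevel) : seq int :=
  (nvar I)%:Z :: (ncon I)%:Z :: rat_ints (bilevel_entries I).

Lemma int_words_rat qs : int_words (rat_ints qs) = flatten (map encode_rat qs).
Proof.
elim: qs => // q qs IH; rewrite -[RHS]/(encode_rat q ++ flatten (map encode_rat qs)) -IH.
by rewrite /encode_rat -catA.
Qed.

Lemma encode_mxE m n (A : 'M[rat]_(m, n)) : encode_mx A = flatten (map encode_rat (mx_entries A)).
Proof.
rewrite /encode_mx /mx_entries; elim: (enum 'I_m) => //= i s ->.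
by rewrite map_cat flatten_cat -map_comp.
Qed.

Lemma encode_bilevelE I : encode_bilevel I = int_words (bilevel_ints I).
Proof.
rewrite /bilevel_ints /int_words /= -/(int_words _) int_words_rat /encode_bilevel !encode_mxE.
by rewrite /bilevel_entries !(map_cat, flatten_cat) /= !(map_cat, flatten_cat) /= cats0.
Qed.

Lemma size_rat_ints qs : size (rat_ints qs) = (size qs + size qs)%N.
Proof. by elim: qs => //= q qs ->; rewrite addnS. Qed.

Lemma nth_rat_ints qs r : (r < size qs)%N ->
  nth 0 (rat_ints qs) (r + r) = numq (nth 0 qs r) /\ nth 0 (rat_ints qs) (r + r).+1 = denq (nth 0 qs r).
Proof. by elim: qs r => // q qs IH [|r] //= lt; rewrite addnS; apply: IH. Qed.

Lemma size_mx_entries m n (A : 'M[rat]_(m, n)) : size (mx_entries A) = (m * n)%N.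
Proof. by rewrite size_allpairs !size_enum_ord. Qed.

Lemma nth_blocks (T : Type) (x0 : T) (ss : seq (seq T)) n k j : all (fun s => size s == n) ss -> (k < size ss)%N -> (j < n)%N ->
  nth x0 (flatten ss) (k * n + j) = nth x0 (nth [::] ss k) j.
Proof.
elim: ss k => // s ss IH [|k] /= /andP [/eqP es alls] lk lj; rewrite nth_cat es.
  by rewrite mul0n add0n lj.
by rewrite mulSn -addnA ltnNge leq_addr /= addKn IH.
Qed.

Lemma nth_mx_entries m n (A : 'M[rat]_(m, n)) rest (i : 'I_m) (j : 'I_n) :
  nth 0 (mx_entries A ++ rest) (i * n + j) = A i j.
Proof.
rewrite nth_cat size_mx_entries.
have -> : (i * n + j < m * n)%N.
  by apply: (@leq_trans (i.+1 * n)); rewrite ?leq_mul2r ?ltn_ord ?orbT // mulSn addnC ltn_add2r.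
rewrite /mx_entries nth_blocks //.
- rewrite (nth_map i) ?size_enum_ord // nth_ord_enum (nth_map j) ?size_enum_ord //.
  by rewrite nth_ord_enum.
- by apply/allP => s /mapP [i' _ ->]; rewrite size_map size_enum_ord.
- by rewrite size_map size_enum_ord.
Qed.

Lemma nth_col_entries m (c : 'cV[rat]_m) rest (i : 'I_m) : nth 0 (mx_entries c ++ rest) i = c i 0.
Proof. by rewrite -[nat_of_ord i]muln1 -[(i * 1)%N]addn0; apply: (nth_mx_entries c rest i 0). Qed.

Lemma nth_skip (T : Type) (x0 : T) s rest k l : size s = k -> nth x0 (s ++ rest) (k + l) = nth x0 rest l.
Proof. by move=> <-; rewrite nth_cat ltnNge leq_addr /= addKn. Qed.

Lemma read_nat_eq zs i n : vget zs i = n%:Z -> (n <= size zs)%N -> read_nat zs i = n.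
Proof.
move=> e le; rewrite /read_nat e size_filter -[X in iota 0 X](subnKC le) iotaD count_cat.
rewrite (@eq_in_count _ _ predT) => [|k]; last by rewrite mem_iota /= add0n ltz_nat => ->.
rewrite count_predT size_iota (@eq_in_count _ _ pred0) => [|k]; last first.
  by rewrite mem_iota add0n => /andP [ge _]; rewrite ltz_nat ltnNge ge.
by rewrite count_pred0 addn0.
Qed.

Section Reading.
Variable I : bilevel.
Let zs := bilevel_ints I.
Let n := nvar I.
Let m := ncon I.
Let D := read_instance zs.

Lemma size_entries : size (bilevel_entries I) = (n + (n + (1 + (m * n + (m + m)))))%N.
Proof. by rewrite /bilevel_entries !(size_cat, size_mx_entries) /= !(size_cat, size_mx_entries) !muln1 addn0. Qed.

Lemma read_rat_entry r : (r < size (bilevel_entries I))%N -> read_rat zs r = nth 0 (bilevel_entries I) r.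
Proof.
move=> lt; have [e1 e2] := nth_rat_ints lt.
by rewrite /read_rat /vget /zs /bilevel_ints addn2 addn3 /= e1 e2 /mkrat divq_num_den.
Qed.

Lemma read_nvar : read_nat zs 0 = n.
Proof.
apply: read_nat_eq => //; rewrite /= size_rat_ints size_entries /n /m; move: (nvar I) (ncon I) (_ * _)%N => *; lia.
Qed.

Lemma read_ncon : read_nat zs 1 = m.
Proof.
apply: read_nat_eq => //; rewrite /= size_rat_ints size_entries /n /m; move: (nvar I) (ncon I) (_ * _)%N => *; lia.
Qed.

Lemma read_instanceP : [/\ D.1.1.1 = n, D.1.1.2 = m & [/\
  forall j : 'I_n, qget D.1.2.1.1 j = Defs.c11 I j 0,
  forall j : 'I_n, qget D.1.2.1.2 j = Defs.c21 I j 0,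
  D.1.2.2 = Defs.c22 I &
  [/\ forall (i : 'I_m) (j : 'I_n), qmget D.2.1.1 i j = Defs.A11 I i j,
      forall i : 'I_m, qget D.2.1.2 i = Defs.A12 I i 0 &
      forall i : 'I_m, qget D.2.2 i = Defs.b1 I i 0]]].
Proof.
have sE := size_entries.
have ij (i : 'I_m) (j : 'I_n) : (i * n + j < m * n)%N.
  by apply: (@leq_trans (i.+1 * n)); rewrite ?leq_mul2r ?ltn_ord ?orbT // mulSn addnC ltn_add2r.
have s1 : size (mx_entries (Defs.c11 I)) = n by rewrite size_mx_entries muln1.
have s2 : size (mx_entries (Defs.c21 I)) = n by rewrite size_mx_entries muln1.
have s4 : size (mx_entries (Defs.A11 I)) = (m * n)%N by rewrite size_mx_entries.
have s5 : size (mx_entries (Defs.A12 I)) = m by rewrite size_mx_entries muln1.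
rewrite /D /read_instance; cbv zeta; rewrite read_nvar read_ncon /qmget /qget /=.
split=> //; split=> [j|j||]; last split=> [i j|i|i].
- rewrite nth_mkseq // read_rat_entry; first exact: nth_col_entries.
  by rewrite sE ltn_addr.
- rewrite nth_mkseq // read_rat_entry; first by rewrite /bilevel_entries (nth_skip _ _ _ s1) nth_col_entries.
  by rewrite sE ltn_add2l ltn_addr.
- rewrite read_rat_entry; first by rewrite /bilevel_entries (nth_skip _ _ _ s1) -[X in nth _ _ X]addn0 (nth_skip _ _ _ s2).
  by rewrite sE ltn_add2l -[X in (X < _)%N]addn0 ltn_add2l.
- rewrite nth_mkseq // nth_mkseq // read_rat_entry -!addnA.
    by rewrite /bilevel_entries (nth_skip _ _ _ s1) (nth_skip _ _ _ s2) add1n /= nth_mx_entries.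
  by rewrite sE !ltn_add2l ltn_addr.
- rewrite nth_mkseq // read_rat_entry -!addnA.
    by rewrite /bilevel_entries (nth_skip _ _ _ s1) (nth_skip _ _ _ s2) add1n /= (nth_skip _ _ _ s4) nth_col_entries.
  by rewrite sE !ltn_add2l ltn_addr.
rewrite nth_mkseq // read_rat_entry -!addnA.
  by rewrite /bilevel_entries (nth_skip _ _ _ s1) (nth_skip _ _ _ s2) add1n /= (nth_skip _ _ _ s4) (nth_skip _ _ _ s5) nth_col_entries.
by rewrite sE !ltn_add2l.
Qed.
End Reading.

Lemma int_wordE z : int_word z = encode_int z.
Proof. by rewrite /int_word /encode_int cats1. Qed.

Lemma answer_wordE n (s : seq rat * rat) : size s.1 = n ->
  answer_word (Some s) = encode_answer (Some (\col_(j < n) qget s.1 j, s.2)).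
Proof.
move=> es; rewrite /answer_word /encode_answer encode_mxE.
have -> : mx_entries (\col_(j < n) qget s.1 j) = s.1.
  apply: (@eq_from_nth _ 0); rewrite size_mx_entries muln1 // => j lj.
  by have := nth_col_entries (\col_(j < n) qget s.1 j) [::] (Ordinal lj); rewrite cats0 mxE.
have wordE q : rat_word q = encode_rat q by rewrite /rat_word !int_wordE.
rewrite wordE; congr (_ ++ _); have -> : forall w, foldl (fun w q => w ++ rat_word q) w s.1 = w ++ flatten (map encode_rat s.1) => //.
by elim: (s.1) => [|q l IH] w /=; rewrite ?cats0 // IH -catA wordE.
Qed.

From mathcomp Require Import reals prodnormedzmodule topology normedtype.

(** * From sequences to column vectors over the reals *)

Section Link.
Variables (R : realType) (I : bilevel).
Let n := nvar I.
Let D := read_instance (bilevel_ints I).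

Lemma sum_col (v : nat -> rat) (c : 'cV[rat]_n) (x : 'cV[R]_n) k : k = n ->
  (forall j : 'I_n, v j = c j 0) -> dotr k v (fun_of_col x) = Defs.dot c x.
Proof. by move=> -> e; apply: eq_bigr => j _; rewrite e fun_of_colE. Qed.

Lemma lower_feasibleE t (x : 'cV[R]_n) : @lower_feasible R I t x <-> rfeas D t (fun_of_col x : nat -> R).
Proof.
have [en em [_ _ _ [eA eh eb]]] := read_instanceP I.
have rows (i : 'I_(ncon I)) : dotr D.1.1.1 (qmget D.2.1.1 i) (fun_of_col x) = (map_mx ratr (Defs.A11 I) *m x) i 0.
  by rewrite /dotr en mxE; apply: eq_bigr => j _; rewrite mxE fun_of_colE eA.
split=> -[h1 h2 h3]; split=> //.
- rewrite em => i li; have := h1 (Ordinal li).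
  by rewrite -rows -(eh (Ordinal li)) -(eb (Ordinal li)).
- by rewrite en => j lj; have := h2 (Ordinal lj); rewrite -fun_of_colE.
- by move=> i; have := h1 i; rewrite em ltn_ord rows eh eb; apply.
by move=> j; have := h2 j; rewrite en ltn_ord fun_of_colE; apply.
Qed.

Lemma rfeas_col t (y : nat -> R) : rfeas D t y -> rfeas D t (fun_of_col (\col_(j < n) y j)).
Proof.
have [en _ _] := read_instanceP I.
apply: rfeas_eq; rewrite en => j lj.
by rewrite -[j]/(val (Ordinal lj)) fun_of_colE mxE.
Qed.

Lemma lower_optimalE t (x : 'cV[R]_n) : @lower_optimal R I t x <-> optimal D.1.1.1 (qget D.1.2.1.1) (@rfeas R D) t (fun_of_col x).
Proof.
have [en _ [ec _ _ _]] := read_instanceP I.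
split=> -[fx ox]; split; first exact/lower_feasibleE.
- move=> y fy; have := ox (\col_(j < n) y j); rewrite lower_feasibleE => /(_ (rfeas_col fy)).
  rewrite -!(sum_col _ en ec) => /le_trans; apply; rewrite le_eqVlt; apply/orP; left; apply/eqP.
  by rewrite /dotr en; apply: eq_bigr => j _; rewrite fun_of_colE mxE.
- exact/lower_feasibleE.
by move=> x' /lower_feasibleE fx'; rewrite -!(sum_col _ en ec); apply: ox.
Qed.

Lemma upper_objectiveE (x : 'cV[R]_n * R) : @upper_objective R I x = upper_value D x.2 (fun_of_col x.1).
Proof.
have [en _ [_ ec e0 _]] := read_instanceP I.
by rewrite /upper_objective /upper_value (sum_col _ en ec) e0.
Qed.
End Link.

Theorem theorem2 (R : realType) :
  exists (M : turing_machine symbol) (p : {poly nat}),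
    forall I : bilevel,
      exists o : option ('cV[rat]_(nvar I) * rat),
        tm_outputs_within M (encode_bilevel I)
          p.[size (encode_bilevel I)] (encode_answer o) /\
        match o with
        | Some (x1, x2) =>
            @locally_optimal R I (map_mx ratr x1, ratr x2)
        | None => forall x : 'cV[R]_(nvar I) * R, ~ bilevel_feasible x
        end.
Proof.
have [M [p hM]] := polytime_machine PT_solve_word; exists M, p => I.
have := hM (encode_bilevel I).
have -> : solve_word (encode_bilevel I) = answer_word (bilevel_solve (read_instance (bilevel_ints I))).
  by rewrite /solve_word encode_bilevelE read_int_words.
have [en _ _] := read_instanceP I.
have := bilevel_solveP R (read_instance (bilevel_ints I)).
set D := read_instance _ in en *; case: bilevel_solve => [s|none run]; last first.
  by exists None; split=> // x [/lower_feasibleE fx _]; apply: none fx.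
move=> [ss os [eps eps0 loc]] run; rewrite en in ss.
exists (Some (\col_(j < nvar I) qget s.1 j, s.2)); rewrite -(answer_wordE ss); split=> //.
have same (j : nat) : (j < nvar I)%N -> embed R (qget s.1) j = fun_of_col (map_mx ratr (\col_(j < nvar I) qget s.1 j)) j.
  by move=> lj; rewrite -[j]/(val (Ordinal lj)) fun_of_colE !mxE.
have same_dot v : dotr D.1.1.1 v (embed R (qget s.1)) =
    dotr D.1.1.1 v (fun_of_col (map_mx ratr (\col_(j < nvar I) qget s.1 j))).
  by rewrite /dotr en; apply: eq_bigr => j _; rewrite same.
split; first apply/lower_optimalE.
  case: os => [fx ox]; split; last by move=> x' /ox; rewrite same_dot.
  by apply: rfeas_eq fx; rewrite -/D en.
exists eps => // x /lower_optimalE ox le; rewrite !upper_objectiveE.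
(* The maximum norm dominates the distance of the parameters, which is all that [loc] asks for. *)
have := loc _ _ ox; rewrite /upper_value /= same_dot; apply.
by apply: le_trans le; rewrite prod_normE le_max lexx orbT.
Qed.
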